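(* Let $0<m<M<\infty$ and $\kappa:=M/m$. Let $d\ge 1$ be any dimension, let $f:\mathbb{R}^d\to\mathbb{R}$ be any separable function that is $m$-strongly convex and $M$-smooth, let $x^*$ be the minimizer of $f$, and let $x_0\in\mathbb{R}^d$ be any initialization with $x_0\neq x^*$. Run gradient descent $x_{t+1}=x_t-\alpha_t\nabla f(x_t)$, $t=0,1,2,\dots$, where the inverse stepsizes $\alpha_t^{-1}$ are i.i.d. from the Arcsine distribution on $(m,M)$. Then $$\left(\frac{\|x_n-x^*\|}{\|x_0-x^*\|}\right)^{1/n}\longrightarrow \frac{\sqrt{\kappa}-1}{\sqrt{\kappa}+1}\qquad (n\to\infty),$$ both almost surely and in $L^1$. Moreover, the Arcsine distribution on $(m,M)$ is the unique distribution of i.i.d. inverse stepsizes for which gradient descent achieves this rate (for all such $d$, $f$, $x_0$).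
   Context: A function $f:\mathbb{R}^d\to\mathbb{R}$ is separable if there exist an orthogonal matrix $U\in\mathbb{R}^{d\times d}$ and functions $f_1,\dots,f_d:\mathbb{R}\to\mathbb{R}$ such that $f(x)=\sum_{i=1}^d f_i([Ux]_i)$ for all $x$. ''$M$-smooth'' means differentiable with $M$-Lipschitz gradient (twice differentiability is not assumed). The Arcsine distribution on $(m,M)$ is the probability measure with density $\frac{1}{\pi\sqrt{(M-\beta)(\beta-m)}}$ for $\beta\in(m,M)$ and zero elsewhere. $\|\cdot\|$ is the Euclidean norm. *)

(* Defs.v *)
From HB Require Import structures.
From mathcomp Require Import all_boot all_order all_algebra.
From mathcomp Require Import finmap.
From mathcomp Require Import all_classical all_reals all_analysis.

Set Implicit Arguments.
Unset Strict Implicit.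
Unset Printing Implicit Defensive.

Import Order.TTheory GRing.Theory Num.Theory.
Import numFieldNormedType.Exports.

Local Open Scope classical_set_scope.
Local Open Scope ring_scope.

(* The library norm `|x| on matrices is the sup norm, hence this definition. *)
Definition enorm (R : realType) (d : nat) (x : 'cV[R]_d) : R :=
  Num.sqrt (\sum_(i < d) x i ord0 ^+ 2).

Definition gradient (R : realType) (d : nat) (f : 'cV[R]_d -> R)
    (x : 'cV[R]_d) : 'cV[R]_d :=
  \col_(i < d) 'D_(delta_mx i ord0) f x.

Definition separable (R : realType) (d : nat) (f : 'cV[R]_d -> R) : Prop :=
  exists U : 'M[R]_d, U *m U^T = 1%:M /\
  exists g : 'I_d -> R -> R,
    forall x, f x = \sum_(i < d) g i ((U *m x) i ord0).

Definition smooth (R : realType) (M : R) (d : nat)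
    (f : 'cV[R]_d -> R) : Prop :=
  (forall x, differentiable f x) /\
  (forall x y, enorm (gradient f x - gradient f y) <= M * enorm (x - y)).

Definition strongly_convex (R : realType) (m : R) (d : nat)
    (f : 'cV[R]_d -> R) : Prop :=
  forall (x y : 'cV[R]_d) (t : R), 0 <= t -> t <= 1 ->
    f (t *: x + (1 - t) *: y) <=
      t * f x + (1 - t) * f y - m / 2 * t * (1 - t) * enorm (x - y) ^+ 2.

Definition is_minimizer (R : realType) (d : nat) (f : 'cV[R]_d -> R)
    (xs : 'cV[R]_d) : Prop :=
  forall x, f xs <= f x.

Fixpoint gd (R : realType) (d : nat) (f : 'cV[R]_d -> R) (alpha : nat -> R)
    (x0 : 'cV[R]_d) (n : nat) : 'cV[R]_d :=
  if n is t.+1 then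
    gd f alpha x0 t - alpha t *: gradient f (gd f alpha x0 t)
  else x0.

Definition arcsine_pdf (R : realType) (m M x : R) : R :=
  if m < x < M then (pi * Num.sqrt ((M - x) * (x - m)))^-1 else 0.

Definition arcsine_prob (R : realType) (m M : R) (A : set R) : \bar R :=
  (\int[lebesgue_measure]_(x in A) (arcsine_pdf m M x)%:E)%E.

Definition mutually_independent (R : realType) (dT : measure_display)
    (T : measurableType dT) (P : probability T R)
    (X : nat -> {RV P >-> R}) : Prop :=
  forall (J : {fset nat}) (A : nat -> set R),
    (forall j, measurable (A j)) ->
    P (\bigcap_(j in [set` J]) (X j @^-1` A j)) =
      (\prod_(j <- J) P (X j @^-1` A j))%E.

Definition iid_with_law (R : realType) (dT : measure_display)
    (T : measurableType dT) (P : probability T R)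
    (X : nat -> {RV P >-> R}) (mu : set R -> \bar R) : Prop :=
  mutually_independent X /\
  forall (t : nat) (A : set R), measurable A -> distribution P (X t) A = mu A.

(* (||x_n - x^*|| / ||x_0 - x^*||)^(1/n), the inverse stepsizes being beta. *)
Definition avg_rate (R : realType) (d : nat) (f : 'cV[R]_d -> R)
    (xs x0 : 'cV[R]_d) (beta : nat -> R) (n : nat) : R :=
  (enorm (gd f (fun t => (beta t)^-1) x0 n - xs) / enorm (x0 - xs))
    `^ (n%:R^-1).

Definition accelerated_rate (R : realType) (m M : R) : R :=
  let kappa := M / m in (Num.sqrt kappa - 1) / (Num.sqrt kappa + 1).

Definition achieves_rate (R : realType) (m M : R) (dT : measure_display)
    (T : measurableType dT) (P : probability T R)
    (beta : nat -> {RV P >-> R}) : Prop :=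
  forall (d : nat) (f : 'cV[R]_d -> R) (xs x0 : 'cV[R]_d),
    (1 <= d)%N ->
    separable f -> strongly_convex m f -> smooth M f ->
    is_minimizer f xs -> x0 != xs ->
    let Y n w := avg_rate f xs x0 (fun t => beta t w) n in
    {ae P, forall w, Y n w @[n --> \oo] --> accelerated_rate m M} /\
    (\int[P]_w (`|Y n w - accelerated_rate m M|)%:E)%E @[n --> \oo] --> 0%E.

(* Main.v *)
Require Import Defs.
From HB Require Import structures.
From mathcomp Require Import all_boot all_order all_algebra.
From mathcomp Require Import finmap.
From mathcomp Require Import all_classical all_reals all_analysis.
From mathcomp Require Import measurable_realfun ring lra.

(* If the angle u is uniform on [0, pi], then c + h cos u with c = (m + M) / 2 and
   h = (M - m) / 2 has the arcsine law. The logarithmic potential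
   E ln |t - cos u| is -ln 2 on [-1, 1] and larger outside: since cos 2u has the law
   of cos u, it satisfies I(2 t^2 - 1) = 2 I(t) + ln 2. Hence E ln |1 - lam / beta|
   equals ln rho for every curvature lam in [m, M].

   A separable f decouples into scalar recursions y -> (1 - lam(y) / beta) y with
   lam(y) in [m, M] depending on the state. Uniformly in lam, the moments
   E |1 - lam / beta|^s are at most exp (s ln rho + C s^2) for small s of both signs,
   so by independence E |y_n|^s is at most the n-th power of that bound, and
   Markov's inequality with summability gives the almost sure rate from above and
   below. L1 convergence follows by domination.

   Conversely, on f(x) = lam x^2 / 2 the L1 limit of the rates is
   (E |1 - lam / beta|^(1/n))^n, which tends to the geometric mean, so
   E ln |1 - lam / beta| = ln rho for all lam in [m, M]. Averaging over
   lam = z + 1 / gamma with gamma arcsine on (1 / (M - z), 1 / (m - z)) and using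
   Fubini: z = 0 forces beta in [m, M], because the potential is larger outside, and
   0 < z < m then determines E ln (1 - z / beta), hence all moments of 1 / beta. *)

Set Implicit Arguments.
Unset Strict Implicit.
Unset Printing Implicit Defensive.

Import Order.TTheory GRing.Theory Num.Theory.
Import numFieldNormedType.Exports.

Local Open Scope classical_set_scope.
Local Open Scope ring_scope.

(** The curvature met along a trajectory depends on the past inputs, so the logarithms of the
    successive factors need not be i.i.d. and the law of large numbers does not apply to them. What
    survives is a one-step moment bound that is the same from every state.

    Everything quantitative rests on one estimate: a ball of radius r has arcsine mass O(sqrt r),
    even at the endpoints, so |t - cos u|^(-1/4) has a bounded integral. It controls logarithms and
    the second-order term in s alike.

    Inversion, logarithm and power are total, with [0^-1 = 0], [ln 0 = 0], and 0 to a nonzero power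
    equal to 0. Identities between logarithms therefore hold almost everywhere only, and negative
    moments do not see the state 0, which is excluded separately.

    In the converse, the change of variable comes from 1 - (z + 1/g) / b = w (g - a) / g with w = 1
    - z/b and a = 1 / (b - z). Averaging over g produces an arcsine potential at a, and a lies in
    the support of g when b lies in [m, M]. *)

Lemma ae_mono d (T : measurableType d) (R : realType)
    (mu : {measure set T -> \bar R}) (P Q : T -> Prop) :
  (forall x, P x -> Q x) -> {ae mu, forall x, P x} -> {ae mu, forall x, Q x}.
Proof. by move=> PQ; apply: filterS. Qed.

Lemma ae_mono2 d (T : measurableType d) (R : realType)
    (mu : {measure set T -> \bar R}) (P P' Q : T -> Prop) :
  (forall x, P x -> P' x -> Q x) ->
  {ae mu, forall x, P x} -> {ae mu, forall x, P' x} -> {ae mu, forall x, Q x}.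
Proof. by move=> PQ; apply: filterS2. Qed.

(** Open left rays are stable under intersection, generate the Borel sets, and exhaust the line
    along natural endpoints; finiteness of [m1] on them gives the sigma-finiteness required by
    uniqueness of extension. *)
Lemma eq_measure_ray (R : realType)
    (m1 m2 : {measure set R -> \bar R}) :
  (forall x, m1 `]-oo, x[%classic = m2 `]-oo, x[%classic) ->
  (forall x, m1 `]-oo, x[%classic < +oo)%E ->
  forall A, measurable A -> m1 A = m2 A.
Proof.
move=> m12 m1oo A mA.
have mAs : <<s @RGenInftyO.G R >> A.
  by have := mA; rewrite -[measurable A]/((@ocitv R).-sigma.-measurable A) RGenInftyO.measurableE.
apply: (@g_sigma_algebra_measure_unique _ R R
  (@RGenInftyO.G R) _ (fun n => `]-oo, n%:R[%classic) _ _ m1 m2 _ _ _ A mAs).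
- by move=> _ [x ->]; exact: measurable_itv.
- by move=> i; exists i%:R.
- apply/seteqP; split => // x _.
  exists (Num.truncn `|x|).+1 => //=; rewrite in_itv/=.
  by rewrite (le_lt_trans (ler_norm _))// truncnS_gt.
- move=> _ _ [x ->] [y ->]; exists (Num.min x y).
  by apply/seteqP; split => z /=; rewrite !in_itv/= lt_min => /andP.
- by move=> _ [x ->].
- by [].
Qed.

(** * The arcsine law as the law of a uniform angle *)

Section theta.
Context {R : realType}.

Definition theta : probability (measurableTypeR R) R := uniform_prob (@pi_gt0 R).

Lemma thetaE A : measurable A ->
  theta A = ((pi^-1)%:E * lebesgue_measure (A `&` `[0%R, pi]%classic))%E.
Proof.
move=> mA; rewrite /theta /= /uniform_prob integral_uniform_pdf.
rewrite (eq_integral (fun=> (pi^-1)%:E)); last first.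
  by move=> x; rewrite inE/= => -[_]; rewrite in_itv/= /uniform_pdf => ->; rewrite subr0.
by rewrite integral_cst//; exact: measurableI.
Qed.

Lemma measurable_theta_EFin (F : R -> R) : measurable_fun [set: R] F ->
  @measurable_fun _ _ (measurableTypeR R) (\bar R) setT (fun u => (F u)%:E).
Proof. by move=> mF; have := mF; move/measurable_EFinP. Qed.

Lemma measurable_cosT : measurable_fun [set: R] (@cos R).
Proof. by apply: continuous_measurable_fun; exact: continuous_cos. Qed.

Lemma le_cosE (a u : R) : -1 <= a <= 1 -> 0 <= u <= pi ->
  (a <= cos u) = (u <= acos a).
Proof.
move=> a1 u0; rewrite -{1}(@acosK R a) ?in_itv//= !leNgt.
by rewrite (@ltr_cos R) ?in_itv//= acos_ge0 ?acos_lepi.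
Qed.

Lemma cos_leE (a u : R) : -1 <= a <= 1 -> 0 <= u <= pi ->
  (cos u <= a) = (acos a <= u).
Proof.
move=> a1 u0; rewrite -{1}(@acosK R a) ?in_itv//= !leNgt.
by rewrite (@ltr_cos R) ?in_itv//= acos_ge0 ?acos_lepi.
Qed.

Lemma theta_cos_itv (a b : R) : -1 <= a -> a <= b -> b <= 1 ->
  theta (cos @^-1` `[a, b]) = ((acos a - acos b) / pi)%:E.
Proof.
move=> a1 ab b1.
have aB : -1 <= a <= 1 by rewrite a1 (le_trans ab).
have bB : -1 <= b <= 1 by rewrite b1 (le_trans a1).
rewrite thetaE; last by rewrite -[X in measurable X]setTI; exact: measurable_cosT.
rewrite (_ : _ `&` _ = `[acos b, acos a]%classic); last first.
  apply/seteqP; split => u /=; rewrite !in_itv/=.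
    by move=> [/andP[ac cb] u0]; rewrite -le_cosE// ac -cos_leE// cb.
  move=> /andP[bu ua].
  have u0 : 0 <= u <= pi.
    by rewrite (le_trans _ bu) ?acos_ge0//= (le_trans ua) ?acos_lepi.
  by rewrite le_cosE// cos_leE// ua bu.
rewrite lebesgue_measure_itv/= lte_fin.
have : acos b <= acos a.
  by rewrite -le_cosE ?acos_ge0 ?acos_lepi// acosK// in_itv.
rewrite le_eqVlt => /predU1P[->|->]; first by rewrite ltxx subrr mul0r mule0.
by rewrite -EFinD -EFinM mulrC.
Qed.

Lemma measurable_cos_pm1 :
  measurable ([set u : R | ~ (-1 < cos u < 1)] : set (measurableTypeR R)).
Proof.
rewrite (_ : [set _ | _] = cos @^-1` (~` `]-1, 1[)).
  by rewrite -[X in measurable X]setTI; apply: measurable_cosT => //; exact: measurableC.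
by apply/seteqP; split => u /=; rewrite in_itv/=.
Qed.

(** The density vanishes at [m] and [M], whereas [arc_var] reaches them at the angles pi and 0.
    Discarding these two angles reconciles the open interval of the density with the closed range of
    [arc_var]. *)
Lemma theta_cos_pm1 : theta [set u | ~ (-1 < cos u < 1)] = 0%E.
Proof.
have mS := measurable_cos_pm1.
rewrite thetaE//.
apply/eqP; rewrite mule_eq0; apply/orP; right.
rewrite -measure_le0.
apply: (@le_trans _ _ (lebesgue_measure ([set 0; pi] : set R))).
  apply: le_measure; rewrite ?inE//; [exact: measurableI| |].
    by apply: measurableU; exact: measurable_set1.
  move=> u /= [/negP]; rewrite negb_and -!leNgt in_itv/= => /orP[c1 u0|c1 u0].
    right; apply: cos_inj; rewrite ?in_itv//= ?pi_ge0 ?lexx//.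
    by rewrite cospi; apply/le_anti; rewrite c1 cos_geN1.
  left; apply: cos_inj; rewrite ?in_itv//= ?pi_ge0 ?lexx//.
  by rewrite cos0; apply/le_anti; rewrite c1 cos_le1.
rewrite measure_le0; apply/eqP; apply: countable_lebesgue_measure0.
by apply: finite_set_countable; exact: finite_set2.
Qed.

End theta.

(** Inversion is total with [0^-1 = 0] and discontinuous there; off 0, an open set, continuity gives
    measurability. *)
Lemma measurable_invr (R : realType) : measurable_fun [set: R] (@GRing.inv R).
Proof.
have -> : @GRing.inv R = fun x => if x == 0 then 0 else x^-1.
  by apply/funext => x; case: eqP => // ->; rewrite invr0.
apply: measurable_fun_if => //.
  exact: measurable_fun_eqr.
have -> : [set: R] `&` (fun t : R => t == 0) @^-1` [set false] = [set x | x != 0].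
  by apply/seteqP; split => x /=; [case=> _ ->|move=> /negbTE].
apply: open_continuous_measurable_fun; first exact: open_neq.
by move=> x /set_mem /= x0; exact: inv_continuous.
Qed.

Section arcsine.
Context {R : realType} (m M : R).
Hypothesis mM : m < M.

Lemma arcsine_pdf_ge0 x : 0 <= arcsine_pdf m M x.
Proof.
rewrite /arcsine_pdf; case: ifP => // _.
by rewrite invr_ge0 mulr_ge0// ?pi_ge0// sqrtr_ge0.
Qed.

Lemma measurable_arcsine_pdf : measurable_fun [set: R] (arcsine_pdf m M).
Proof.
rewrite /arcsine_pdf; apply: measurable_fun_ifT => //=.
  by apply: measurable_and => /=; apply: measurable_fun_ltr.
apply: measurableT_comp; first exact: measurable_invr.
apply: measurable_funM => //.
apply: measurableT_comp; first by apply: continuous_measurable_fun; exact: sqrt_continuous.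
by apply: measurable_funM; apply: measurable_funB.
Qed.

Let arcsine0 : arcsine_prob m M set0 = 0%E.
Proof. by rewrite /arcsine_prob integral_set0. Qed.

Let arcsine_ge0 A : (0 <= arcsine_prob m M A)%E.
Proof. by apply: integral_ge0 => /= x Ax; rewrite lee_fin arcsine_pdf_ge0. Qed.

Let arcsine_sigma_additive : semi_sigma_additive (arcsine_prob m M).
Proof.
move=> /= F mF tF mUF; rewrite /arcsine_prob; apply: cvg_toP.
  apply: ereal_nondecreasing_is_cvgn => k n kn.
  apply: lee_sum_nneg_natr => // i _ _.
  by apply: integral_ge0 => /= x Fkx; rewrite lee_fin arcsine_pdf_ge0.
rewrite ge0_integral_bigcup//=.
- by apply/measurable_funTS/measurableT_comp => //; exact: measurable_arcsine_pdf.
- by move=> x _; rewrite lee_fin arcsine_pdf_ge0.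
Qed.

HB.instance Definition _ := isMeasure.Build _ _ _ (arcsine_prob m M)
  arcsine0 arcsine_ge0 arcsine_sigma_additive.

Definition arc_var (u : R) := (m + M) / 2 + (M - m) / 2 * cos u.

Lemma measurable_arc_var : measurable_fun [set: R] arc_var.
Proof.
by apply: measurable_funD => //; apply: measurable_funM => //; exact: measurable_cosT.
Qed.

Let mpre (A : set R) : measurable A ->
  measurable (arc_var @^-1` A : set (measurableTypeR R)).
Proof.
by move=> mA; rewrite -[X in measurable X]setTI; apply: measurable_arc_var.
Qed.

Let s (x : R) := (2 * x - (m + M)) / (M - m).

Let s_itv x : m < x < M -> -1 < s x < 1.
Proof.
move=> /andP[mx xM]; rewrite ltr_pdivlMr ?subr_gt0// ltr_pdivrMr ?subr_gt0//.
by apply/andP; split; lra.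
Qed.

(** The density blows up at both ends of []m, M[], so the fundamental theorem of calculus is applied
    strictly inside, where - acos (s x) / pi is a primitive. *)
Let arcsine_prob_itvcc (a b : R) : m < a -> a < b -> b < M ->
  arcsine_prob m M `[a, b] = theta (arc_var @^-1` `[a, b]).
Proof.
move=> ma ab bM.
have Mm0 : 0 < M - m by rewrite subr_gt0.
have -> : arc_var @^-1` `[a, b] = cos @^-1` `[s a, s b].
  apply/seteqP; split => u /=; rewrite !in_itv/= /arc_var /s ler_pdivrMr// ler_pdivlMr//;
    by move=> /andP[? ?]; apply/andP; split; lra.
have /andP[sa1 sa2] : -1 < s a < 1 by apply: s_itv; rewrite ma (lt_trans ab).
have /andP[sb1 sb2] : -1 < s b < 1 by apply: s_itv; rewrite bM (lt_trans ma).
rewrite theta_cos_itv//; [|exact: ltW| |exact: ltW]; last first.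
  by rewrite /s ler_pM2r ?invr_gt0//; lra.
rewrite /arcsine_prob.
pose g x : R := (pi * Num.sqrt ((M - x) * (x - m)))^-1.
transitivity (\int[lebesgue_measure]_(x in `[a, b]) (g x)%:E)%E.
  apply: eq_integral => x; rewrite inE/= in_itv/= /arcsine_pdf => /andP[ax xb].
  by rewrite (lt_le_trans ma ax) (le_lt_trans xb bM).
pose F x := - (pi^-1 * acos (s x)).
have dF x : m < x < M -> is_derive x 1 F (g x).
  move=> mxM.
  have sx := s_itv mxM.
  have ds : is_derive x 1 s (2 / (M - m)).
    have -> : s = (fun x => (2 / (M - m)) * x - (m + M) / (M - m)).
      by apply/funext => z; rewrite /s mulrBl mulrAC.
    by apply: is_derive_eq; rewrite /GRing.scale/=; ring.
  have da : is_derive (s x) 1 (@acos R) (- (Num.sqrt (1 - (s x) ^+ 2))^-1).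
    exact: is_derive1_acos.
  have dc := is_derive1_comp da ds.
  have -> : F = (- pi^-1) \*: (@acos R \o s).
    by apply/funext => z; rewrite /F /= /GRing.scale/= mulNr.
  apply: is_derive_eq; rewrite /GRing.scale/= /g.
  have -> : (M - x) * (x - m) = ((M - m) / 2) ^+ 2 * (1 - (s x) ^+ 2).
    by rewrite /s; field; rewrite gt_eqF.
  rewrite sqrtrM ?sqr_ge0// sqrtr_sqr ger0_norm; last by rewrite divr_ge0// ltW.
  have q0 : Num.sqrt (1 - s x ^+ 2) != 0.
    case/andP: sx => ? ?; rewrite gt_eqF// sqrtr_gt0; nra.
  have p0 : pi != 0 :> R by rewrite gt_eqF ?pi_gt0.
  have M0 : M - m != 0 by rewrite gt_eqF.
  by move: (@pi R) p0 => p p0; field; rewrite q0 M0 p0.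
have cF x : m < x < M -> {for x, continuous F}.
  move=> /dF dFx; apply/differentiable_continuous/derivable1_diffP.
  by case: dFx.
rewrite (@continuous_FTC2 _ _ F)//.
- by rewrite /F -EFinB; congr EFin; rewrite mulrBl opprK addrC !(mulrC pi^-1).
- apply: continuous_in_subspaceT => x; rewrite inE/= in_itv/= => /andP[ax xb].
  have max := lt_le_trans ma ax; have xbM := le_lt_trans xb bM.
  apply: (@cvgV R R); first by rewrite mulf_neq0 ?gt_eqF ?pi_gt0// sqrtr_gt0 mulr_gt0// subr_gt0.
  apply: cvgM; first exact: cvg_cst.
  apply: (@continuous_comp _ _ _ (fun x => (M - x) * (x - m)) (@Num.sqrt R)); last exact: sqrt_continuous.
  by apply: cvgM; apply: cvgB; [exact: cvg_cst|exact: cvg_id|exact: cvg_id|exact: cvg_cst].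
- split.
  + move=> x; rewrite in_itv/= => /andP[ax xb].
    by apply: ex_derive; apply: dF; rewrite (lt_trans ma ax) (lt_trans xb bM).
  + by apply: cvg_at_right_filter; apply: cF; rewrite ma (lt_trans ab).
  + by apply: cvg_at_left_filter; apply: cF; rewrite bM (lt_trans ma).
- move=> x; rewrite in_itv/= => /andP[ax xb]; rewrite derive1E.
  by apply: derive_val; apply: dF; rewrite (lt_trans ma ax) (lt_trans xb bM).
Qed.

Let arcsine_prob_itvoo (b : R) : m < b <= M ->
  arcsine_prob m M `]m, b[ = theta (arc_var @^-1` `]m, b[).
Proof.
move=> /andP[mb bM].
(* The offset 3 keeps 2 * k n strictly below b - m, so every [J n] is a nondegenerate interval, as
   [arcsine_prob_itvcc] requires. *)
pose k n : R := (b - m) / (n.+3)%:R.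
have k0 n : 0 < k n by rewrite divr_gt0// subr_gt0.
have k3 n : k n * 3 <= b - m.
  rewrite /k -mulrA -[leRHS]mulr1 ler_pM2l ?subr_gt0// mulrC ler_pdivrMr//.
  by rewrite mul1r ler_nat.
pose J n := `[m + k n, b - k n]%classic.
have JU : \bigcup_n J n = `]m, b[%classic.
  apply/seteqP; split => x /=.
    move=> [n _]; rewrite /J/= !in_itv/= => /andP[x1 x2].
    have := k0 n; move=> ?; apply/andP; split; lra.
  rewrite in_itv/= => /andP[mx xb].
  pose e := Num.min (x - m) (b - x).
  have e0 : 0 < e by rewrite lt_min !subr_gt0 mx.
  exists (Num.truncn ((b - m) / e)) => //=.
  set n := Num.truncn _.
  have kn : k n <= e.
    rewrite ler_pdivrMr// mulrC -ler_pdivrMr//.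
    apply: (@le_trans _ _ n.+1%:R); first by rewrite ltW// truncnS_gt.
    by rewrite ler_nat ltnW.
  have /andP[? ?] : (k n <= x - m) && (k n <= b - x) by rewrite -le_min.
  by rewrite /J/= in_itv/=; apply/andP; split; lra.
have mJ n : measurable (J n) by exact: measurable_itv.
have ndJ : nondecreasing_seq J.
  move=> p q pq; apply/subsetPset => x; rewrite /J /= !in_itv/= => /andP[x1 x2].
  have kpq : k q <= k p by rewrite ler_pM2l ?subr_gt0// lef_pV2 ?posrE// ler_nat.
  by apply/andP; split; lra.
pose th := pushforward theta arc_var.
have JE n : arcsine_prob m M (J n) = theta (arc_var @^-1` J n).
  have := k0 n; have := k3 n => ? ?.
  by apply: arcsine_prob_itvcc; lra.
rewrite -JU.
have c1 : arcsine_prob m M (J n) @[n --> \oo] --> arcsine_prob m M (\bigcup_n J n).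
  by apply: nondecreasing_cvg_mu => //; apply: bigcupT_measurable => n; exact: mJ.
have c2 : arcsine_prob m M (J n) @[n --> \oo] --> theta (arc_var @^-1` (\bigcup_n J n)).
  under eq_fun do rewrite JE.
  rewrite preimage_bigcup; apply: nondecreasing_cvg_mu.
  - by move=> n; exact: mpre.
  - by apply: bigcup_measurable => n _; exact: mpre.
  - by move=> p q /ndJ /subsetPset pq; apply/subsetPset => x; exact: pq.
by rewrite -(cvg_lim _ c1)// -(cvg_lim _ c2).
Qed.

Lemma arcsine_prob_ray x :
  arcsine_prob m M `]-oo, x[ = theta (arc_var @^-1` `]-oo, x[).
Proof.
have Mm0 : 0 < M - m by rewrite subr_gt0.
pose b := Num.min x M.
have -> : arcsine_prob m M `]-oo, x[ = arcsine_prob m M `]m, b[.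
  rewrite /arcsine_prob [LHS]integral_mkcond [RHS]integral_mkcond.
  apply: eq_integral => z _; rewrite !patchE /= !mem_setE !in_itv/= /arcsine_pdf lt_min.
  by case: (m < z) => //=; case: (z < M); rewrite ?andbT ?andbF//=; case: (z < x).
have -> : theta (arc_var @^-1` `]-oo, x[) = theta (arc_var @^-1` `]m, b[).
  apply/eqP; rewrite eq_le; apply/andP; split; last first.
    apply: le_measure; rewrite ?inE; [exact: mpre|exact: mpre|].
    by move=> u /=; rewrite !in_itv/= lt_min => /andP[_ /andP[]].
  rewrite -[leRHS]adde0 -(@theta_cos_pm1 R).
  apply: (@le_trans _ _ (theta ((arc_var @^-1` `]m, b[) `|` [set u | ~ (-1 < cos u < 1)]))).
    apply: le_measure; rewrite ?inE; [exact: mpre| |].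
      by apply: measurableU; [exact: mpre|exact: measurable_cos_pm1].
    move=> u /=; rewrite !in_itv/= lt_min => ux.
    have [/andP[c1 c2]|?] := pselect (-1 < cos u < 1); [left|by right].
    by rewrite ux/= /arc_var; apply/andP; split; nra.
  by apply: measureU2; [exact: mpre|exact: measurable_cos_pm1].
have [mb|bm] := ltP m b.
  by apply: arcsine_prob_itvoo; rewrite mb ge_min lexx orbT.
by rewrite !set_itv_ge ?preimage_set0 ?measure0// bnd_simp -leNgt.
Qed.

End arcsine.

Section arcsine_law.
Context {R : realType} (m M : R) (mM : m < M).

Let marc : @measurable_fun _ _ (measurableTypeR R) R setT (arc_var m M).
Proof. exact: measurable_arc_var. Qed.
Let arc_isMF := @isMeasurableFun.Build _ _ (measurableTypeR R) R (arc_var m M) marc.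
Definition arc_rv : {RV (@theta R) >-> R} := HB.pack (arc_var m M) arc_isMF.

Lemma arcsine_probE (A : set R) : measurable A ->
  arcsine_prob m M A = theta (arc_var m M @^-1` A).
Proof.
move=> mA; rewrite -[RHS]/(distribution theta arc_rv A).
apply: (@eq_measure_ray R (arcsine_prob m M) (distribution theta arc_rv)) => // x.
  exact: arcsine_prob_ray.
apply: (@le_lt_trans _ _ 1%E); last exact: ltry.
apply: le_trans (@probability_le1 _ _ _ (distribution theta arc_rv) `]-oo, x[ _) => //.
by rewrite le_eqVlt; apply/orP; left; apply/eqP; exact: arcsine_prob_ray.
Qed.

Lemma ge0_integral_arcsine (mu : {measure set R -> \bar R}) (F : R -> \bar R) :
  (forall A, measurable A -> mu A = arcsine_prob m M A) ->
  measurable_fun setT F -> (forall x, 0 <= F x)%E ->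
  (\int[mu]_x F x = \int[theta]_u F (arc_var m M u))%E.
Proof.
move=> muE mF F0.
transitivity (\int[distribution theta arc_rv]_x F x)%E.
  by apply: eq_measure_integral => A mA _; rewrite muE// arcsine_probE.
by rewrite ge0_integral_pushforward// preimage_setT.
Qed.

Lemma integrable_arcsine (mu : {measure set R -> \bar R}) (F : R -> \bar R) :
  (forall A, measurable A -> mu A = arcsine_prob m M A) ->
  measurable_fun setT F ->
  theta.-integrable setT (F \o arc_var m M) -> mu.-integrable setT F.
Proof.
move=> muE mF /integrableP[_ iF]; apply/integrableP; split => //.
rewrite (ge0_integral_arcsine muE)//.
exact: measurableT_comp.
Qed.

Lemma integral_arcsine (mu : {measure set R -> \bar R}) (F : R -> \bar R) :
  (forall A, measurable A -> mu A = arcsine_prob m M A) ->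
  measurable_fun setT F ->
  theta.-integrable setT (F \o arc_var m M) ->
  (\int[mu]_x F x = \int[theta]_u F (arc_var m M u))%E.
Proof.
move=> muE mF iF.
transitivity (\int[distribution theta arc_rv]_x F x)%E.
  by apply: eq_measure_integral => A mA _; rewrite muE// arcsine_probE.
by rewrite integral_pushforward// preimage_setT.
Qed.

End arcsine_law.

Section invariance.
Context {R : realType}.
Local Notation th := (@theta R).

Let mth (F : R -> R) : measurable_fun [set: R] F ->
  @measurable_fun _ _ (measurableTypeR R) R setT F.
Proof. by []. Qed.

Definition theta_rv (F : R -> R) (mF : measurable_fun [set: R] F) : {RV th >-> R} :=
  HB.pack F (@isMeasurableFun.Build _ _ (measurableTypeR R) R F (mth mF)).

Lemma ge0_integral_theta_eq (X Y : R -> R) :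
  measurable_fun [set: R] X -> measurable_fun [set: R] Y ->
  (forall x, th (X @^-1` `]-oo, x[) = th (Y @^-1` `]-oo, x[)) ->
  forall F : R -> \bar R, measurable_fun setT F -> (forall x, 0 <= F x)%E ->
  (\int[th]_u F (X u) = \int[th]_u F (Y u))%E.
Proof.
move=> mX mY XY F mF F0.
transitivity (\int[distribution th (theta_rv mX)]_x F x)%E.
  by rewrite ge0_integral_pushforward// preimage_setT.
transitivity (\int[distribution th (theta_rv mY)]_x F x)%E; last first.
  by rewrite ge0_integral_pushforward// preimage_setT.
apply: eq_measure_integral => A mA _.
apply: (@eq_measure_ray R (distribution th (theta_rv mX)) (distribution th (theta_rv mY))) => // x.
by apply: (@le_lt_trans _ _ 1%E); [exact: probability_le1|exact: ltry].
Qed.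

Let mcos2 : measurable_fun [set: R] (fun u : R => cos (2 * u)).
Proof.
by apply: measurableT_comp; [exact: measurable_cosT|exact: measurable_funM].
Qed.

Let mcosN : measurable_fun [set: R] (fun u : R => - cos u).
Proof. by apply: measurableT_comp => //; exact: measurable_cosT. Qed.

Let mpre (F : R -> R) (A : set R) : measurable_fun [set: R] F -> measurable A ->
  measurable (F @^-1` A : set (measurableTypeR R)).
Proof.
by move=> mF mA; rewrite -[X in measurable X]setTI; apply: mF.
Qed.

Let theta_itv (F : R -> R) (x a b : R) : measurable_fun [set: R] F ->
  0 <= a -> a <= b -> b <= pi ->
  (forall u, 0 <= u <= pi -> (F u < x) = (a < u < b)) ->
  th (F @^-1` `]-oo, x[) = ((b - a) / pi)%:E.
Proof.
move=> mF a0 ab bp FE; rewrite thetaE; last exact: mpre.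
rewrite (_ : _ `&` _ = `]a, b[%classic); last first.
  apply/seteqP; split => u /=; rewrite !in_itv/=.
    by move=> [Fx u0]; rewrite -FE.
  move=> /andP[au ub].
  have u0 : 0 <= u <= pi by rewrite (le_trans a0 (ltW au)) (le_trans (ltW ub)).
  by rewrite FE// au ub.
rewrite lebesgue_measure_itv/= lte_fin.
move: ab; rewrite le_eqVlt => /predU1P[->|->]; first by rewrite ltxx subrr mul0r mule0.
by rewrite -EFinD -EFinM mulrC.
Qed.

Let theta_itvc (F : R -> R) (x a : R) : measurable_fun [set: R] F ->
  0 <= a -> a <= pi ->
  (forall u, 0 <= u <= pi -> (F u < x) = (a < u)) ->
  th (F @^-1` `]-oo, x[) = ((pi - a) / pi)%:E.
Proof.
move=> mF a0 ap FE; rewrite thetaE; last exact: mpre.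
rewrite (_ : _ `&` _ = `]a, pi]%classic); last first.
  apply/seteqP; split => u /=; rewrite !in_itv/=.
    by move=> [Fx u0]; rewrite -FE// Fx; case/andP: u0.
  move=> /andP[au ub].
  have u0 : 0 <= u <= pi by rewrite (le_trans a0 (ltW au)).
  by rewrite FE// au.
rewrite lebesgue_measure_itv/= lte_fin.
move: ap; rewrite le_eqVlt => /predU1P[->|->]; first by rewrite ltxx subrr mul0r mule0.
by rewrite -EFinD -EFinM mulrC.
Qed.

Let theta_itvl (F : R -> R) (x b : R) : measurable_fun [set: R] F ->
  0 <= b -> b <= pi ->
  (forall u, 0 <= u <= pi -> (F u < x) = (u < b)) ->
  th (F @^-1` `]-oo, x[) = (b / pi)%:E.
Proof.
move=> mF b0 bp FE; rewrite thetaE; last exact: mpre.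
rewrite (_ : _ `&` _ = `[0, b[%classic); last first.
  apply/seteqP; split => u /=; rewrite !in_itv/=.
    by move=> [Fx u0]; rewrite -FE// Fx; case/andP: u0 => ->.
  move=> /andP[u0 ub].
  have u0p : 0 <= u <= pi by rewrite u0 (le_trans (ltW ub)).
  by rewrite FE// ub.
rewrite lebesgue_measure_itv/= lte_fin.
move: b0; rewrite le_eqVlt => /predU1P[<-|->]; first by rewrite ltxx mul0r mule0.
by rewrite -EFinD -EFinM mulrC subr0.
Qed.

Let theta_all (F : R -> R) (x : R) : measurable_fun [set: R] F ->
  (forall u, F u < x) -> th (F @^-1` `]-oo, x[) = 1%:E.
Proof.
move=> mF Fx; rewrite (_ : _ @^-1` _ = setT); first exact: probability_setT.
by apply/seteqP; split => // u _; rewrite /= in_itv/=; exact: Fx.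
Qed.

Let theta_none (F : R -> R) (x : R) : measurable_fun [set: R] F ->
  (forall u, x <= F u) -> th (F @^-1` `]-oo, x[) = 0%:E.
Proof.
move=> mF Fx; rewrite (_ : _ @^-1` _ = set0); first exact: measure0.
by apply/seteqP; split => // u; rewrite /= in_itv/= ltNge Fx.
Qed.

(** The reflection u |-> pi - u, read on distribution functions. *)
Lemma theta_cosN x : th ((fun u => - cos u) @^-1` `]-oo, x[) = th (cos @^-1` `]-oo, x[).
Proof.
have [x1|x1] := ltP 1 x.
  rewrite !theta_all//; [exact: measurable_cosT|by move=> u; rewrite (le_lt_trans (cos_le1 u))|].
  by move=> u; rewrite (le_lt_trans _ x1)// lerNl cos_geN1.
have [x1'|x1'] := leP x (- 1).
  rewrite !theta_none//; [exact: measurable_cosT|by move=> u; rewrite (le_trans x1')// cos_geN1|].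
  by move=> u; rewrite (le_trans x1')// lerN2 cos_le1.
have xB : -1 <= x <= 1 by rewrite ltW.
have NxB : -1 <= -x <= 1 by rewrite lerN2 x1/= lerNl ltW.
rewrite (@theta_itvc cos x (acos x)) ?acos_ge0 ?acos_lepi//; last 2 first.
- exact: measurable_cosT.
- by move=> u u0; rewrite !ltNge le_cosE.
rewrite (@theta_itvl _ x (acos (- x))) ?acos_ge0 ?acos_lepi//.
  by rewrite acosN.
by move=> u u0; rewrite ltrNl !ltNge cos_leE.
Qed.

(** Doubling the angle covers the range of cos twice: for x in ]-1, 1], cos (2 u) < x exactly on
    []acos x / 2, pi - acos x / 2[], whose length pi - acos x is also that of the set cos u < x. *)
Lemma theta_cos2 x : th ((fun u => cos (2 * u)) @^-1` `]-oo, x[) = th (cos @^-1` `]-oo, x[).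
Proof.
have [x1|x1] := ltP 1 x.
  rewrite !theta_all//; [exact: measurable_cosT|by move=> u; rewrite (le_lt_trans (cos_le1 _))|].
  by move=> u; rewrite (le_lt_trans (cos_le1 _)).
have [x1'|x1'] := leP x (- 1).
  by rewrite !theta_none//; [exact: measurable_cosT| |]; move=> u; rewrite (le_trans x1')// cos_geN1.
have xB : -1 <= x <= 1 by rewrite ltW.
rewrite (@theta_itvc cos x (acos x)) ?acos_ge0 ?acos_lepi//; last 2 first.
- exact: measurable_cosT.
- by move=> u u0; rewrite !ltNge le_cosE.
have a0 := acos_ge0 xB. have ap := acos_lepi xB.
have p0 := pi_gt0 R.
rewrite (@theta_itv _ x (acos x / 2) (pi - acos x / 2))//.
- by congr EFin; lra.
- lra.
- lra.
- lra.
move=> u u0.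
have yB : 0 <= acos x / 2 <= pi by lra.
have zB : 0 <= pi - acos x / 2 <= pi by lra.
have [up|up] := leP (2 * u) pi.
  rewrite ltNge le_cosE//; last lra.
  by rewrite -ltNge; apply/idP/idP => ?; lra.
have -> : cos (2 * u) = cos (2 * pi - 2 * u).
  by rewrite cosB (mulr_natl pi 2) cos2pi sin2pi; ring.
rewrite ltNge le_cosE//; last lra.
by rewrite -ltNge; apply/idP/idP => ?; lra.
Qed.

Lemma integral_theta_cosN (F : R -> \bar R) : measurable_fun setT F ->
  (forall x, 0 <= F x)%E ->
  (\int[th]_u F (- cos u)%R = \int[th]_u F (cos u))%E.
Proof.
move=> mF F0.
by apply: (@ge0_integral_theta_eq (fun u => - cos u) cos) => //; [exact: measurable_cosT|exact: theta_cosN].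
Qed.

Lemma integral_theta_cos2 (F : R -> \bar R) : measurable_fun setT F ->
  (forall x, 0 <= F x)%E ->
  (\int[th]_u F (2 * cos u ^+ 2 - 1)%R = \int[th]_u F (cos u))%E.
Proof.
move=> mF F0.
rewrite -(@ge0_integral_theta_eq (fun u => cos (2 * u)) cos)//; last 2 first.
- exact: measurable_cosT.
- exact: theta_cos2.
by apply: eq_integral => u _; rewrite (mulr_natl u 2) cos_mulr2n mulr_natl.
Qed.

End invariance.

(** * Logarithmic potential of the arcsine law *)

Section arcsine_bounds.
Context {R : realType}.
Local Notation th := (@theta R).

(** The mean value theorem gives sin (d/2) = (d/2) cos c with c < d/2, so sin d = d cos (d/2) cos c.
    Then cos c >= cos (d/2), and 2 cos (d/2)^2 = 1 + cos d >= 1 yields the factor 1/2. *)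
Lemma sin_ge_half (d : R) : 0 <= d -> d <= pi / 2 -> d / 2 <= sin d.
Proof.
move=> d0 dp; have p0 := pi_gt0 R.
move: d0; rewrite le_eqVlt => /predU1P[<-|d0]; first by rewrite mul0r sin0.
have [c] : exists2 c, c \in `]0, d / 2[ & sin (d / 2) - sin 0 = cos c * (d / 2 - 0).
  apply: (@MVT R sin cos) => //; first by rewrite divr_gt0.
  by apply: derivable_within_continuous => x _.
rewrite in_itv/= sin0 !subr0 => /andP[c0 cd] sE.
have cc : cos (d / 2) <= cos c.
  by rewrite leNgt ltr_cos ?in_itv/=; [lra|lra|lra].
have c2 : 0 <= cos (d / 2) by apply: cos_ge0_pihalf; lra.
have cd0 : 0 <= cos d by apply: cos_ge0_pihalf; lra.
have dE : d = (d / 2) *+ 2 by rewrite -mulr_natr; lra.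
have sd : sin d = 2 * (cos (d / 2) * sin (d / 2)).
  by rewrite {1}dE sin_mulr2n mulr_natl.
have cdE : cos d = 2 * cos (d / 2) ^+ 2 - 1.
  by rewrite {1}dE cos_mulr2n mulr_natl.
have h1 : cos (d / 2) ^+ 2 <= cos (d / 2) * cos c by rewrite expr2 ler_wpM2l.
have h2 : 2^-1 <= cos (d / 2) * cos c by lra.
have -> : sin d = d * (cos (d / 2) * cos c) by rewrite sd sE; field.
by rewrite ler_wpM2l// ltW.
Qed.

(** This says that [acos] is 1/2-Hoelder. With s and d the half-sum and half-difference, cos b - cos
    a = 2 sin s sin d, and sin s >= sin d >= d/2 because |s - pi/2| <= pi/2 - d. *)
Lemma cosB_sqr (a b : R) : 0 <= b -> b <= a -> a <= pi ->
  (a - b) ^+ 2 <= 8 * (cos b - cos a).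
Proof.
move=> b0 ba ap; pose s := (a + b) / 2; pose d := (a - b) / 2.
have p0 := pi_gt0 R.
have aE : a = s + d by rewrite /s /d; lra.
have bE : b = s - d by rewrite /s /d; lra.
have cE : cos b - cos a = 2 * (sin s * sin d).
  by rewrite aE bE cosB cosD; ring.
have d0 : 0 <= d by rewrite /d; lra.
have dp : d <= pi / 2 by rewrite /d; lra.
have h := sin_ge_half d0 dp.
have sd : sin d <= sin s.
  rewrite -(@cosBpihalf R d) -(@cosBpihalf R s).
  have -> : cos (d - pi / 2) = cos (pi / 2 - d) by rewrite -cosN; congr cos; ring.
  have n1 : `|s - pi / 2| <= pi / 2 - d.
    by rewrite ler_norml; rewrite /s /d in d0 dp *; apply/andP; split; lra.
  have n2 : `|s - pi / 2| \in `[0, pi] by rewrite in_itv/= normr_ge0/=; lra.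
  have n3 : pi / 2 - d \in `[0, pi] by rewrite in_itv/=; apply/andP; split; lra.
  by rewrite -[X in _ <= X]cos_norm leNgt ltr_cos// -leNgt.
rewrite cE (_ : a - b = 2 * d); last by rewrite /d; lra.
nra.
Qed.

(** By [cosB_sqr], an interval of length at most 2 * 16^-k has angular width at most sqrt (16 *
    16^-k) = 4 * 4^-k; dividing by pi >= 2 gives the bound. Clipping to [-1, 1] meets the conditions
    of [theta_cos_itv]. *)
Lemma theta_cos_ball (t : R) (k : nat) : -1 <= t <= 1 ->
  (th [set u | (`|t - cos u| <= 16 ^- k)%R] <= (2 / 4 ^+ k)%:E)%E.
Proof.
move=> /andP[t1 t2].
have e0 : 0 < 16 ^- k :> R by rewrite invr_gt0 exprn_gt0.
pose a := Num.max (-1) (t - 16 ^- k); pose b := Num.min 1 (t + 16 ^- k).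
have at_ : a <= t by rewrite /a ge_max t1/=; lra.
have tb : t <= b by rewrite /b le_min t2/=; lra.
have a1 : -1 <= a by rewrite le_max lexx.
have b1 : b <= 1 by rewrite ge_min lexx.
have ab : a <= b by apply: le_trans tb.
have -> : [set u | `|t - cos u| <= 16 ^- k] = cos @^-1` `[a, b].
  apply/seteqP; split => u /=; rewrite in_itv/= /a /b ge_max le_min cos_geN1 cos_le1/= ler_norml.
    by move=> /andP[? ?]; apply/andP; split; lra.
  by move=> /andP[? ?]; apply/andP; split; lra.
rewrite theta_cos_itv// lee_fin ler_pdivrMr ?pi_gt0//.
have aB : -1 <= a <= 1 by rewrite a1 (le_trans ab).
have bB : -1 <= b <= 1 by rewrite b1 (le_trans a1).
have cab : acos b <= acos a.
  by rewrite -le_cosE ?acos_ge0 ?acos_lepi// acosK// in_itv.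
have := @cosB_sqr (acos a) (acos b) (acos_ge0 bB) cab (acos_lepi aB).
rewrite !acosK ?in_itv// => H.
have ba : b - a <= 2 * 16 ^- k.
  have : t - 16 ^- k <= a by rewrite /a le_max lexx orbT.
  have : b <= t + 16 ^- k by rewrite /b ge_min lexx orbT.
  lra.
have q0 : 0 < 4 ^- k :> R by rewrite invr_gt0 exprn_gt0.
have q2 : 16 ^- k = (4 ^- k) ^+ 2 :> R.
  by rewrite -!exprVn -exprM mulnC exprM; congr (_ ^+ _); field.
have p2 : 2 <= pi :> R by exact: pi_ge2.
have : (acos a - acos b) ^+ 2 <= (4 * 4 ^- k) ^+ 2 by rewrite exprMn -q2; lra.
move=> h.
have {}h : acos a - acos b <= 4 * 4 ^- k by rewrite leNgt; apply/negP => hh; nra.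
nra.
Qed.

(** A dyadic decomposition. For x < 1 and y = x^(1/4), the least k with 2^-(k+1) < y satisfies x <=
    16^-k by minimality, so the k-th term alone is 2^(k+1) > 1/y. The summand 1 covers x >= 1. *)
Lemma powR_quarter_le (x : R) : 0 < x ->
  ((x `^ (- 4^-1))%:E <=
   1 + \sum_(0 <= k <oo) (2 ^+ k.+1 * (x <= 16 ^- k)%R%:R)%:E)%E.
Proof.
move=> x0.
have g0 k : (0 <= (2 ^+ k.+1 * (x <= 16 ^- k)%R%:R : R)%:E)%E.
  by rewrite lee_fin mulr_ge0// exprn_ge0.
have [x1|x1] := leP 1 x.
  rewrite (@le_trans _ _ 1%E)//; last by rewrite leeDl// nneseries_ge0.
  have h : 1 `^ 4^-1 <= x `^ 4^-1 by apply: ge0_ler_powR; rewrite ?nnegrE ?invr_ge0// ltW.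
  by rewrite powR1 in h; rewrite lee_fin powRN invf_le1 ?powR_gt0.
have [y [y0 xE yE]] : exists y, [/\ 0 < y, x = y ^+ 4 & x `^ (- 4^-1) = y^-1].
  exists (x `^ 4^-1); split; rewrite ?powR_gt0 ?powRN//.
  by rewrite -powR_mulrn ?powR_ge0// -powRrM mulVf// powRr1// ltW.
have : exists k, 2 ^- k.+1 < y.
  exists (Num.truncn y^-1).
  rewrite invf_plt ?posrE ?exprn_gt0//.
  apply: (@lt_trans _ _ (Num.truncn y^-1).+1%:R); first by rewrite truncnS_gt.
  by rewrite -natrX ltr_nat ltn_expl.
case/ex_minnP => k yk mink.
have xk : x <= 16 ^- k.
  rewrite xE (_ : 16 ^- k = (2 ^- k) ^+ 4); last first.
    by rewrite -!exprVn -exprM mulnC exprM; congr (_ ^+ _); field.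
  rewrite lerXn2r ?nnegrE ?invr_ge0 ?exprn_ge0//; first exact: ltW.
  case: k mink {yk} => [_|k mink].
    rewrite expr0 invr1 leNgt; apply/negP => y1.
    by move: x1; rewrite xE ltNge exprn_ege1// ltW.
  by rewrite leNgt; apply/negP => /mink; rewrite ltnn.
rewrite yE (@le_trans _ _ (2 ^+ k.+1)%:E)//.
  by rewrite lee_fin invf_ple ?posrE ?exprn_gt0// ltW.
apply: (@le_trans _ _ (\sum_(0 <= k <oo) (2 ^+ k.+1 * (x <= 16 ^- k)%R%:R)%:E)%E); last first.
  by rewrite leeDr.
apply: le_trans (nneseries_lim_ge k.+1 _) => //.
rewrite big_nat_recr//= xk mulr1 leeDr//.
by apply: sume_ge0.
Qed.

(** 9 is 1 plus the sum of 2^(k+1) * (2 / 4^k). The bound is uniform up to t = 1 and t = -1, where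
    the arcsine density is itself singular and the critical exponent drops to 1/2. *)
Lemma integral_theta_powR (t : R) : -1 <= t <= 1 ->
  (\int[th]_u (`|t - cos u| `^ (- 4^-1))%:E <= 9%:E)%E.
Proof.
move=> tB.
have mtc : measurable_fun [set: R] (fun u => `|t - cos u|).
  by apply: measurableT_comp => //; apply: measurable_funB => //; exact: measurable_cosT.
have mtc' : @measurable_fun _ _ (measurableTypeR R) R setT (fun u => `|t - cos u|) by [].
have mpow : @measurable_fun _ _ (measurableTypeR R) R setT (fun u => `|t - cos u| `^ (- 4^-1)).
  have : measurable_fun [set: R] (fun u => `|t - cos u| `^ (- 4^-1)).
    by apply: (measurableT_comp (measurable_powR (- 4^-1)) mtc).
  by [].
have mg k : @measurable_fun _ _ (measurableTypeR R) R setT (fun u => 2 ^+ k.+1 * (`|t - cos u| <= 16 ^- k)%R%:R).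
  apply: measurable_funM => //.
  apply: (@measurableT_comp _ _ _ _ _ _ (fun b : bool => b%:R : R)) => //.
  exact: measurable_fun_ler.
have g0 k u : (0 <= (2 ^+ k.+1 * (`|t - cos u| <= 16 ^- k)%R%:R : R)%:E)%E.
  by rewrite lee_fin mulr_ge0// exprn_ge0.
have msum : @measurable_fun _ _ (measurableTypeR R) (\bar R) setT
    (fun u => \sum_(0 <= k <oo) (2 ^+ k.+1 * (`|t - cos u| <= 16 ^- k)%R%:R : R)%:E)%E.
  apply: ge0_emeasurable_sum => [k u _ _|k _]; first exact: g0.
  by apply/measurable_EFinP; exact: mg.
apply: (@le_trans _ _ (\int[th]_u (1 + \sum_(0 <= k <oo) (2 ^+ k.+1 * (`|t - cos u| <= 16 ^- k)%R%:R)%:E))%E).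
  apply: ge0_le_integral => //.
  - apply/measurable_EFinP; exact: mpow.
  - exact: emeasurable_funD.
  - move=> u _.
    have [<-|] := eqVneq 0 `|t - cos u|.
      by rewrite powR0 ?oppr_eq0 ?invr_eq0// adde_ge0// nneseries_ge0.
    by rewrite eq_sym => n0; apply: powR_quarter_le; rewrite lt0r n0/=.
rewrite ge0_integralD//; last by move=> u _; rewrite nneseries_ge0.
rewrite integral_cst// [X in (1 * X)%E]probability_setT mule1.
rewrite integral_nneseries//; last first.
  by move=> k; apply/measurable_EFinP.
have bk k : (\int[th]_u (2 ^+ k.+1 * (`|t - cos u| <= 16 ^- k)%R%:R)%:E <= (4 / 2 ^+ k)%:E)%E.
  under eq_integral do rewrite EFinM.
  have mi : @measurable_fun _ _ (measurableTypeR R) (\bar R) setT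
      (fun u => ((`|t - cos u| <= 16 ^- k)%R%:R : R)%:E).
    apply/measurable_EFinP; apply: (@measurableT_comp _ _ _ _ _ _ (fun b : bool => b%:R : R)) => //.
    exact: measurable_fun_ler.
  rewrite ge0_integralZl ?lee_fin ?exprn_ge0//.
  have -> : (\int[th]_u ((`|t - cos u| <= 16 ^- k)%R%:R)%:E = th [set u | (`|t - cos u| <= 16 ^- k)%R])%E.
    have mS : measurable ([set u | (`|t - cos u| <= 16 ^- k)%R] : set (measurableTypeR R)).
      rewrite (_ : [set _ | _] = (fun u => `|t - cos u|) @^-1` `]-oo, 16 ^- k]).
        by rewrite -[X in measurable X]setTI; apply: mtc'.
      by apply/seteqP; split => u /=; rewrite in_itv.
    transitivity (\int[th]_u (\1_[set u | (`|t - cos u| <= 16 ^- k)%R] u)%:E)%E.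
      by apply: eq_integral => u _; rewrite indicE mem_setE.
    by rewrite integral_indic// setIT.
  apply: (@le_trans _ _ ((2 ^+ k.+1)%:E * (2 / 4 ^+ k)%:E)%E).
    by rewrite lee_wpmul2l ?lee_fin ?exprn_ge0//; exact: theta_cos_ball.
  rewrite -EFinM lee_fin (_ : 4 = 2 * 2)//; last by ring.
  rewrite exprMn exprS le_eqVlt; apply/orP; left; apply/eqP.
  by field; rewrite expf_neq0.
apply: (@le_trans _ _ (1 + \sum_(0 <= k <oo) (4 / 2 ^+ k)%:E)%E).
  rewrite leeD2l//; apply: lee_nneseries => [k _ _|k _]; last exact: bk.
  by apply: integral_ge0 => u _; exact: g0.
have : (\sum_(0 <= k <oo) (4 / 2 ^+ k : R)%:E = 8%:E)%E.
  apply/cvg_lim => //; apply/cvg_EFin; first by apply: nearW => n; rewrite sumEFin.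
  have -> : fine \o (fun n => \sum_(0 <= k < n) (4 / 2 ^+ k : R)%:E)%E =
            series (geometric 4 2^-1) :> (nat -> R).
    apply/funext => n /=; rewrite sumEFin /series/= /geometric/=.
    by apply: eq_bigr => i _; rewrite exprVn.
  have -> : 8 = 4 / (1 - 2^-1) :> R by field.
  by apply: cvg_geometric_series; rewrite ger0_norm ?invr_ge0// invf_lt1 ?ltr1n.
by move=> ->; rewrite -EFinD lee_fin; lra.
Qed.

End arcsine_bounds.

Section log_potential.
Context {R : realType}.
Local Notation th := (@theta R).
Local Notation thfun F := (@measurable_fun _ _ (measurableTypeR R) R setT F).

(** The inequality ln y <= y, applied to x and to x^(-1/4). *)
Lemma norm_ln_le (x : R) : 0 <= x -> `|ln x| <= 4 * x `^ (- 4^-1) + x.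
Proof.
rewrite le_eqVlt => /predU1P[<-|x0].
  by rewrite ln0// normr0 addr0 mulr_ge0// powR_ge0.
have p0 : 0 < x `^ (- 4^-1) by rewrite powR_gt0.
have := ln_sublinear x0; have := ln_sublinear p0; rewrite ln_powR => h1 h2.
by rewrite ler_norml; apply/andP; split; lra.
Qed.

Lemma measurable_ln_sub_cos (t : R) :
  measurable_fun [set: R] (fun u => ln `|t - cos u|).
Proof.
apply: (measurableT_comp (@measurable_ln R)).
by apply: measurableT_comp => //; apply: measurable_funB => //; exact: measurable_cosT.
Qed.

Lemma theta_cos_eq (t : R) : th [set u | cos u = t] = 0%E.
Proof.
have [tB|tB] := boolP (-1 <= t <= 1).
  rewrite (_ : [set _ | _] = cos @^-1` `[t, t]).
    by case/andP: (tB) => ? ?; rewrite theta_cos_itv// subrr mul0r.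
  by rewrite set_itv1; apply/seteqP; split.
rewrite (_ : [set _ | _] = set0); first exact: measure0.
apply/seteqP; split => // u /= ut; move: tB.
by rewrite -ut cos_geN1 cos_le1.
Qed.

Lemma theta_ae_cos_neq (t : R) : {ae th, forall u, cos u != t}.
Proof.
exists [set u | cos u = t]; split; last by move=> u /= /negP; rewrite negbK => /eqP.
  rewrite (_ : [set _ | _] = cos @^-1` [set t]); last by apply/seteqP; split.
  by rewrite -[X in measurable X]setTI; apply: measurable_cosT => //; exact: measurable_set1.
exact: theta_cos_eq.
Qed.

Let mpow t : thfun (fun u => `|t - cos u| `^ (- 4^-1)).
Proof.
have : measurable_fun [set: R] (fun u => `|t - cos u| `^ (- 4^-1)); last by [].
apply: (measurableT_comp (measurable_powR (- 4^-1))).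
by apply: measurableT_comp => //; apply: measurable_funB => //; exact: measurable_cosT.
Qed.

Let mpowE t : @measurable_fun _ _ (measurableTypeR R) (\bar R) setT
  (fun u => (`|t - cos u| `^ (- 4^-1))%:E).
Proof. by apply: measurable_theta_EFin; exact: mpow. Qed.

Let mpow4 t : @measurable_fun _ _ (measurableTypeR R) (\bar R) setT
  (fun u => 4%:E * (`|t - cos u| `^ (- 4^-1))%:E)%E.
Proof. by apply: measurable_funeM; exact: mpowE. Qed.

Let powR_lty (t : R) : (\int[th]_u (`|t - cos u| `^ (- 4^-1))%:E < +oo)%E.
Proof.
have [tB|tB] := boolP (-1 <= t <= 1).
  by rewrite (le_lt_trans (integral_theta_powR tB))// ltry.
have t1 : 1 < `|t|.
  by rewrite ltNge ler_norml; exact: tB.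
apply: (@le_lt_trans _ _ (\int[th]_u ((`|t| - 1) `^ (- 4^-1))%:E)%E).
  apply: ge0_le_integral => //.
  - move=> u _; rewrite lee_fin !powRN lef_pV2 ?posrE ?powR_gt0//.
    + apply: ge0_ler_powR; rewrite ?nnegrE ?invr_ge0// ?subr_ge0 ?(ltW t1)//.
      by rewrite (le_trans _ (lerB_dist _ _))// lerB// cos_max.
    + rewrite (lt_le_trans _ (lerB_dist _ _))// subr_gt0 (le_lt_trans _ t1)//.
      exact: cos_max.
    + by rewrite subr_gt0.
by rewrite integral_cst// [X in (_ * X)%E]probability_setT mule1 ltry.
Qed.

Lemma integrable_powR_sub_cos (t : R) :
  th.-integrable setT (EFin \o (fun u => `|t - cos u| `^ (- 4^-1))).
Proof.
apply/integrableP; split; first exact: mpowE.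
apply: le_lt_trans (powR_lty t); rewrite le_eqVlt; apply/orP; left; apply/eqP.
by apply: eq_integral => u _ /=; rewrite ger0_norm// powR_ge0.
Qed.

Lemma integrable_ln_sub_cos (t : R) :
  th.-integrable setT (EFin \o (fun u => ln `|t - cos u|)).
Proof.
have mln : thfun (fun u => ln `|t - cos u|) by exact: measurable_ln_sub_cos.
apply/integrableP; split; first exact/measurable_EFinP.
apply: (@le_lt_trans _ _ (\int[th]_u (4%:E * (`|t - cos u| `^ (- 4^-1))%:E + (`|t| + 1)%:E))%E).
  apply: ge0_le_integral => //.
  - apply/measurable_EFinP; exact: (measurableT_comp (@normr_measurable R setT) mln).
  - apply: emeasurable_funD => //; apply: measurable_funeM; exact/measurable_EFinP.
  - move=> u _ /=; rewrite lee_fin (le_trans (norm_ln_le _))// lerD2l.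
    by rewrite (le_trans (ler_normB _ _))// lerD2l cos_max.
rewrite ge0_integralD//.
rewrite ge0_integralZl//.
rewrite integral_cst// [X in (_ + _ * X)%E]probability_setT mule1.
by rewrite lte_add_pinfty ?ltry// lte_mul_pinfty ?lee_fin ?ltry.
Qed.

Definition logpot (t : R) : R := \int[th]_u (ln `|t - cos u|).

(** 38 = 4 * 9 + 2, from [norm_ln_le], [integral_theta_powR] and |t - cos u| <= 2; only its
    uniformity in t matters. *)
Let normr_logpot_le (t : R) : -1 <= t <= 1 -> `|logpot t| <= 38.
Proof.
move=> tB.
have mln : thfun (fun u => ln `|t - cos u|) by exact: measurable_ln_sub_cos.
rewrite -lee_fin EFin_normr_Rintegral//; last exact: integrable_ln_sub_cos.
apply: le_trans (le_abse_integral _ _ _) _ => //; first exact/measurable_EFinP.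
apply: (@le_trans _ _ (\int[th]_u (4%:E * (`|t - cos u| `^ (- 4^-1))%:E + 2%:E))%E).
  apply: ge0_le_integral => //.
  - apply/measurable_EFinP; exact: (measurableT_comp (@normr_measurable R setT) mln).
  - apply: emeasurable_funD => //; apply: measurable_funeM; exact/measurable_EFinP.
  - move=> u _ /=; rewrite lee_fin (le_trans (norm_ln_le _))// lerD2l.
    rewrite (le_trans (ler_normB _ _))// (_ : 2 = 1 + 1)// lerD// ?cos_max//.
    by rewrite ler_norml.
rewrite ge0_integralD//.
rewrite ge0_integralZl//.
rewrite integral_cst// [X in (_ + _ * X)%E]probability_setT mule1.
apply: (@le_trans _ _ (4%:E * 9%:E + 2%:E)%E); last by rewrite lee_fin; lra.
by rewrite leeD2r// lee_wpmul2l ?lee_fin//; exact: integral_theta_powR.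
Qed.

Let integral_cos2 (F : R -> R) : measurable_fun setT F ->
  \int[th]_u F (2 * cos u ^+ 2 - 1) = \int[th]_u F (cos u).
Proof.
move=> mF; rewrite /Rintegral; congr fine.
have mE : measurable_fun setT (EFin \o F) by exact/measurable_EFinP.
rewrite [LHS]integralE [RHS]integralE; congr (_ - _)%E.
  transitivity (\int[th]_u ((EFin \o F)^\+ (2 * cos u ^+ 2 - 1)%R))%E.
    by apply: eq_integral => u _; rewrite !funeposE.
  transitivity (\int[th]_u ((EFin \o F)^\+ (cos u)))%E; last first.
    by apply: eq_integral => u _; rewrite !funeposE.
  by apply: integral_theta_cos2 => [|x]; [exact: measurable_funepos|exact: funepos_ge0].
transitivity (\int[th]_u ((EFin \o F)^\- (2 * cos u ^+ 2 - 1)%R))%E.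
    by apply: eq_integral => u _; rewrite !funenegE.
  transitivity (\int[th]_u ((EFin \o F)^\- (cos u)))%E; last first.
    by apply: eq_integral => u _; rewrite !funenegE.
  by apply: integral_theta_cos2 => [|x]; [exact: measurable_funeneg|exact: funeneg_ge0].
Qed.

Let integral_cosN (F : R -> R) : measurable_fun setT F ->
  \int[th]_u F (- cos u) = \int[th]_u F (cos u).
Proof.
move=> mF; rewrite /Rintegral; congr fine.
have mE : measurable_fun setT (EFin \o F) by exact/measurable_EFinP.
rewrite [LHS]integralE [RHS]integralE; congr (_ - _)%E.
  transitivity (\int[th]_u ((EFin \o F)^\+ (- cos u)%R))%E.
    by apply: eq_integral => u _; rewrite !funeposE.
  transitivity (\int[th]_u ((EFin \o F)^\+ (cos u)))%E; last first.
    by apply: eq_integral => u _; rewrite !funeposE.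
  by apply: integral_theta_cosN => [|x]; [exact: measurable_funepos|exact: funepos_ge0].
transitivity (\int[th]_u ((EFin \o F)^\- (- cos u)%R))%E.
    by apply: eq_integral => u _; rewrite !funenegE.
  transitivity (\int[th]_u ((EFin \o F)^\- (cos u)))%E; last first.
    by apply: eq_integral => u _; rewrite !funenegE.
  by apply: integral_theta_cosN => [|x]; [exact: measurable_funeneg|exact: funeneg_ge0].
Qed.

Let mlnsub (t : R) : measurable_fun [set: R] (fun x => ln `|t - x|).
Proof.
apply: (measurableT_comp (@measurable_ln R)).
by apply: measurableT_comp => //; exact: measurable_funB.
Qed.

Lemma logpotN (t : R) : logpot (- t) = logpot t.
Proof.
rewrite /logpot -(integral_cosN (mlnsub t)).
by apply: eq_Rintegral => u _; rewrite -normrN; congr (ln `|_|); ring.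
Qed.

Lemma Rintegral_theta_cst (c : R) : \int[th]_u c = c.
Proof. by rewrite Rintegral_cst// [X in fine X]probability_setT mulr1. Qed.

Lemma integrable_theta_cst (c : R) : th.-integrable setT (EFin \o (fun=> c)).
Proof. exact: finite_measure_integrable_cst. Qed.

Lemma ae_eq_Rintegral_theta (f g : R -> R) :
  measurable_fun [set: R] f -> measurable_fun [set: R] g ->
  {ae th, forall u, f u = g u} -> \int[th]_u f u = \int[th]_u g u.
Proof.
move=> mf mg fg; rewrite /Rintegral; congr fine.
apply: ae_eq_integral => //.
- by have := mf; move/measurable_EFinP.
- by have := mg; move/measurable_EFinP.
- by apply: ae_mono fg => u /= ->.
Qed.

(** For T x = 2 x^2 - 1 one has T t - T x = 2 (t - x) (t + x). Integrating the logarithm at x = cos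
    u, whose law is invariant under T and under sign change, gives the identity; where a factor
    vanishes [ln 0 = 0] breaks the product rule, hence the almost everywhere step. *)
Lemma logpot_cos2 (t : R) : logpot (2 * t ^+ 2 - 1) = 2 * logpot t + ln 2.
Proof.
have iB : th.-integrable setT (EFin \o (fun u => ln `|t - cos u| + ln `|- t - cos u|)).
  by have := integrableD measurableT (integrable_ln_sub_cos t) (integrable_ln_sub_cos (- t)).
transitivity (\int[th]_u (ln 2 + (ln `|t - cos u| + ln `|- t - cos u|))).
  rewrite {1}/logpot -(integral_cos2 (mlnsub _)); apply: ae_eq_Rintegral_theta.
  - apply: (@measurableT_comp _ _ _ _ _ _ (fun x : R => ln `|2 * t ^+ 2 - 1 - x|)); first exact: mlnsub.
    apply: measurable_funB => //; apply: measurable_funM => //.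
    by apply: measurable_funX; exact: measurable_cosT.
  - by apply: measurable_funD => //; apply: measurable_funD; exact: measurable_ln_sub_cos.
  - have := theta_ae_cos_neq t; have := theta_ae_cos_neq (- t).
    apply: ae_mono2 => u cNt ct.
    have p1 : 0 < `|t - cos u| by rewrite normr_gt0 subr_eq0 eq_sym.
    have p2 : 0 < `|- t - cos u| by rewrite normr_gt0 subr_eq0 eq_sym.
    rewrite -!lnM ?posrE ?mulr_gt0//; congr ln.
    rewrite -[2 in RHS]ger0_norm// -!normrM -normrN; congr `|_|; ring.
rewrite RintegralD//; last exact: integrable_theta_cst.
rewrite Rintegral_theta_cst RintegralD//; try exact: integrable_ln_sub_cos.
rewrite -/(logpot t) -/(logpot (- t)) logpotN; ring.
Qed.

(** Solves the doubling equation of [logpot_cos2] both on [-1, 1] and outside: a defect that doubles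
    at each iteration and stays bounded is zero. *)
Lemma bounded_pow2_eq0 (a C : R) : (forall n, `|2 ^+ n * a| <= C) -> a = 0.
Proof.
move=> aC; apply/eqP; apply: contraT => a0.
have a1 : 0 < `|a| by rewrite normr_gt0.
have := aC (Num.truncn (C / `|a|)); rewrite normrM ger0_norm ?exprn_ge0//.
rewrite -ler_pdivlMr// leNgt => /negP; case.
apply: (@lt_le_trans _ _ (Num.truncn (C / `|a|)).+1%:R); first by rewrite truncnS_gt.
by rewrite -natrX ler_nat ltn_expl.
Qed.

(** The map T x = 2 x^2 - 1 preserves [-1, 1], where [logpot] is bounded, and the defect logpot + ln
    2 doubles along its orbits. *)
Lemma logpot_in (t : R) : -1 <= t <= 1 -> logpot t = - ln 2.
Proof.
move=> tB; apply/eqP; rewrite -addr_eq0; apply/eqP.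
apply: (@bounded_pow2_eq0 _ (38 + `|ln 2|)) => n.
pose T (x : R) := 2 * x ^+ 2 - 1.
have TB k : -1 <= iter k T t <= 1.
  elim: k => //= k; set y := iter _ _ _ => /andP[y1 y2].
  by rewrite /T; apply/andP; split; nra.
have -> : 2 ^+ n * (logpot t + ln 2) = logpot (iter n T t) + ln 2.
  elim: n => [|n IH]; first by rewrite expr0 mul1r.
  rewrite exprS -mulrA IH iterS logpot_cos2; ring.
by rewrite (le_trans (ler_normD _ _))// lerD2r normr_logpot_le.
Qed.

(** This crude bound and the next one keep the defect in [logpot_out] bounded along an iteration
    whose argument escapes to infinity. *)
Let logpot_ub (s : R) : 1 < s -> logpot s <= ln (s + 1).
Proof.
move=> s1; rewrite -[leRHS]Rintegral_theta_cst; apply: le_Rintegral => //.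
- exact: integrable_ln_sub_cos.
- exact: integrable_theta_cst.
- move=> u _; have := cos_geN1 u; have := cos_le1 u => c1 c2.
  by rewrite ger0_norm ?ler_ln ?posrE; lra.
Qed.

Let logpot_lb (s : R) : 1 < s -> ln (s - 1) <= logpot s.
Proof.
move=> s1; rewrite -[leLHS]Rintegral_theta_cst; apply: le_Rintegral => //.
- exact: integrable_theta_cst.
- exact: integrable_ln_sub_cos.
- move=> u _; have := cos_geN1 u; have := cos_le1 u => c1 c2.
  by rewrite ger0_norm ?ler_ln ?posrE; lra.
Qed.

(* Iterating the Chebyshev map x |-> 2 x^2 - 1 squares w. *)
Lemma logpot_out (w : R) : 1 < w -> logpot ((w + w^-1) / 2) = ln w - ln 2.
Proof.
move=> w1; have w0 : 0 < w by rewrite (lt_trans _ w1).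
pose D (v : R) := logpot ((v + v^-1) / 2) + ln 2 - ln v.
suff : D w = 0 by rewrite /D => h; lra.
have D2 v : 1 < v -> D (v ^+ 2) = 2 * D v.
  move=> v1; have v0 : 0 < v by rewrite (lt_trans _ v1).
  rewrite /D (_ : (v ^+ 2 + (v ^+ 2)^-1) / 2 = 2 * ((v + v^-1) / 2) ^+ 2 - 1); last first.
    by field; rewrite gt_eqF.
  by rewrite logpot_cos2 lnXn// mulr2n; ring.
have v1 n : w <= w ^+ (2 ^ n).
  rewrite -[leLHS]expr1 ler_eXn2l//; exact: expn_gt0.
have Dn n : 2 ^+ n * D w = D (w ^+ (2 ^ n)).
  elim: n => [|n IH]; first by rewrite expr0 mul1r expn0 expr1.
  rewrite exprS -mulrA IH expnS mulnC exprM D2//.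
  by rewrite (lt_le_trans w1).
apply: (@bounded_pow2_eq0 _ (`|ln 4| + `|2 * ln (1 - w^-1)|)) => n.
rewrite Dn; set v := w ^+ _.
have wv : w <= v by exact: v1.
have v1' : 1 < v by exact: lt_le_trans wv.
have v0 : 0 < v by rewrite (lt_trans _ v1').
have vV : v^-1 < 1 by rewrite invf_lt1.
have vV0 : 0 < v^-1 by rewrite invr_gt0.
have vw : v^-1 <= w^-1 by rewrite lef_pV2.
have wV : w^-1 < 1 by rewrite invf_lt1.
have vvV : v * v^-1 = 1 by rewrite divff// gt_eqF.
have s1 : 1 < (v + v^-1) / 2 by nra.
have ub := logpot_ub s1; have lb := logpot_lb s1.
have ub2 : D v <= ln 4.
  rewrite /D; have : ln ((v + v^-1) / 2 + 1) + ln 2 <= ln 4 + ln v; last by lra.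
  by rewrite -!lnM ?posrE ?ler_ln ?posrE; try nra.
have lb2 : 2 * ln (1 - w^-1) <= D v.
  have : 2 * ln (1 - w^-1) <= 2 * ln (1 - v^-1).
    by rewrite ler_pM2l// ler_ln ?posrE; lra.
  have : 2 * ln (1 - v^-1) + ln v <= ln ((v + v^-1) / 2 - 1) + ln 2.
    rewrite mulr_natl -lnXn ?subr_gt0// -!lnM ?posrE ?exprn_gt0 ?subr_gt0//; try lra.
    rewrite ler_ln ?posrE ?mulr_gt0 ?exprn_gt0 ?subr_gt0//.
    by rewrite le_eqVlt; apply/orP; left; apply/eqP; field; rewrite gt_eqF.
  rewrite /D; lra.
have := ler_norm (ln 4 : R); have := normr_ge0 (ln 4 : R).
have := ler_norm (- (2 * ln (1 - w^-1))); rewrite normrN; have := normr_ge0 (2 * ln (1 - w^-1)).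
rewrite ler_norml => *; apply/andP; split; lra.
Qed.

(** By symmetry t > 1. Then w = t + sqrt (t^2 - 1) > 1 inverts the Joukowski map w |-> (w + 1/w) /
    2, so the potential exceeds - ln 2 by ln w. Strictness is what later confines the support of an
    unknown law. *)
Lemma logpot_gt (t : R) : ~~ (-1 <= t <= 1) -> - ln 2 < logpot t.
Proof.
wlog t0 : t / 0 <= t.
  move=> H; have [t0|t0] := leP 0 t; first exact: H.
  move=> tB; rewrite -logpotN; apply: H; first lra.
  by apply: contra tB => /andP[? ?]; apply/andP; split; lra.
move=> tB; have t1 : 1 < t.
  by rewrite ltNge; apply: contra tB => t1; apply/andP; split; lra.
pose q := Num.sqrt (t ^+ 2 - 1).
have q0 : 0 <= q by exact: sqrtr_ge0.
have q2 : q ^+ 2 = t ^+ 2 - 1 by rewrite sqr_sqrtr//; nra.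
pose w := t + q.
have w1 : 1 < w by rewrite /w; lra.
have w0 : w != 0 by rewrite gt_eqF//; lra.
have wV : w^-1 = t - q by apply: (mulfI w0); rewrite divff// /w; nra.
have -> : t = (w + w^-1) / 2 by rewrite wV /w; field.
by rewrite logpot_out//; have := ln_gt0 w1; lra.
Qed.

End log_potential.

(** For x <= 1/2, (1 - x) exp x <= 1 gives exp x <= 1 + x + 2 x^2; for larger x, 4 x^2 >= 1 and the
    last term alone dominates exp x. *)
Lemma expR_le_quadratic (R : realType) (x : R) :
  expR x <= 1 + x + 4 * x ^+ 2 * expR `|x|.
Proof.
have e1 : 1 <= expR `|x| by rewrite -expR0 ler_expR.
have x2 : 0 <= x ^+ 2 by rewrite sqr_ge0.
have [xh|xh] := leP x 2^-1.
  have := expR_ge1Dx (- x); rewrite expRN => h.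
  have E0 := expR_gt0 x.
  have h1 : (1 - x) * expR x <= 1 by rewrite -ler_pdivlMr// mul1r.
  have h2 : expR x <= 1 + x + 2 * x ^+ 2 by nra.
  nra.
have -> : `|x| = x by rewrite ger0_norm//; lra.
have E0 := expR_gt0 x.
have : 1 <= 4 * x ^+ 2 by nra.
by rewrite -(ler_pM2r E0) mul1r => h; lra.
Qed.

Lemma ae_eq_integrable d (T : measurableType d) (R : realType)
    (mu : {measure set T -> \bar R}) (f g : T -> \bar R) :
  measurable_fun setT g -> {ae mu, forall x, f x = g x} ->
  mu.-integrable setT f -> mu.-integrable setT g.
Proof.
move=> mg fg /integrableP[mf foo]; apply/integrableP; split => //.
rewrite -(@ae_eq_integral _ _ _ _ setT (fun x => `|g x|%E) (fun x => `|f x|%E))//.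
- exact: measurableT_comp.
- exact: measurableT_comp.
- by apply: ae_mono fg => x ->.
Qed.

(** * Logarithm and small moments of one contraction factor *)

Section arcsine_rate.
Context {R : realType} (m M : R).
Hypotheses (m0 : 0 < m) (mM : m < M).
Local Notation th := (@theta R).
Local Notation rho := (accelerated_rate m M).
Local Notation b := (arc_var m M).

Let M0 : 0 < M. Proof. exact: lt_trans mM. Qed.
Let Mm0 : 0 < M - m. Proof. by rewrite subr_gt0. Qed.

Let r := Num.sqrt (M / m).
Let r1 : 1 < r.
Proof. by rewrite /r -sqrtr1 ltr_sqrt ?divr_gt0// ltr_pdivlMr// mul1r. Qed.

Lemma accelerated_rate_gt0 : 0 < rho.
Proof. by rewrite /accelerated_rate -/r; apply: divr_gt0; have := r1; lra. Qed.

Lemma accelerated_rate_lt1 : rho < 1.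
Proof.
by rewrite /accelerated_rate -/r; have := r1 => ?; rewrite ltr_pdivrMr; lra.
Qed.

(** Rescaling [m, M] to [-1, 1] sends 0 to - (m + M) / (M - m), whose absolute value has Joukowski
    parameter 1 / rho: this is where the rate comes from. *)
Lemma accelerated_rateDV : rho^-1 + rho = 2 * (m + M) / (M - m).
Proof.
have r2 : r ^+ 2 * m = M by rewrite sqr_sqrtr ?divr_ge0 ?ltW// divfK// gt_eqF.
rewrite /accelerated_rate -/r; have := r1 => r1'.
have a1 : r - 1 != 0 by rewrite gt_eqF//; lra.
have a2 : r + 1 != 0 by rewrite gt_eqF//; lra.
have a3 : r ^+ 2 * m - m != 0 by rewrite r2 gt_eqF.
rewrite -r2; field.
by rewrite a1 a2 a3.
Qed.

Lemma arc_var_itv (u : R) : m <= b u <= M.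
Proof.
have := cos_geN1 u; have := cos_le1 u => c1 c2.
by rewrite /arc_var; have := Mm0 => ?; apply/andP; split; nra.
Qed.

Lemma arc_var_gt0 (u : R) : 0 < b u.
Proof. by case/andP: (arc_var_itv u) => h _; exact: lt_le_trans h. Qed.

Let t_ (y : R) := (2 * y - (m + M)) / (M - m).

Let sub_arc_var (y u : R) : y - b u = (M - m) / 2 * (t_ y - cos u).
Proof. by rewrite /t_ /arc_var; field; rewrite gt_eqF. Qed.

Let h0 : 0 < (M - m) / 2. Proof. by rewrite divr_gt0. Qed.

Lemma theta_ae_arc_neq (y : R) : {ae th, forall u, b u != y}.
Proof.
apply: ae_mono (theta_ae_cos_neq (t_ y)) => u; apply: contra => /eqP by_.
have := sub_arc_var y u; rewrite by_ subrr => /esym/eqP.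
by rewrite mulf_eq0 gt_eqF//= subr_eq0 eq_sym.
Qed.

Lemma measurable_ln_sub_arc (y : R) : measurable_fun [set: R] (fun u => ln `|y - b u|).
Proof.
apply: (measurableT_comp (@measurable_ln R)).
by apply: measurableT_comp => //; apply: measurable_funB => //; exact: measurable_arc_var.
Qed.

Let ae_ln (y : R) :
  {ae th, forall u, ln `|y - b u| = ln ((M - m) / 2) + ln `|t_ y - cos u|}.
Proof.
apply: ae_mono (theta_ae_cos_neq (t_ y)) => u tu.
rewrite sub_arc_var normrM (gtr0_norm h0) [LHS]lnM ?posrE//.
by rewrite normr_gt0 subr_eq0 eq_sym.
Qed.

Let iD (y : R) : th.-integrable setT
  (EFin \o (fun u => ln ((M - m) / 2) + ln `|t_ y - cos u|)).
Proof.
by have := integrableD measurableT (integrable_theta_cst (ln ((M - m) / 2))) (integrable_ln_sub_cos (t_ y)).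
Qed.

Lemma integrable_ln_sub_arc (y : R) :
  th.-integrable setT (EFin \o (fun u => ln `|y - b u|)).
Proof.
apply: ae_eq_integrable (iD y).
  by apply: measurable_theta_EFin; exact: measurable_ln_sub_arc.
by apply: ae_mono (ae_ln y) => u /= ->.
Qed.

Lemma Rintegral_ln_sub_arc (y : R) :
  \int[th]_u (ln `|y - b u|) =
  ln ((M - m) / 2) + logpot ((2 * y - (m + M)) / (M - m)).
Proof.
transitivity (\int[th]_u (ln ((M - m) / 2) + ln `|t_ y - cos u|)).
  apply: ae_eq_Rintegral_theta; last exact: ae_ln.
    exact: measurable_ln_sub_arc.
  by apply: measurable_funD => //; exact: measurable_ln_sub_cos.
rewrite RintegralD//; [|exact: integrable_theta_cst|exact: integrable_ln_sub_cos].
by rewrite Rintegral_theta_cst.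
Qed.

Let t_itv (y : R) : (-1 <= t_ y <= 1) = (m <= y <= M).
Proof.
rewrite /t_ ler_pdivrMr// ler_pdivlMr//.
by apply/idP/idP => /andP[? ?]; apply/andP; split; lra.
Qed.

(** (M - m) / 4 is the logarithmic capacity of [m, M]: half the length from the scaling, and another
    factor 1/2 from the equilibrium value - ln 2. *)
Lemma Rintegral_ln_sub_arc_in (y : R) : m <= y <= M ->
  \int[th]_u (ln `|y - b u|) = ln ((M - m) / 4).
Proof.
move=> yB; rewrite Rintegral_ln_sub_arc logpot_in ?t_itv//.
rewrite -ln_div ?posrE//; congr ln; by field.
Qed.

Lemma Rintegral_ln_sub_arc_out (y : R) : ~~ (m <= y <= M) ->
  ln ((M - m) / 4) < \int[th]_u (ln `|y - b u|).
Proof.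
move=> yB; rewrite Rintegral_ln_sub_arc.
have -> : ln ((M - m) / 4) = ln ((M - m) / 2) - ln 2.
  by rewrite -ln_div ?posrE//; congr ln; field.
by rewrite ltrD2l logpot_gt// t_itv.
Qed.

Lemma integrable_ln_arc : th.-integrable setT (EFin \o (fun u => ln (b u))).
Proof.
apply: eq_integrable (integrable_ln_sub_arc 0) => // u _ /=.
by rewrite sub0r normrN gtr0_norm// arc_var_gt0.
Qed.

Lemma Rintegral_ln_arc : \int[th]_u (ln (b u)) = ln ((M - m) / 4) - ln rho.
Proof.
transitivity (\int[th]_u (ln `|0 - b u|)).
  by apply: eq_Rintegral => u _; rewrite sub0r normrN gtr0_norm// arc_var_gt0.
rewrite Rintegral_ln_sub_arc.
have -> : (2 * 0 - (m + M)) / (M - m) = - ((rho^-1 + rho^-1^-1) / 2).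
  by rewrite invrK accelerated_rateDV; field; rewrite gt_eqF.
have rho0 := accelerated_rate_gt0.
rewrite logpotN logpot_out; last by rewrite invf_gt1// accelerated_rate_lt1.
rewrite lnV ?posrE// addrCA addrC; congr (_ - _).
rewrite -ln_div ?posrE//; congr ln; by field.
Qed.

Let ae_ln_factor (lam : R) :
  {ae th, forall u, ln `|1 - lam / b u| = ln `|lam - b u| - ln (b u)}.
Proof.
apply: ae_mono (theta_ae_arc_neq lam) => u bl.
have b0 := arc_var_gt0 u.
rewrite -ln_div ?posrE// ?normr_gt0 ?subr_eq0 1?eq_sym//; congr ln.
have -> : 1 - lam / b u = - ((lam - b u) / b u) by field; rewrite gt_eqF.
by rewrite normrN normf_div (gtr0_norm b0).
Qed.

Lemma measurable_ln_factor (lam : R) : measurable_fun [set: R] (fun u => ln `|1 - lam / b u|).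
Proof.
apply: (measurableT_comp (@measurable_ln R)).
apply: measurableT_comp => //; apply: measurable_funB => //; apply: measurable_funM => //.
by apply: (measurableT_comp (@measurable_invr R)); exact: measurable_arc_var.
Qed.

Let iB (lam : R) : th.-integrable setT
  (EFin \o (fun u => ln `|lam - b u| - ln (b u))).
Proof.
by have := integrableB measurableT (integrable_ln_sub_arc lam) integrable_ln_arc.
Qed.

Lemma integrable_ln_factor (lam : R) :
  th.-integrable setT (EFin \o (fun u => ln `|1 - lam / b u|)).
Proof.
apply: ae_eq_integrable (iB lam).
  by apply: measurable_theta_EFin; exact: measurable_ln_factor.
by apply: ae_mono (ae_ln_factor lam) => u /= ->.
Qed.

(** Since |1 - lam / b| = |lam - b| / b, this is the potential at lam minus the potential at 0. The
    capacity cancels, leaving [ln rho] whatever lam is in [m, M]. *)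
Lemma Rintegral_ln_factor (lam : R) : m <= lam <= M ->
  \int[th]_u (ln `|1 - lam / b u|) = ln rho.
Proof.
move=> lB.
transitivity (\int[th]_u (ln `|lam - b u| - ln (b u))).
  apply: ae_eq_Rintegral_theta; last exact: ae_ln_factor.
    exact: measurable_ln_factor.
  apply: measurable_funB; first exact: measurable_ln_sub_arc.
  by apply: (measurableT_comp (@measurable_ln R)); exact: measurable_arc_var.
rewrite RintegralB//; [|exact: integrable_ln_sub_arc|exact: integrable_ln_arc].
rewrite Rintegral_ln_sub_arc_in// Rintegral_ln_arc; ring.
Qed.

(** 32 * 32 = 4 * (16 * 16), with 4 from [expR_le_quadratic] and 16 * 16 from X^2 <= 16^2 exp (|X| /
    8). *)
Let K : R := 32 * 32.
Let K0 : 0 <= K. Proof. by rewrite mulr_ge0. Qed.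

Let factor_le (lam u : R) : m <= lam <= M -> `|1 - lam / b u| <= M / m.
Proof.
move=> /andP[l1 l2]; have b0 := arc_var_gt0 u; have /andP[b1 b2] := arc_var_itv u.
have q1 : lam / b u <= M / m.
  by rewrite ler_pM ?invr_ge0 ?lef_pV2 ?posrE// (le_trans (ltW m0)).
have q0 : 0 <= lam / b u by rewrite divr_ge0 ?(ltW b0)// (le_trans (ltW m0)).
have k1 : 1 <= M / m by rewrite ler_pdivlMr// mul1r ltW.
by rewrite ler_norml; apply/andP; split; lra.
Qed.

Let factor_ge (lam u : R) :
  (M - m) / (2 * M) * `|t_ lam - cos u| <= `|1 - lam / b u|.
Proof.
have b0 := arc_var_gt0 u; have /andP[b1 b2] := arc_var_itv u.
have -> : `|1 - lam / b u| = (M - m) / 2 * `|t_ lam - cos u| / b u.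
  rewrite -[X in X * `|_|]gtr0_norm// -normrM -sub_arc_var.
  have -> : 1 - lam / b u = - ((lam - b u) / b u) by field; rewrite gt_eqF.
  by rewrite normrN normf_div (gtr0_norm b0).
rewrite [leRHS]mulrAC ler_wpM2r// invfM mulrA; apply: ler_wpM2l; first exact: ltW.
by rewrite lef_pV2.
Qed.

(** Write v = exp X and expand exp (s X) to second order. As |s| <= 1/8, the remainder is at most a
    multiple of s^2 X^2 exp (|X| / 8), and absorbing X^2 costs another exp (|X| / 8). The resulting
    exp (|X| / 4) is v^(1/4) <= M / m for v >= 1, and v^(-1/4), integrable uniformly in lam, for v <
    1. *)
Let pointwise (s lam u : R) : `|s| <= 8^-1 -> m <= lam <= M ->
  `|1 - lam / b u| `^ s <=
  1 + s * ln `|1 - lam / b u| + K * s ^+ 2 *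
    (1 + M / m + ((M - m) / (2 * M)) `^ (- 4^-1) * `|t_ lam - cos u| `^ (- 4^-1)).
Proof.
move=> s8 lB; set D := _ `^ (- 4^-1); set p := _ `^ (- 4^-1).
have D0 : 0 <= D by exact: powR_ge0.
have p0 : 0 <= p by exact: powR_ge0.
have k1 : 1 <= M / m by rewrite ler_pdivlMr// mul1r ltW.
have s20 : 0 <= s ^+ 2 by exact: sqr_ge0.
have Dp : 0 <= D * p by exact: mulr_ge0.
have vz : `|t_ lam - cos u| = 0 -> `|1 - lam / b u| = 0.
  move/eqP; rewrite normr_eq0 => /eqP t0; have := sub_arc_var lam u.
  rewrite t0 mulr0 => /eqP; rewrite subr_eq0 => /eqP ->.
  by rewrite divff ?subrr ?normr0// gt_eqF// arc_var_gt0.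
move: vz; have := factor_le u lB; have := factor_ge lam u.
set v := `|1 - _| => vge vle vz.
have : 0 <= v by exact: normr_ge0.
rewrite le_eqVlt => /predU1P[v0|v0].
  (* At v = 0 the conventions give [ln 0 = 0] and a power equal to 0, or to 1 when s = 0, for
     negative s as well; the left side is at most 1. *)
  rewrite -v0 ln0// mulr0 addr0.
  apply: (@le_trans _ _ 1); last first.
    by rewrite lerDl; apply: mulr_ge0; [exact: mulr_ge0|lra].
  have [->|sn0] := eqVneq s 0; first by rewrite powRr0.
  by rewrite powR0.
rewrite {1}/powR gt_eqF//.
set X := ln v.
apply: le_trans (expR_le_quadratic _) _.
rewrite lerD2l.
have eX : expR `|s * X| <= expR (`|X| / 8).
  by rewrite ler_expR normrM mulrC ler_wpM2l.
have X2 : X ^+ 2 <= 16 * 16 * expR (`|X| / 8).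
  have h : `|X| / 16 <= expR (`|X| / 16) by apply: le_trans (expR_ge1Dx _); lra.
  have -> : expR (`|X| / 8) = expR (`|X| / 16) ^+ 2.
    by rewrite -expRM_natl; congr expR; field.
  rewrite -(@real_normK _ X) ?num_real//; have := normr_ge0 X; nra.
have e8 : 0 < expR (`|X| / 8) by exact: expR_gt0.
have e84 : expR (`|X| / 8) ^+ 2 = expR (`|X| / 4).
  by rewrite -expRM_natl; congr expR; field.
have e4 : expR (`|X| / 4) <= 1 + M / m + D * p.
  have [X0|X0] := leP 0 X.
    rewrite ger0_norm//.
    have : expR (X / 4) <= expR X by rewrite ler_expR; lra.
    by rewrite /X lnK ?posrE//; lra.
  have -> : expR (`|X| / 4) = v `^ (- 4^-1).
    by rewrite /powR gt_eqF// ltr0_norm//; congr expR; rewrite -/X; field.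
  have : v `^ (- 4^-1) <= D * p; last by lra.
  have d0 : 0 < (M - m) / (2 * M) by rewrite divr_gt0 ?mulr_gt0.
  rewrite /D /p -powRM ?normr_ge0 ?(ltW d0)//.
  have w0 : 0 <= (M - m) / (2 * M) * `|t_ lam - cos u| by rewrite mulr_ge0// ltW.
  move: vge w0; set w := _ * `|_ - cos u| => vge; rewrite le_eqVlt => /predU1P[w0|w0].
    have /eqP : 0 = w := w0; rewrite eq_sym mulf_eq0 gt_eqF//= => /eqP /vz v00.
    by rewrite v00 ltxx in v0.
  rewrite !powRN lef_pV2 ?posrE ?powR_gt0//.
  by apply: ge0_ler_powR; rewrite ?nnegrE ?invr_ge0// ltW.
have : 0 <= s ^+ 2 * X ^+ 2 by rewrite mulr_ge0 ?sqr_ge0.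
have h5 : 4 * (s * X) ^+ 2 * expR `|s * X| <= 4 * s ^+ 2 * (X ^+ 2 * expR (`|X| / 8)).
  have -> : 4 * (s * X) ^+ 2 * expR `|s * X| = 4 * (s ^+ 2 * X ^+ 2) * expR `|s * X|.
    by rewrite exprMn.
  have -> : 4 * s ^+ 2 * (X ^+ 2 * expR (`|X| / 8)) = 4 * (s ^+ 2 * X ^+ 2) * expR (`|X| / 8).
    by ring.
  by apply: ler_wpM2l => //; apply: mulr_ge0 => //; rewrite mulr_ge0 ?sqr_ge0.
have h6 : X ^+ 2 * expR (`|X| / 8) <= 16 * 16 * (1 + M / m + D * p).
  apply: (@le_trans _ _ (16 * 16 * expR (`|X| / 4))).
    by rewrite -e84 expr2 mulrA ler_wpM2r// ltW.
  by rewrite ler_wpM2l ?mulr_ge0.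
move=> _; apply: le_trans h5 _.
have -> : K * s ^+ 2 * (1 + M / m + D * p) = 4 * s ^+ 2 * (16 * 16 * (1 + M / m + D * p)).
  by rewrite /K; ring.
by apply: ler_wpM2l => //; exact: mulr_ge0.
Qed.

(** Integrating [pointwise] leaves 1 + s ln rho + C s^2, below its exponential form. The linear
    coefficient does not depend on lam and [C] is uniform in it, so the bound survives a curvature
    chosen by the past. *)
Lemma arcsine_exp_bound : exists2 C : R, 0 <= C &
  forall s lam, `|s| <= 8^-1 -> m <= lam <= M ->
  (\int[th]_u (`|1 - lam / b u| `^ s)%:E <= (expR (s * ln rho + C * s ^+ 2))%:E)%E.
Proof.
pose D := ((M - m) / (2 * M)) `^ (- 4^-1).
have D0 : 0 <= D by exact: powR_ge0.
have k1 : 1 <= M / m by rewrite ler_pdivlMr// mul1r ltW.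
exists (K * (1 + M / m + D * 9)).
  apply: mulr_ge0; [exact: K0|lra].
move=> s lam s8 lB.
pose p u := `|t_ lam - cos u| `^ (- 4^-1).
pose Y u := (1 + s * ln `|1 - lam / b u|) + K * s ^+ 2 * ((1 + M / m) + D * p u).
have ip : th.-integrable setT (EFin \o p) := integrable_powR_sub_cos (t_ lam).
have iDp : th.-integrable setT (EFin \o (fun u => D * p u)).
  by have := integrableZl measurableT D ip.
have i1 : th.-integrable setT (EFin \o (fun u => (1 + M / m) + D * p u)).
  by have := integrableD measurableT (integrable_theta_cst (1 + M / m)) iDp.
have i2 : th.-integrable setT (EFin \o (fun u => K * s ^+ 2 * ((1 + M / m) + D * p u))).
  by have := integrableZl measurableT (K * s ^+ 2) i1.
have i3 : th.-integrable setT (EFin \o (fun u => s * ln `|1 - lam / b u|)).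
  by have := integrableZl measurableT s (integrable_ln_factor lam).
have i4 : th.-integrable setT (EFin \o (fun u => 1 + s * ln `|1 - lam / b u|)).
  by have := integrableD measurableT (integrable_theta_cst 1) i3.
have iY : th.-integrable setT (EFin \o Y).
  by have := integrableD measurableT i4 i2.
have vY u : `|1 - lam / b u| `^ s <= Y u by exact: pointwise.
apply: (@le_trans _ _ (\int[th]_u (Y u)%:E)%E).
  apply: ge0_le_integral => //.
  - apply: measurable_theta_EFin.
    apply: (measurableT_comp (measurable_powR s)).
    apply: measurableT_comp => //; apply: measurable_funB => //; apply: measurable_funM => //.
    by apply: (measurableT_comp (@measurable_invr R)); exact: measurable_arc_var.
  - by case/integrableP: iY.
  - by move=> u _; rewrite lee_fin.
rewrite -[leLHS]fineK; last exact: (integrable_fin_num measurableT iY).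
rewrite lee_fin -/(Rintegral th setT Y).
have -> : \int[th]_u Y u = 1 + s * ln rho + K * s ^+ 2 * (1 + M / m + D * \int[th]_u p u).
  rewrite /Y RintegralD// RintegralD//; last exact: integrable_theta_cst.
  rewrite RintegralZl//; last exact: integrable_ln_factor.
  rewrite RintegralZl// RintegralD//; last exact: integrable_theta_cst.
  by rewrite RintegralZl// !Rintegral_theta_cst Rintegral_ln_factor.
have p9 : \int[th]_u p u <= 9.
  rewrite -lee_fin fineK; last exact: (integrable_fin_num measurableT ip).
  by apply: integral_theta_powR; rewrite t_itv.
apply: le_trans (expR_ge1Dx _); rewrite -addrA lerD2l lerD2l.
rewrite [leRHS]mulrAC; apply: ler_wpM2l; first by rewrite mulr_ge0 ?sqr_ge0.
by rewrite lerD2l ler_wpM2l.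
Qed.

End arcsine_rate.

(** * Scalar recursions driven by independent inputs *)

Section push.
Context d d' (T1 : measurableType d) (T2 : measurableType d') (R : realType).

(** The pushforward with its measure structure made explicit, so that it can be rescaled and
    compared with product measures. *)
Definition pushm (mu : {measure set T1 -> \bar R}) (f : T1 -> T2)
    (mf : measurable_fun setT f) : {measure set T2 -> \bar R} :=
  measure_function_pushforward__canonical__measure_function_Measure mu mf.

Lemma ge0_integral_pushm (mu : {measure set T1 -> \bar R}) (f : T1 -> T2)
    (mf : measurable_fun setT f) (F : T2 -> \bar R) :
  measurable_fun setT F -> (forall x, 0 <= F x)%E ->
  (\int[pushm mu mf]_y F y = \int[mu]_x F (f x))%E.
Proof.
by move=> mF F0; rewrite /pushm ge0_integral_pushforward// preimage_setT.
Qed.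

End push.

Section chain.
Context d (T : measurableType d) (R : realType) (P : probability T R).
Variable beta : nat -> {RV P >-> R}.
Hypothesis indep : mutually_independent beta.
Variables (G : R * R -> R) (y0 : R).
Hypothesis mG : measurable_fun setT G.

Fixpoint chain (n : nat) (w : T) : R :=
  if n is k.+1 then G (chain k w, beta k w) else y0.

Lemma measurable_chain n : measurable_fun setT (chain n).
Proof.
elim: n => [|n IH] /=; first exact: measurable_cst.
apply: (measurableT_comp mG).
by apply/measurable_fun_pairP; split.
Qed.

Let mpre (f : T -> R) (A : set R) : measurable_fun setT f -> measurable A ->
  measurable (f @^-1` A).
Proof. by move=> mf mA; rewrite -[X in measurable X]setTI; exact: mf. Qed.

Let evt (J : {fset nat}) (A : nat -> set R) :=
  \bigcap_(j in [set` J]) (beta j @^-1` A j).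

Let mevt J A : (forall j, measurable (A j)) -> measurable (evt J A).
Proof.
move=> mA; apply: fin_bigcap_measurable; first exact: finite_fset.
by move=> j _; exact: mpre.
Qed.

Let yb n := fun w => (chain n w, beta n w).
Let myb n : measurable_fun setT (yb n).
Proof. by apply/measurable_fun_pairP; split; first exact: measurable_chain. Qed.

Let chain_isMF n := isMeasurableFun.Build _ _ _ _ (chain n) (measurable_chain n).
Definition chain_rv n : {RV P >-> R} := HB.pack (chain n) (chain_isMF n).

Let fsetU1_evt n J A : evt (n |` J)%fset A = (beta n @^-1` A n) `&` evt J A.
Proof.
apply/seteqP; split => w /=.
  move=> h; split; first by apply: (h n); rewrite /= !inE eqxx.
  by move=> j /= jJ; apply: h; rewrite /= !inE jJ orbT.
move=> [h1 h2] j /=; rewrite !inE => /orP[/eqP ->//|jJ].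
exact: h2.
Qed.

Let P_evtU1 n J A : (forall j, measurable (A j)) -> n \notin J ->
  P (evt (n |` J)%fset A) = (P (beta n @^-1` A n) * P (evt J A))%E.
Proof.
move=> mA nJ; rewrite /evt !indep//.
by rewrite big_fsetU1.
Qed.

(** The state at time n involves only earlier inputs. In the inductive step, the law of the pair
    ([chain n], [beta n]) and the same law conditioned on the event [E] of later inputs both agree
    with the product of the marginals on rectangles: apply the induction hypothesis with n added to
    J. Uniqueness of product measures makes them agree on the preimage of [B] under [G]. A null [E]
    is set apart, since conditioning divides by its mass. *)
Lemma chain_indep n (J : {fset nat}) (A : nat -> set R) (B : set R) :
  (forall j, measurable (A j)) -> measurable B ->
  (forall j, j \in J -> (n <= j)%N) ->
  P (chain n @^-1` B `&` evt J A) =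
  (P (chain n @^-1` B) * P (evt J A))%E.
Proof.
move=> mA mB; elim: n J A mA B mB => [|n IH] J A mA B mB nJ.
  have [y0B|y0B] := pselect (B y0).
    have -> : chain 0 @^-1` B = setT by apply/seteqP; split.
    by rewrite setTI [X in (X * _)%E]probability_setT mul1e.
  have -> : chain 0 @^-1` B = set0 by apply/seteqP; split.
  by rewrite set0I measure0 mul0e.
set E := evt J A; have mE : measurable E by exact: mevt.
have mS : measurable (chain n.+1 @^-1` B) by apply: mpre => //; exact: measurable_chain.
have finE : P E \is a fin_num by exact: fin_num_measure.
have [PE0|PE0] := eqVneq (P E) 0%E.
  rewrite PE0 mule0; apply/eqP; rewrite -measure_le0 -PE0.
  by apply: le_measure; rewrite ?inE//; exact: measurableI.
have f0 : fine (P E) != 0 by rewrite fine_eq0.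
have c0 : 0 <= (fine (P E))^-1 by rewrite invr_ge0 fine_ge0.
pose c : {nonneg R} := NngNum c0.
have nJ' : n \notin J by apply/negP => /nJ; rewrite ltnn.
have IHr (X Y : set R) (F : set T) (J' : {fset nat}) (A' : nat -> set R) : True by [].
have rect (X Y : set R) : measurable X -> measurable Y ->
    P (chain n @^-1` X `&` (beta n @^-1` Y) `&` E) =
    (P (chain n @^-1` X) * P (beta n @^-1` Y) * P E)%E.
  move=> mX mY.
  pose A' j := if j == n then Y else A j.
  have mA' j : measurable (A' j) by rewrite /A'; case: eqP.
  have E' : evt J A' = E.
    apply: eq_bigcapr => j /= jJ; rewrite /A'; case: eqP => // jn.
    by move: nJ'; rewrite -jn jJ.
  have H := IH (n |` J)%fset A' mA' X mX.
  rewrite -setIA -{1}E' -[X in X `&` evt _ _](_ : beta n @^-1` A' n = _); last by rewrite /A' eqxx.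
  rewrite -fsetU1_evt H; last first.
    by move=> j; rewrite !inE => /orP[/eqP ->//|/nJ /ltnW].
  by rewrite P_evtU1// E' /A' eqxx muleA.
have rect1 (X Y : set R) : measurable X -> measurable Y ->
    P (chain n @^-1` X `&` (beta n @^-1` Y)) =
    (P (chain n @^-1` X) * P (beta n @^-1` Y))%E.
  move=> mX mY.
  pose A' (j : nat) := Y.
  have e1 : evt [fset n]%fset A' = beta n @^-1` Y.
    by apply/seteqP; split => w /=; [apply; rewrite /= inE|move=> h j /=; rewrite inE => /eqP ->].
  rewrite -e1; apply: IH => // j.
  by rewrite inE => /eqP ->.
pose m' : {measure set (R * R) -> \bar R} := mscale c (pushm (mrestr P mE) (myb n)).
pose m'' : {measure set (R * R) -> \bar R} := pushm P (myb n).
have mSS : measurable (G @^-1` B).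
  by rewrite -[X in measurable X]setTI; apply: mG.
have h1 := @product_measure_unique _ _ _ _ R (distribution P (chain_rv n)) (distribution P (beta n)) m' _ _ mSS.
have h2 := @product_measure_unique _ _ _ _ R (distribution P (chain_rv n)) (distribution P (beta n)) m'' _ _ mSS.
have {h2} : m'' (G @^-1` B) = m' (G @^-1` B).
  rewrite -h1; last first.
    move=> X Y mX mY.
    rewrite -[LHS]/((fine (P E))^-1%:E * P (chain n @^-1` X `&` (beta n @^-1` Y) `&` E))%E.
    rewrite rect// muleCA -[X in (_ * (_ * X))%E](fineK finE) -EFinM mulVf// mule1.
    by [].
  by rewrite -h2// => X Y mX mY; exact: rect1.
rewrite -[X in X = _ -> _]/(P (chain n.+1 @^-1` B)).
rewrite -[X in _ = X -> _]/((fine (P E))^-1%:E * P (chain n.+1 @^-1` B `&` E))%E => ->.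
by rewrite muleAC -[X in (_ * X * _)%E](fineK finE) -EFinM mulVf// mul1e.
Qed.

Lemma chain_law_prod n (S : set (R * R)) : measurable S ->
  P [set w | S (chain n w, beta n w)] =
  (distribution P (chain_rv n) \x distribution P (beta n))%E S.
Proof.
move=> mS; apply/esym.
apply: (@product_measure_unique _ _ _ _ R (distribution P (chain_rv n))
  (distribution P (beta n)) (pushm P (myb n))) => // X Y mX mY.
pose A' (j : nat) := Y.
have e1 : evt [fset n]%fset A' = beta n @^-1` Y.
  by apply/seteqP; split => w /=; [apply; rewrite /= inE|move=> h j /=; rewrite inE => /eqP ->].
rewrite -[LHS]/(P (chain n @^-1` X `&` (beta n @^-1` Y))).
rewrite -e1 chain_indep// ?e1// => j.
by rewrite inE => /eqP ->.
Qed.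

(** The Markov property as an iterated integral: the state and the next input have a product law, to
    which Tonelli applies. *)
Lemma integral_chainS n (mu : {measure set R -> \bar R}) (h : R -> \bar R) :
  (forall A, measurable A -> distribution P (beta n) A = mu A) ->
  measurable_fun setT h -> (forall x, 0 <= h x)%E ->
  (\int[P]_w h (chain n.+1 w) =
   \int[P]_w \int[mu]_b h (G (chain n w, b)))%E.
Proof.
move=> muE mh h0.
have mhG : measurable_fun setT (h \o G) by exact: measurableT_comp.
have h0G z : (0 <= (h \o G) z)%E by exact: h0.
rewrite -[LHS]/(\int[P]_w ((h \o G) (yb n w)))%E -(ge0_integral_pushm P (myb n) mhG)//.
transitivity (\int[(distribution P (chain_rv n) \x distribution P (beta n))%E]_z (h \o G) z)%E.
  by apply: eq_measure_integral => S mS _; exact: chain_law_prod.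
rewrite fubini_tonelli1// ge0_integral_pushforward//; last 2 first.
- exact: measurable_fun_fubini_tonelli_F.
- by move=> y _; apply: integral_ge0 => b _.
rewrite preimage_setT; apply: eq_integral => w _ /=.
by apply: eq_measure_integral => A mA _; rewrite -muE.
Qed.

(** A Lyapunov argument: the one-step bound is uniform over the states [y], so the factor
    multiplying the state may itself depend on the state. *)
Lemma integral_chain_le (mu : {measure set R -> \bar R}) (h : R -> \bar R) (c : R) n :
  (forall t A, measurable A -> distribution P (beta t) A = mu A) ->
  measurable_fun setT h -> (forall x, 0 <= h x)%E -> 0 <= c ->
  (forall y, \int[mu]_b h (G (y, b)) <= c%:E * h y)%E ->
  (\int[P]_w h (chain n w) <= (c ^+ n)%:E * h y0)%E.
Proof.
move=> muE mh h0 c0 hc; elim: n => [|n IH].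
  by rewrite /= (eq_integral (cst (h y0)))// integral_cst// [X in (_ * X)%E]probability_setT mule1 ?expr0 mul1e.
rewrite (integral_chainS (muE n))//.
apply: (@le_trans _ _ (\int[P]_w (c%:E * h (chain n w)))%E).
  apply: ge0_le_integral => //.
  - by move=> w _; apply: integral_ge0 => b _.
  - pose F y := (\int[distribution P (beta n)]_b (h \o G) (y, b))%E.
    have mF : measurable_fun setT F.
      apply: measurable_fun_fubini_tonelli_F; first exact: measurableT_comp.
      by move=> z; exact: h0.
    have -> : (fun w => (\int[mu]_b h (G (chain n w, b)))%E) = F \o chain n.
      apply/funext => w; apply: eq_measure_integral => A mA _.
      by rewrite -(muE n).
    by apply: measurableT_comp => //; exact: measurable_chain.
  - by apply: measurable_funeM; apply: measurableT_comp => //; exact: measurable_chain.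
rewrite ge0_integralZl ?lee_fin//; last first.
  by apply: measurableT_comp => //; exact: measurable_chain.
by rewrite exprS EFinM -muleA lee_wpmul2l ?lee_fin.
Qed.

(** Here [c] is an extended real, because a fractional moment of an unknown stepsize law may be
    infinite. *)
Lemma integral_chain_eq (mu : {measure set R -> \bar R}) (h : R -> \bar R) (c : \bar R) n :
  (forall t A, measurable A -> distribution P (beta t) A = mu A) ->
  measurable_fun setT h -> (forall x, 0 <= h x)%E -> (0 <= c)%E ->
  (forall y, \int[mu]_b h (G (y, b)) = c * h y)%E ->
  (\int[P]_w h (chain n w) = c ^+ n * h y0)%E.
Proof.
move=> muE mh h0 c0 hc; elim: n => [|n IH].
  by rewrite /= (eq_integral (cst (h y0)))// integral_cst// [X in (_ * X)%E]probability_setT mule1 ?expr0 mul1e.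
rewrite (integral_chainS (muE n))//.
under eq_integral do rewrite hc.
rewrite ge0_integralZl//; last first.
  by apply: measurableT_comp => //; exact: measurable_chain.
by rewrite IH expeS muleA.
Qed.

End chain.

(** Markov's inequality at level 1 bounds the masses by a geometric series; Borel-Cantelli
    concludes. *)
Lemma ae_eventually_le1 d (T : measurableType d) (R : realType)
    (mu : {measure set T -> \bar R}) (Z : nat -> T -> R) (K q : R) :
  (forall n, measurable_fun setT (Z n)) -> (forall n w, 0 <= Z n w) ->
  0 < q < 1 -> 0 <= K ->
  (forall n, (\int[mu]_w (Z n w)%:E <= (K * q ^+ n)%:E)%E) ->
  {ae mu, forall w, \forall n \near \oo, Z n w <= 1}.
Proof.
move=> mZ Z0 /andP[q0 q1] K0 ZK.
pose F n := [set w | 1 <= Z n w].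
have mF n : measurable (F n).
  rewrite /F (_ : [set _ | _] = Z n @^-1` `[1, +oo[).
    by rewrite -[X in measurable X]setTI; exact: mZ.
  by apply/seteqP; split => w /=; rewrite in_itv/= andbT.
have FK n : (mu (F n) <= (K * q ^+ n)%:E)%E.
  apply: le_trans (ZK n).
  have := @le_integral_abse _ _ _ mu setT measurableT (EFin \o Z n) 1 _ ltr01.
  rewrite mul1e setTI => h.
  apply: (@le_trans _ _ (\int[mu]_x `|(EFin \o Z n) x|)%E).
    apply: le_trans (h _); last exact/measurable_EFinP.
    apply: le_measure; rewrite ?inE//; last first.
      by move=> w /=; rewrite /F/= lee_fin => Zw; rewrite ger0_norm.
    rewrite (_ : [set _ | _] = F n)//.
    by apply/seteqP; split => w /=; rewrite lee_fin ger0_norm.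
  rewrite (eq_integral (fun w => (Z n w)%:E))// => w _ /=.
  by rewrite ger0_norm.
have limF : mu (lim_sup_set F) = 0%E.
  apply: lim_sup_set_cvg0 => //.
  apply: (@le_lt_trans _ _ (\sum_(0 <= n <oo) (K * q ^+ n)%:E)%E).
    by apply: lee_nneseries => [n _ _|n _]; [exact: measure_ge0|exact: FK].
  have -> : (\sum_(0 <= n <oo) (K * q ^+ n)%:E = (K / (1 - q))%:E)%E.
    apply/cvg_lim => //; apply/cvg_EFin; first by apply: nearW => n; rewrite sumEFin.
    have -> : fine \o (fun n => \sum_(0 <= k < n) (K * q ^+ k)%:E)%E =
              series (geometric K q) :> (nat -> R).
      by apply/funext => n /=; rewrite sumEFin.
    by apply: cvg_geometric_series; rewrite ger0_norm// ltW.
  exact: ltry.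
exists (lim_sup_set F); split => //.
  by apply: bigcapT_measurable => n; apply: bigcup_measurable => k _.
move=> w /= H n _; apply: contrapT => H2; apply: H.
exists n => // k /= nk; rewrite leNgt; apply/negP => Zk; apply: H2.
by exists k => //; rewrite /F/= ltW.
Qed.

(** * Almost sure rate of one scalar recursion *)

Section scalar_descent.
Context d (T : measurableType d) (R : realType) (P : probability T R).
Context (m M : R) (m0 : 0 < m) (mM : m < M).
Variable beta : nat -> {RV P >-> R}.
Hypothesis iid : iid_with_law beta (arcsine_prob m M).
Variables (g : R -> R) (y0 : R).
Hypothesis mg : measurable_fun setT g.
Hypothesis gE : forall y, exists2 lam, m <= lam <= M & g y = lam * y.
Local Notation rho := (accelerated_rate m M).

Definition gd_step (z : R * R) : R := z.1 - z.2^-1 * g z.1.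

Lemma measurable_gd_step : measurable_fun setT gd_step.
Proof.
apply: measurable_funB; first exact: measurable_fst.
apply: measurable_funM.
  by apply: (measurableT_comp (@measurable_invr R)); exact: measurable_snd.
by apply: measurableT_comp => //; exact: measurable_fst.
Qed.

Local Notation y_ := (chain beta gd_step y0).

Let indep : mutually_independent beta. Proof. by case: iid. Qed.
Let mu := distribution P (beta 0).
Let muE : forall t A, measurable A -> distribution P (beta t) A = mu A.
Proof. by case: iid => _ h t A mA; rewrite /mu !h. Qed.
Let muA : forall A, measurable A -> mu A = arcsine_prob m M A.
Proof. by case: iid => _ h A mA; rewrite /mu h. Qed.

Let my n : measurable_fun setT (y_ n).
Proof. by apply: measurable_chain; exact: measurable_gd_step. Qed.

Let stepE y : exists2 lam, m <= lam <= M & forall b, gd_step (y, b) = (1 - lam / b) * y.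
Proof.
have [lam lB gy] := gE y; exists lam => // b.
by rewrite /gd_step /= gy; ring.
Qed.

Let mfactor lam : measurable_fun [set: R] (fun b => 1 - lam / b).
Proof.
by apply: measurable_funB => //; apply: measurable_funM => //; exact: measurable_invr.
Qed.

Let moment_bound : exists2 C : R, 0 <= C & forall s n, `|s| <= 8^-1 ->
  (\int[P]_w (`|y_ n w| `^ s)%:E <= (expR (s * ln rho + C * s ^+ 2) ^+ n)%:E * (`|y0| `^ s)%:E)%E.
Proof.
have [C C0 HC] := arcsine_exp_bound m0 mM.
exists C => // s n s8.
have mp : measurable_fun [set: R] (fun x : R => `|x| `^ s).
  by apply: (measurableT_comp (measurable_powR s)).
pose h (x : R) : \bar R := (`|x| `^ s)%:E.
apply: (@integral_chain_le _ _ _ _ _ indep _ _ measurable_gd_step mu h) => //.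
- exact/measurable_EFinP.
- by move=> x; rewrite /h lee_fin powR_ge0.
move=> y; have [lam lB sE] := stepE y.
have mq : measurable_fun [set: R] (fun b => `|1 - lam / b| `^ s).
  by apply: (measurableT_comp mp).
have -> : (\int[mu]_b h (gd_step (y, b)) = \int[mu]_b ((`|1 - lam / b| `^ s)%:E * (`|y| `^ s)%:E))%E.
  by apply: eq_integral => b _; rewrite /h sE normrM powRM ?normr_ge0// EFinM.
rewrite ge0_integralZr ?lee_fin ?powR_ge0//; last exact/measurable_EFinP.
rewrite lee_wpmul2r ?lee_fin ?powR_ge0//.
rewrite (ge0_integral_arcsine mM muA)//; first exact: HC.
exact/measurable_EFinP.
Qed.

Lemma arcsine_no_atom x : arcsine_prob m M [set x] = 0%E.
Proof.
rewrite /arcsine_prob; exact: integral_set1.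
Qed.

(** The indicator of 0 is run through [integral_chain_le] with c = 1: from a nonzero state the step
    reaches 0 only if b = lam, which the atomless arcsine law excludes. An input b = 0 is harmless,
    since its factor is 1. *)
Lemma chain_neq0 : y0 != 0 -> {ae P, forall w, forall n, y_ n w != 0}.
Proof.
move=> y00; apply: ae_foralln => n.
have mh : measurable_fun [set: R] (fun x : R => ((x == 0)%:R : R)).
  apply: (@measurableT_comp _ _ _ _ _ _ (fun b : bool => b%:R : R)) => //.
  exact: measurable_fun_eqr.
pose h (x : R) : \bar R := ((x == 0)%:R : R)%:E.
have H : (\int[P]_w h (y_ n w) <= (1 ^+ n)%:E * h y0)%E.
  apply: (@integral_chain_le _ _ _ _ _ indep _ _ measurable_gd_step mu h) => //.
  - exact/measurable_EFinP.
  - by move=> x; rewrite /h lee_fin.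
  - move=> y; have [lam lB sE] := stepE y; rewrite mul1e.
    have [y00'|yn0] := eqVneq y 0.
      rewrite (eq_integral (cst 1%E)); last by move=> b _; rewrite /h sE y00' mulr0 eqxx.
      by rewrite integral_cst// mul1e /h y00' eqxx probability_le1.
    have : (\int[mu]_b h (gd_step (y, b)) <= \int[mu]_b (\1_[set lam] b)%:E)%E.
      apply: ge0_le_integral => //.
      - by move=> b _; rewrite /h lee_fin.
      - apply/measurable_EFinP; apply: (measurableT_comp mh).
        by apply: (measurableT_comp measurable_gd_step).
      - by apply/measurable_EFinP; exact: measurable_indic.
      - move=> b _; rewrite lee_fin indicE sE mulf_eq0 (negbTE yn0) orbF.
        have [e|_] := eqVneq (1 - lam / b) 0; last by rewrite ler0n.
        rewrite mem_set//=; move: e; have [->|b0] := eqVneq b 0.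
          by rewrite invr0 mulr0 subr0 => /eqP; rewrite oner_eq0.
        by move/eqP; rewrite subr_eq0 eq_sym => /eqP e; rewrite -[lam](divfK b0) e mul1r.
    move/le_trans; apply.
    rewrite integral_indic// setIT.
    apply: (@le_trans _ _ 0%E); last by rewrite lee_fin.
    rewrite le_eqVlt; apply/orP; left; apply/eqP; rewrite -(arcsine_no_atom lam).
    by apply: muA; exact: measurable_set1.
rewrite /h (negbTE y00) mule0 in H.
exists [set w | y_ n w = 0]; split.
- rewrite (_ : [set _ | _] = y_ n @^-1` [set 0]); last by apply/seteqP; split.
  by rewrite -[X in measurable X]setTI; apply: my => //; exact: measurable_set1.
- apply/eqP; rewrite -measure_le0; apply: le_trans H.
  rewrite (eq_integral (fun w => (\1_[set w | y_ n w = 0] w)%:E)).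
    rewrite integral_indic ?setIT//.
    rewrite (_ : [set _ | _] = y_ n @^-1` [set 0]); last by apply/seteqP; split.
    by rewrite -[X in measurable X]setTI; apply: my => //; exact: measurable_set1.
  move=> w _; rewrite indicE; congr ((nat_of_bool _)%:R%:E).
  by apply/idP/idP => [/eqP h0|]; [rewrite mem_set|rewrite inE/= => ->].
- by move=> w /= /negP; rewrite negbK => /eqP.
Qed.

Lemma chain_rate : y0 != 0 -> {ae P, forall w, forall e, 0 < e ->
  \forall n \near \oo, expR (n%:R * (ln rho - e)) <= `|y_ n w| <= expR (n%:R * (ln rho + e))}.
Proof.
move=> y00.
have [C C0 HC] := moment_bound.
have rho0 := accelerated_rate_gt0 m0 mM.
have p0 s : 0 < `|y0| `^ s by rewrite powR_gt0 ?normr_gt0.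
(* [sg = 1] gives the upper bound and [sg = -1] the lower one *)
have key sg (e : R) : `|sg| = 1 -> 0 < e ->
    exists2 s, 0 < s & {ae P, forall w, \forall n \near \oo,
      `|y_ n w| `^ (sg * s) * expR (- (n%:R * (sg * s * ln rho + s * e))) <= 1}.
  move=> sg1 e0.
  (* Small enough for [moment_bound], and for C s^2 <= s e / 2: of the margin s e, half pays for the
     second-order term and half remains as the geometric ratio q. *)
  pose s := Num.min (8^-1) (e / (2 * (C + 1))).
  have C1 : 0 < 2 * (C + 1) by lra.
  have s0 : 0 < s by rewrite lt_min invr_gt0 divr_gt0// ltr0n.
  have s8 : `|sg * s| <= 8^-1.
    by rewrite normrM sg1 mul1r gtr0_norm// ge_min lexx.
  have sC : C * s <= e / 2.
    have : s <= e / (2 * (C + 1)) by rewrite ge_min lexx orbT.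
    rewrite ler_pdivlMr//; nra.
  exists s => //.
  pose q := expR (- (s * e / 2)).
  have q01 : 0 < q < 1 by rewrite expR_gt0 expR_lt1 oppr_lt0 divr_gt0 ?mulr_gt0.
  apply: (@ae_eventually_le1 _ _ _ P
    (fun n w => `|y_ n w| `^ (sg * s) * expR (- (n%:R * (sg * s * ln rho + s * e))))
    (`|y0| `^ (sg * s)) q) => //.
  - move=> n; apply: measurable_funM => //.
    by apply: (measurableT_comp (measurable_powR (sg * s))); exact: measurableT_comp.
  move=> n; under eq_integral do rewrite EFinM.
  rewrite ge0_integralZr ?lee_fin ?expR_ge0//; last first.
    apply/measurable_EFinP.
    by apply: (measurableT_comp (measurable_powR (sg * s))); exact: measurableT_comp.
  apply: (@le_trans _ _
    ((expR (sg * s * ln rho + C * (sg * s) ^+ 2) ^+ n)%:E * (`|y0| `^ (sg * s))%:E * (expR (- (n%:R * (sg * s * ln rho + s * e))))%:E)%E).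
    by rewrite lee_wpmul2r ?lee_fin ?expR_ge0//; exact: HC.
  rewrite -!EFinM lee_fin mulrAC mulrC ler_wpM2l ?powR_ge0//.
  rewrite -!expRM_natl -expRD ler_expR.
  rewrite -mulrN -mulrDr ler_wpM2l//.
  have sg2 : (sg * s) ^+ 2 = s ^+ 2.
    by rewrite -(@real_normK _ (sg * s)) ?num_real// normrM sg1 mul1r gtr0_norm.
  rewrite sg2; nra.
(* Only countably many values of e may pass under the almost sure quantifier, hence e = 1 / (k +
   1). *)
have h1 : {ae P, forall w, forall k : nat, \forall n \near \oo, `|y_ n w| <= expR (n%:R * (ln rho + k.+1%:R^-1))}.
  apply: ae_foralln => k.
  have e0 : 0 < k.+1%:R^-1 :> R by rewrite invr_gt0.
  have [s s0] := key 1 _ (normr1 _) e0.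
  apply: ae_mono => w; apply: filterS => n.
  rewrite mul1r -mulrDr mulrCA expRN ler_pdivrMr ?expR_gt0// mul1r.
  rewrite (_ : s * (n%:R * _) = (n%:R * (ln rho + k.+1%:R^-1)) * s); last by rewrite mulrC.
  rewrite expRM => h.
  rewrite leNgt; apply/negP => h'; move: h; rewrite leNgt => /negP; apply.
  by apply: gt0_ltr_powR => //; rewrite nnegrE// expR_ge0.
(* The premise [y_ n w != 0] appears because 0 to a negative power is 0, so a bounded negative
   moment says nothing at the state 0. *)
have h2 : {ae P, forall w, forall k : nat, \forall n \near \oo, y_ n w != 0 -> expR (n%:R * (ln rho - k.+1%:R^-1)) <= `|y_ n w|}.
  apply: ae_foralln => k.
  have e0 : 0 < k.+1%:R^-1 :> R by rewrite invr_gt0.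
  have [s s0] := key (-1) _ (normrN1 _) e0.
  apply: ae_mono => w; apply: filterS => n h yn0; move: h.
  have yn1 : 0 < `|y_ n w| by rewrite normr_gt0.
  rewrite mulN1r powRN expRN mulrC -invfM invf_le1 ?mulr_gt0 ?expR_gt0 ?powR_gt0//.
  rewrite (_ : n%:R * _ = - ((n%:R * (ln rho - k.+1%:R^-1)) * s)); last by ring.
  rewrite expRN -ler_pdivrMl ?invr_gt0 ?expR_gt0// invrK mulr1 expRM => h.
  rewrite leNgt; apply/negP => h'; move: h; rewrite leNgt => /negP; apply.
  by apply: gt0_ltr_powR => //; rewrite nnegrE// ltW.
have h3 := chain_neq0 y00.
have h12 : {ae P, forall w,
    (forall k : nat, \forall n \near \oo, expR (n%:R * (ln rho - k.+1%:R^-1)) <= `|y_ n w|) /\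
    (forall k : nat, \forall n \near \oo, `|y_ n w| <= expR (n%:R * (ln rho + k.+1%:R^-1)))}.
  have := ae_mono2 _ h2 h3.
  move/(_ (fun w => forall k : nat, \forall n \near \oo, expR (n%:R * (ln rho - k.+1%:R^-1)) <= `|y_ n w|)) => h23.
  apply: (ae_mono2 _ (h23 _) h1); first by move=> w; split.
  by move=> w a bn k; apply: filterS (a k) => n; apply; exact: bn.
apply: ae_mono h12 => w [lo up] e e0.
have [k ke] : exists k : nat, k.+1%:R^-1 <= e.
  exists (Num.truncn e^-1); rewrite invf_ple ?posrE// ltW// truncnS_gt//.
near=> n; apply/andP; split.
- apply: (@le_trans _ _ (expR (n%:R * (ln rho - k.+1%:R^-1)))).
    by rewrite ler_expR ler_wpM2l// lerB.
  by near: n; exact: lo.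
- apply: (@le_trans _ _ (expR (n%:R * (ln rho + k.+1%:R^-1)))).
    by near: n; exact: up.
  by rewrite ler_expR ler_wpM2l// lerD.
Unshelve. all: by end_near. Qed.

Lemma ae_input_itv : {ae P, forall w, forall t, m <= beta t w <= M}.
Proof.
apply: ae_foralln => t.
have mN : measurable (~` `[m, M]%classic : set R) by apply: measurableC.
exists (beta t @^-1` (~` `[m, M]%classic)); split.
- by rewrite -[X in measurable X]setTI; exact: measurable_funP.
- case: iid => _ h; rewrite -[LHS]/(distribution P (beta t) (~` `[m, M]%classic)) h// arcsine_probE//.
  rewrite (_ : _ @^-1` _ = set0); first exact: measure0.
  apply/seteqP; split => // u /=; rewrite in_itv/=; apply.
  exact: arc_var_itv.
- by move=> w /= H; rewrite in_itv/=.
Qed.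

(** Supplies the dominating constant of the L1 limit: |1 - q| <= M / m for q in [0, M / m], because
    M / m >= 1. *)
Lemma chain_bound : {ae P, forall w, forall n, `|y_ n w| <= (M / m) ^+ n * `|y0|}.
Proof.
apply: ae_mono ae_input_itv => w bB; elim => [|n IH]; first by rewrite expr0 mul1r.
have [lam /andP[l1 l2] sE] := stepE (y_ n w).
rewrite [y_ n.+1 w]sE normrM exprS -mulrA ler_pM//.
have /andP[b1 b2] := bB n.
have b0 : 0 < beta n w by apply: lt_le_trans b1.
have M0 : 0 < M by exact: lt_trans mM.
have q1 : lam / beta n w <= M / m.
  by rewrite ler_pM ?invr_ge0 ?lef_pV2 ?posrE// ?(ltW b0)// (le_trans (ltW m0)).
have q0 : 0 <= lam / beta n w by rewrite divr_ge0 ?(ltW b0)// (le_trans (ltW m0)).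
have k1 : 1 <= M / m by rewrite ler_pdivlMr// mul1r ltW.
by rewrite ler_norml; apply/andP; split; lra.
Qed.

End scalar_descent.

(** * From scalar coordinates to the Euclidean norm *)

Lemma sqrt_sum_sqr_rate (R : realType) (I : finType) (a : I -> nat -> R) (l D : R) (i0 : I) :
  0 < D ->
  (forall i, (forall n, a i n = 0) \/ forall e, 0 < e ->
     \forall n \near \oo, `|a i n| <= expR (n%:R * (l + e))) ->
  (forall e, 0 < e -> \forall n \near \oo, expR (n%:R * (l - e)) <= `|a i0 n|) ->
  (Num.sqrt (\sum_i a i n ^+ 2) / D) `^ (n%:R^-1) @[n --> \oo] --> expR l.
Proof.
move=> D0 up lo.
pose S n := Num.sqrt (\sum_i a i n ^+ 2).
pose L n := n%:R^-1 * ln (S n / D).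
pose K := Num.sqrt #|I|%:R : R.
have K0 : 0 < K by rewrite sqrtr_gt0 ltr0n; apply/card_gt0P; exists i0.
(* The norm lies between one coordinate and sqrt #|I| times a common bound on all of them; these
   constants, like [D], disappear under the n-th root. *)
have Slo n : `|a i0 n| <= S n.
  rewrite -sqrtr_sqr ler_sqrt; last by apply: sumr_ge0 => i _; exact: sqr_ge0.
  by rewrite (bigD1 i0)//= lerDl sumr_ge0// => i _; exact: sqr_ge0.
have up' e : 0 < e -> \forall n \near \oo, forall i, `|a i n| <= expR (n%:R * (l + e)).
  move=> e0; apply: filter_forall => i.
  case: (up i) => [ai0|]; last exact.
  by apply: nearW => n; rewrite ai0 normr0 expR_ge0.
have Sup n x : 0 <= x -> (forall i, `|a i n| <= x) -> S n <= K * x.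
  move=> x0 ax; rewrite -[x]ger0_norm// -sqrtr_sqr -sqrtrM ?ler0n//.
  rewrite ler_sqrt ?mulr_ge0 ?sqr_ge0//.
  apply: (@le_trans _ _ (\sum_(i : I) x ^+ 2)); last by rewrite sumr_const mulr_natl.
  apply: ler_sum => i _; rewrite -(@real_normK _ (a i n)) ?num_real//.
  by rewrite lerXn2r ?nnegrE.
have S0 : \forall n \near \oo, 0 < S n.
  have := lo 1 ltr01; apply: filterS => n h.
  by apply: lt_le_trans (Slo n); apply: lt_le_trans h; exact: expR_gt0.
have cL : L n @[n --> \oo] --> l.
  apply/cvgrPdist_le => e e0.
  have e2 : 0 < e / 2 by rewrite divr_gt0.
  pose c := `|ln K| + `|ln D|.
  near=> n.
  have n0 : 0 < n%:R :> R by rewrite ltr0n; near: n; exact: nbhs_infty_gt.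
  have Sn : 0 < S n by near: n.
  have h1 : expR (n%:R * (l - e / 2)) <= S n.
    by apply: le_trans (Slo n); near: n; exact: lo.
  have h2 : S n <= K * expR (n%:R * (l + e / 2)).
    by apply: Sup; [exact: expR_ge0|near: n; exact: up'].
  have cn : c <= n%:R * (e / 2).
    rewrite -ler_pdivrMr//; near: n; exact: nbhs_infty_ger.
  have l1 : n%:R * (l - e / 2) <= ln (S n).
    by rewrite -[leLHS]expRK ler_ln ?posrE ?expR_gt0.
  have l2 : ln (S n) <= ln K + n%:R * (l + e / 2).
    by rewrite -[X in _ + X]expRK -lnM ?posrE ?expR_gt0// ler_ln ?posrE ?mulr_gt0 ?expR_gt0.
  rewrite /L ln_div ?posrE//.
  have k1 := ler_norm (ln K); have k2 := ler_norm (- ln D); have k3 := ler_norm (ln D).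
  rewrite normrN in k2.
  have k4 := normr_ge0 (ln K).
  have -> : l - n%:R^-1 * (ln (S n) - ln D) = n%:R^-1 * (n%:R * l - (ln (S n) - ln D)).
    by rewrite [RHS]mulrBr mulKf ?gt_eqF.
  rewrite normrM gtr0_norm ?invr_gt0// ler_pdivrMl// ler_norml.
  rewrite /c in cn; apply/andP; split; lra.
have cE : expR (L n) @[n --> \oo] --> expR l.
  exact: (cvg_comp L expR cL (@continuous_expR R l)).
apply: cvg_trans cE; apply: near_eq_cvg; near=> n.
have Sn : 0 < S n by near: n.
by rewrite /powR gt_eqF// divr_gt0.
Unshelve. all: by end_near. Qed.

Section decoupled_descent.
Context d (T : measurableType d) (R : realType) (P : probability T R).
Context (m M : R) (m0 : 0 < m) (mM : m < M).
Variable beta : nat -> {RV P >-> R}.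
Hypothesis iid : iid_with_law beta (arcsine_prob m M).
Variables (I : finType) (g : I -> R -> R) (y0 : I -> R).
Hypothesis mg : forall i, measurable_fun setT (g i).
Hypothesis gE : forall i y, exists2 lam, m <= lam <= M & g i y = lam * y.
Hypothesis y00 : exists i, y0 i != 0.
Local Notation rho := (accelerated_rate m M).
Local Notation y_ i := (chain beta (gd_step (g i)) (y0 i)).

Let D := Num.sqrt (\sum_i y0 i ^+ 2).
Let Y n w := (Num.sqrt (\sum_i y_ i n w ^+ 2) / D) `^ (n%:R^-1).

Let D0 : 0 < D.
Proof.
have [i yi] := y00; rewrite sqrtr_gt0 (bigD1 i)//=.
by rewrite ltr_pwDl ?exprn_even_gt0// sumr_ge0// => j _; exact: sqr_ge0.
Qed.

Let gi0 i : g i 0 = 0. Proof. by have [lam _ ->] := gE i 0; rewrite mulr0. Qed.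

Let chain0 i n w : y0 i = 0 -> y_ i n w = 0.
Proof. by move=> yi; elim: n => [//|n IH] /=; rewrite /gd_step IH /= gi0 mulr0 subrr. Qed.

Lemma decoupled_rate_ae : {ae P, forall w, Y n w @[n --> \oo] --> rho}.
Proof.
have rho0 := accelerated_rate_gt0 m0 mM.
have [i0 yi0] := y00.
have h : {ae P, forall w, forall i, y0 i != 0 -> forall e, 0 < e ->
  \forall n \near \oo, expR (n%:R * (ln rho - e)) <= `|y_ i n w| <= expR (n%:R * (ln rho + e))}.
  have : forall i, {ae P, forall w, y0 i != 0 -> forall e, 0 < e ->
      \forall n \near \oo, expR (n%:R * (ln rho - e)) <= `|y_ i n w| <= expR (n%:R * (ln rho + e))}.
    move=> i; have [->|yi] := eqVneq (y0 i) 0.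
      by apply: aeW => w.
    by apply: ae_mono (chain_rate m0 mM iid (mg i) (gE i) yi) => w.
  exact: filter_forall.
apply: ae_mono h => w h.
rewrite -[rho in X in _ --> X]lnK ?posrE//.
apply: (@sqrt_sum_sqr_rate _ _ (fun i n => y_ i n w) _ _ i0 D0).
- move=> i; have [yi|yi] := eqVneq (y0 i) 0; [left => n; exact: chain0|right => e e0].
  by apply: filterS (h i yi e e0) => n /andP[].
- by move=> e e0; apply: filterS (h i0 yi0 e e0) => n /andP[].
Qed.

Let mY n : measurable_fun setT (Y n).
Proof.
apply: (measurableT_comp (measurable_powR (n%:R^-1))).
apply: measurable_funM => //.
apply: measurableT_comp; first by apply: continuous_measurable_fun; exact: sqrt_continuous.
apply: measurable_sum => i; apply: measurable_funX.
by apply: measurable_chain; apply: measurable_gd_step; exact: mg.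
Qed.

Let Ybound : {ae P, forall w, forall n, Y n w <= M / m}.
Proof.
have k1 : 1 <= M / m by rewrite ler_pdivlMr// mul1r ltW.
have : {ae P, forall w, forall i n, `|y_ i n w| <= (M / m) ^+ n * `|y0 i|}.
  have : forall i, {ae P, forall w, forall n, `|y_ i n w| <= (M / m) ^+ n * `|y0 i|}.
    by move=> i; apply: (chain_bound m0 mM iid); exact: gE.
  exact: filter_forall.
apply: ae_mono => w h [|n]; first by rewrite /Y invr0 powRr0.
have k0 : 0 <= (M / m) ^+ n.+1 by rewrite exprn_ge0// (le_trans ler01).
have S1 : Num.sqrt (\sum_i y_ i n.+1 w ^+ 2) <= (M / m) ^+ n.+1 * D.
  rewrite -[(M / m) ^+ _]ger0_norm// -sqrtr_sqr -sqrtrM ?sqr_ge0//.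
  rewrite ler_sqrt; last by rewrite mulr_ge0 ?sqr_ge0// sumr_ge0// => i _; exact: sqr_ge0.
  rewrite mulr_sumr; apply: ler_sum => i _.
  rewrite -exprMn -(@real_normK _ (y_ i n.+1 w)) ?num_real//.
  rewrite -[leRHS](@real_normK _ _) ?num_real// normrM [X in X * _]ger0_norm//.
  by rewrite lerXn2r ?nnegrE ?mulr_ge0 ?normr_ge0//; exact: h.
have S2 : Num.sqrt (\sum_i y_ i n.+1 w ^+ 2) / D <= (M / m) ^+ n.+1.
  by rewrite ler_pdivrMr.
apply: (@le_trans _ _ (((M / m) ^+ n.+1) `^ (n.+1%:R^-1))).
  by apply: ge0_ler_powR; rewrite ?nnegrE ?divr_ge0 ?sqrtr_ge0// ltW.
rewrite -powR_mulrn ?(le_trans ler01)// -powRrM divff// powRr1//.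
by rewrite (le_trans ler01).
Qed.

Lemma decoupled_rate_L1 : (\int[P]_w (`|Y n w - rho|)%:E)%E @[n --> \oo] --> 0%E.
Proof.
have mYE n : measurable_fun setT (fun w => (Y n w)%:E) by exact/measurable_EFinP/mY.
have mr : measurable_fun [set: T] (fun=> rho%:E) by exact: measurable_cst.
have cv : {ae P, forall w, setT w -> (fun n => (Y n w)%:E) n @[n --> \oo] --> rho%:E}.
  by apply: ae_mono decoupled_rate_ae => w h _; apply: cvg_EFin => //; exact: nearW.
have ib : P.-integrable setT (EFin \o (fun=> M / m)) by exact: finite_measure_integrable_cst.
have bd : {ae P, forall w n, setT w -> (`|(Y n w)%:E| <= (M / m)%:E)%E}.
  apply: ae_mono Ybound => w h n _.
  by rewrite abse_EFin lee_fin ger0_norm ?h// powR_ge0.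
have [_ + _] := @dominated_convergence _ _ _ P setT measurableT
  (fun n w => (Y n w)%:E) (fun=> rho%:E) (EFin \o (fun=> M / m)) mYE mr cv ib bd.
by [].
Qed.

End decoupled_descent.

(** * Decoupling of separable functions *)

Section decoupling.
Context (R : realType) (d : nat) (f : 'cV[R]_d -> R).
Context (U : 'M[R]_d) (g : 'I_d -> R -> R).
Hypothesis UU : U *m U^T = 1%:M.
Hypothesis fE : forall x, f x = \sum_(i < d) g i ((U *m x) i ord0).
Hypothesis df : forall x, differentiable f x.

Let UtU : U^T *m U = 1%:M. Proof. exact: mulmx1C. Qed.

Lemma enorm_mulmx_orthogonal (x : 'cV[R]_d) : enorm (U *m x) = enorm x.
Proof.
congr Num.sqrt.
have E (z : 'cV[R]_d) : \sum_i z i ord0 ^+ 2 = (z^T *m z) ord0 ord0.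
  by rewrite mxE; apply: eq_bigr => i _; rewrite mxE expr2.
by rewrite !E trmx_mul mulmxA -(mulmxA x^T) UtU mulmx1.
Qed.

Lemma normr_le_enorm (x : 'cV[R]_d) i : `|x i ord0| <= enorm x.
Proof.
rewrite -sqrtr_sqr ler_sqrt; last by rewrite sumr_ge0// => j _; exact: sqr_ge0.
by rewrite (bigD1 i)//= lerDl sumr_ge0// => j _; exact: sqr_ge0.
Qed.

(** The i-th row of [U] as a column: moving along it changes only the i-th rotated coordinate. *)
Definition axis (i : 'I_d) : 'cV[R]_d := U^T *m delta_mx i ord0.

Lemma mulmx_axis i j : (U *m axis i) j ord0 = (j == i)%:R.
Proof. by rewrite /axis mulmxA UU mul1mx mxE eqxx andbT. Qed.

Lemma mulmx_addaxis (x : 'cV[R]_d) h i j :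
  (U *m (x + h *: axis i)) j ord0 = (U *m x) j ord0 + (j == i)%:R * h.
Proof. by rewrite mulmxDr -scalemxAr mxE [X in _ + X]mxE mulmx_axis mulrC. Qed.

Lemma enorm_axis h i : enorm (h *: axis i) = `|h|.
Proof.
rewrite -enorm_mulmx_orthogonal /enorm (bigD1 i)//= big1 => [|j ji].
  by rewrite addr0 -scalemxAr mxE mulmx_axis eqxx mulr1 sqrtr_sqr.
by rewrite -scalemxAr mxE mulmx_axis (negbTE ji) mulr0 expr0n.
Qed.

Lemma sub_axis (x : 'cV[R]_d) h i :
  f (x + h *: axis i) - f x = g i ((U *m x) i ord0 + h) - g i ((U *m x) i ord0).
Proof.
rewrite !fE -sumrB (bigD1 i)//= big1 => [|j ji]; first by rewrite mulmx_addaxis eqxx mul1r addr0.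
by rewrite mulmx_addaxis (negbTE ji) mul0r addr0 subrr.
Qed.

Let quotientE x i : (fun h => h^-1 *: ((f \o shift x) (h *: axis i) - f x)) =
  (fun h => h^-1 *: (g i (h + (U *m x) i ord0) - g i ((U *m x) i ord0))).
Proof.
by apply/funext => h /=; rewrite [h *: _ + x]addrC sub_axis [h + _]addrC.
Qed.

Lemma derive_axis x i : 'D_(axis i) f x = derive1 (g i) ((U *m x) i ord0).
Proof. by rewrite /derive quotientE. Qed.

(** Differentiability is known for f alone; along [axis i] the other components cancel, so the
    difference quotients of f are those of [g i]. *)
Lemma derivable_component i r : derivable (g i) r 1.
Proof.
have := @diff_derivable _ _ _ f (U^T *m (r *: delta_mx i ord0)) (axis i) (df _).
rewrite /derivable quotientE.
rewrite mulmxA UU mul1mx mxE mxE !eqxx mulr1 => h.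
rewrite (_ : (fun h0 => _) = (fun h => h^-1 *: (g i (h + r) - g i r)))//.
by apply/funext => h' /=; rewrite [h'%:A]mulr1.
Qed.

(** The differential is linear and [axis i] has coordinates [U i j], so rotating the gradient by [U]
    yields the derivatives along the axes. *)
Lemma gradientE x i : (U *m gradient f x) i ord0 = derive1 (g i) ((U *m x) i ord0).
Proof.
rewrite -derive_axis deriveE; last exact: df.
have -> : axis i = \sum_j U i j *: delta_mx j ord0.
  apply/matrixP => k l; rewrite ord1 summxE (bigD1 k)//= big1 => [|j jk].
    rewrite addr0 /axis !mxE (bigD1 i)//= big1 => [|j ji].
      by rewrite !mxE !eqxx mulr1 addr0.
    by rewrite !mxE (negbTE ji) mulr0.
  by rewrite !mxE eq_sym (negbTE jk) mulr0.
rewrite linear_sum mxE; apply: eq_bigr => j _.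
by rewrite linearZ mxE deriveE; last exact: df.
Qed.

Context (m M : R) (xs : 'cV[R]_d).
Hypotheses (m0 : 0 < m) (mM : m < M).
Hypothesis sm : smooth M f.
Hypothesis sc : strongly_convex m f.
Hypothesis ms : is_minimizer f xs.

Let z i := (U *m xs) i ord0.

Definition component_gradient i y := derive1 (g i) (z i + y).
Local Notation G := component_gradient.

Let xsE i y : (U *m (xs + y *: axis i)) i ord0 = z i + y.
Proof. by rewrite mulmx_addaxis eqxx mul1r. Qed.

Lemma component_gradient_lipschitz i y y' : `|G i y - G i y'| <= M * `|y - y'|.
Proof.
rewrite /G -!xsE -!gradientE.
have -> : (U *m gradient f (xs + y *: axis i)) i ord0 - (U *m gradient f (xs + y' *: axis i)) i ord0
  = (U *m (gradient f (xs + y *: axis i) - gradient f (xs + y' *: axis i))) i ord0.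
  by rewrite mulmxBr [RHS]mxE [X in _ = _ + X]mxE.
apply: le_trans (normr_le_enorm _ _) _.
rewrite enorm_mulmx_orthogonal.
have [_ /(_ (xs + y *: axis i) (xs + y' *: axis i))] := sm.
have -> : xs + y *: axis i - (xs + y' *: axis i) = (y - y') *: axis i.
  by rewrite opprD addrACA subrr add0r scalerBl.
by rewrite enorm_axis.
Qed.

Lemma measurable_component_gradient i : measurable_fun setT (G i).
Proof.
have M0 : 0 < M by exact: lt_trans mM.
apply: continuous_measurable_fun => y.
apply/cvgrPdist_le => e e0; near=> y'.
apply: le_trans (component_gradient_lipschitz _ _ _) _.
rewrite mulrC -ler_pdivlMr//.
near: y'; apply: (@cvgr_dist_le _ _ _ _ _ id y) => //.
by rewrite divr_gt0.
Unshelve. all: by end_near. Qed.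

(** On a line along [axis i] the other components cancel, so strong convexity passes to [g i].
    Dividing the chord inequality by t and letting t decrease to 0 turns it into this tangent
    inequality. *)
Let first_order i a b : derive1 (g i) b * (a - b) <= g i a - g i b - m / 2 * (a - b) ^+ 2.
Proof.
(* Starting from a point whose i-th rotated coordinate is 0 makes [r] in [X r] the value of that
   coordinate. *)
pose x0 := xs + (- z i) *: axis i.
pose X r := x0 + r *: axis i.
have Xi r : (U *m X r) i ord0 = r.
  by rewrite /X /x0 !mulmx_addaxis eqxx !mul1r -/(z i) subrr add0r.
have XB r s : X r = X s + (r - s) *: axis i.
  by rewrite {1}(_ : r = s + (r - s)); [rewrite /X scalerDl addrA|ring].
have gB r s : f (X r) - f (X s) = g i r - g i s.
  by rewrite (XB r s) sub_axis Xi [s + _]addrC subrK.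
have conv t : 0 <= t -> t <= 1 ->
    g i (b + t * (a - b)) - g i b <= t * (g i a - g i b) - m / 2 * t * (1 - t) * (a - b) ^+ 2.
  move=> t0 t1; have := sc (X a) (X b) t0 t1.
  have -> : t *: X a + (1 - t) *: X b = X (b + t * (a - b)).
    rewrite (XB (b + t * (a - b)) b) (XB a b) [b + _]addrC addrK.
    move: (X b) => v; rewrite scalerDr addrAC -scalerDl [t + _]addrC subrK.
    by rewrite scale1r scalerA.
  have -> : X a - X b = (a - b) *: axis i by rewrite (XB a b) addrC addKr.
  rewrite enorm_axis real_normK ?num_real// => h.
  have := gB (b + t * (a - b)) b; have := gB a b; nra.
have dg : is_derive b 1 (g i) (derive1 (g i) b).
  by rewrite derive1E; apply/derivableP; exact: derivable_component.
pose psi (t : R) := g i (b + t * (a - b)).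
have dl : is_derive (0 : R) 1 (fun t : R => b + t * (a - b)) (a - b).
  apply: is_derive_eq; rewrite /GRing.scale/=; ring.
have dpsi : is_derive (0 : R) 1 psi (derive1 (g i) b * (a - b)).
  apply: is_derive1_comp.
  by rewrite mul0r addr0.
case: dpsi => dpsi dval; rewrite -dval.
pose C := g i a - g i b - m / 2 * (a - b) ^+ 2.
have c1 : (fun h : R => h^-1 *: ((psi \o shift 0) (h *: 1) - psi 0)) @ 0^'+ --> 'D_1 psi 0.
  by apply: cvg_dnbhs_at_right; exact: dpsi.
have c2 : (fun h : R => C + h * (m / 2 * (a - b) ^+ 2)) @ 0^'+ --> C.
  rewrite -[X in _ --> X]addr0 -[X in _ --> _ + X](mul0r (m / 2 * (a - b) ^+ 2)).
  apply: cvg_at_right_filter; apply: cvgD; first exact: cvg_cst.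
  by apply: cvgM; [exact: cvg_id|exact: cvg_cst].
apply: (ler_cvg_to c1 c2).
near=> h.
have h0 : 0 < h by [].
have h1 : h <= 1 by near: h; exact: nbhs_right_le.
rewrite /= addr0 [h%:A]mulr1 /GRing.scale/= ler_pdivrMl// /psi mul0r addr0.
have := conv h (ltW h0) h1; rewrite /C; nra.
Unshelve. all: by end_near. Qed.

Lemma component_gradient0 i : G i 0 = 0.
Proof.
rewrite /G addr0 derive1E.
have h : is_derive (z i) 1 (g i) 0.
  apply: (@derive1_at_min _ (g i) (z i - 1) (z i + 1)).
  - lra.
  - by move=> t _; exact: derivable_component.
  - by rewrite in_itv/=; apply/andP; split; lra.
  - move=> t _; have := ms (xs + (t - z i) *: axis i).
    by rewrite -subr_ge0 sub_axis -/(z i) [z i + _]addrC subrK subr_ge0.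
by rewrite derive_val.
Qed.

(** The curvature is the secant slope of the derivative, so no second derivative enters. Adding
    [first_order] in both directions between 0 and y gives the lower bound m, and the Lipschitz
    bound gives M. At y = 0 any slope fits. *)
Lemma component_gradientE i y : exists2 lam, m <= lam <= M & G i y = lam * y.
Proof.
have [->|y0] := eqVneq y 0.
  by exists m; rewrite ?lexx ?(ltW mM)// mulr0 component_gradient0.
have lo : m * y ^+ 2 <= G i y * y.
  have h1 := first_order i (z i) (z i + y).
  have h2 := first_order i (z i + y) (z i).
  have := component_gradient0 i; rewrite /G addr0 => g0.
  rewrite g0 in h2; rewrite /G; nra.
have up : `|G i y| <= M * `|y|.
  by have := component_gradient_lipschitz i y 0; rewrite component_gradient0 !subr0.
exists (G i y / y); last by rewrite divfK.
have y2 : 0 < y ^+ 2 by rewrite exprn_even_gt0.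
have -> : G i y / y = (G i y * y) / y ^+ 2 by field.
rewrite ler_pdivlMr// lo/= ler_pdivrMr//.
rewrite (le_trans (ler_norm _))// normrM.
rewrite -(@real_normK _ y) ?num_real// expr2 mulrA.
by rewrite ler_wpM2r.
Qed.

Lemma gd_decoupled (beta : nat -> R) (x0 : 'cV[R]_d) i n :
  (U *m (gd f (fun t => (beta t)^-1) x0 n.+1 - xs)) i ord0 =
  gd_step (G i) ((U *m (gd f (fun t => (beta t)^-1) x0 n - xs)) i ord0, beta n).
Proof.
rewrite /gd_step /= /G; set x := gd _ _ _ n.
have zE : z i + (U *m (x - xs)) i ord0 = (U *m x) i ord0.
  by rewrite mulmxBr [X in _ + X]mxE [X in _ + (_ + X)]mxE addrC subrK.
rewrite zE -gradientE addrAC mulmxBr [LHS]mxE [X in _ + X]mxE -scalemxAr.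
by rewrite [X in _ - X]mxE.
Qed.

End decoupling.

Lemma arcsine_achieves_rate (R : realType) (m M : R) (m0 : 0 < m) (mM : m < M)
    (dT : measure_display) (T : measurableType dT)
    (P : probability T R) (beta : nat -> {RV P >-> R}) :
  iid_with_law beta (arcsine_prob m M) -> achieves_rate m M beta.
Proof.
move=> iid d f xs x0 _ [U [UU [g fE]]] sc sm ms x0xs Y.
have [df _] := sm.
pose G := component_gradient U g xs.
pose y0 i := (U *m (x0 - xs)) i ord0.
have mG i : measurable_fun setT (G i).
  exact: (measurable_component_gradient UU fE df xs m0 mM sm).
have GE i y : exists2 lam, m <= lam <= M & G i y = lam * y.
  exact: (component_gradientE UU fE df mM sm sc ms).
have y00 : exists i, y0 i != 0.
  apply/existsP; apply: contraT; rewrite negb_exists => /forallP h.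
  move: x0xs; rewrite -subr_eq0 => /eqP; case.
  have -> : x0 - xs = U^T *m (U *m (x0 - xs)).
    by rewrite mulmxA (mulmx1C UU) mul1mx.
  rewrite (_ : U *m (x0 - xs) = 0) ?mulmx0//.
  apply/matrixP => i j; rewrite ord1 [RHS]mxE; apply/eqP.
  by have := h i; rewrite negbK.
have chainE i n w : chain beta (gd_step (G i)) (y0 i) n w =
    (U *m (gd f (fun t => (beta t w)^-1) x0 n - xs)) i ord0.
  elim: n => [//|n IH].
  by rewrite (gd_decoupled UU fE df xs (fun t => beta t w)) /= IH.
have YE n w : Y n w = (Num.sqrt (\sum_i chain beta (gd_step (G i)) (y0 i) n w ^+ 2) /
    Num.sqrt (\sum_i y0 i ^+ 2)) `^ (n%:R^-1).
  rewrite /Y /avg_rate -(enorm_mulmx_orthogonal UU (_ - xs)) -(enorm_mulmx_orthogonal UU (x0 - xs)).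
  by rewrite /enorm; under eq_bigr do rewrite -chainE.
split.
  apply: ae_mono (decoupled_rate_ae m0 mM iid mG GE y00) => w.
  by under eq_fun do rewrite -YE.
apply: cvg_trans (decoupled_rate_L1 m0 mM iid mG GE y00).
apply: near_eq_cvg; apply: nearW => n; apply: eq_integral => w _.
by rewrite YE.
Qed.

(** * Geometric means and one-dimensional quadratics *)

(** Squeezed between l_n and l_n + 4 l_n^2 exp |l_n| / 2^n. Letting [l_] vary covers both the
    pointwise limit of [g k] below and the limit of its integrals. *)
Lemma cvg_mulr_expRB1 (R : realType) (l_ : nat -> R) (l : R) :
  l_ n @[n --> \oo] --> l ->
  (2 ^+ n * (expR (l_ n / 2 ^+ n) - 1)) @[n --> \oo] --> l.
Proof.
move=> cl.
have c1 : l_ n + l_ n ^+ 2 * (4 * expR `|l_ n|) * 2^-1 ^+ n @[n --> \oo] --> l.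
  rewrite -[X in _ --> X]addr0 -(mulr0 (l ^+ 2 * (4 * expR `|l|))).
  apply: cvgD => //; apply: cvgM; last first.
    have := @cvg_geometric R 1 2^-1; rewrite /geometric/=.
    under eq_fun do rewrite mul1r; apply.
    by rewrite ger0_norm ?invr_ge0// invf_lt1 ?ltr1n.
  apply: cvgM; first by under eq_fun do rewrite expr2; apply: cvgM.
  apply: cvgM; first exact: cvg_cst.
  apply: (cvg_comp (fun n => `|l_ n|) expR _ (@continuous_expR R _)).
  exact: cvg_norm.
apply: (squeeze_cvgr _ cl c1); near=> n.
have p0 : 0 < 2 ^+ n :> R by rewrite exprn_gt0.
have p1 : 1 <= 2 ^+ n :> R by rewrite exprn_ege1// ler1n.
have lE : l_ n = 2 ^+ n * (l_ n / 2 ^+ n) by rewrite mulrC divfK// gt_eqF.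
apply/andP; split.
  rewrite {1}lE ler_pM2l// lerBrDl; exact: expR_ge1Dx.
have h := expR_le_quadratic (l_ n / 2 ^+ n).
have h2 : expR `|l_ n / 2 ^+ n| <= expR `|l_ n|.
  rewrite ler_expR normrM normfV (gtr0_norm p0).
  by rewrite ler_pdivrMr// ler_peMr.
have e0 := expR_gt0 `|l_ n|.
apply: (@le_trans _ _ (2 ^+ n * (l_ n / 2 ^+ n + 4 * (l_ n / 2 ^+ n) ^+ 2 * expR `|l_ n|))).
  rewrite ler_pM2l//.
  have : 4 * (l_ n / 2 ^+ n) ^+ 2 * expR `|l_ n / 2 ^+ n| <= 4 * (l_ n / 2 ^+ n) ^+ 2 * expR `|l_ n|.
    by rewrite ler_wpM2l// mulr_ge0// sqr_ge0.
  lra.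
rewrite exprVn; set q := 2 ^+ n in p0 p1 *.
by rewrite le_eqVlt; apply/orP; left; apply/eqP; field; rewrite gt_eqF.
Unshelve. all: by end_near. Qed.

Section geometric_mean.
Context d (T : measurableType d) (R : realType) (P : probability T R).
Variables (v : T -> R) (rho : R).
Hypothesis mv : measurable_fun setT v.
Hypothesis v0 : forall x, 0 < v x.
Hypothesis rho0 : 0 < rho.

Let c k : \bar R := (\int[P]_x (v x `^ (2 ^+ k)^-1)%R%:E)%E.
Hypothesis cvc : ((c k) ^+ (2 ^ k)%N)%E @[k --> \oo] --> rho%:E.

Let g k x := 2 ^+ k * (v x `^ (2 ^+ k)^-1 - 1).

Let mpow k : measurable_fun setT (fun x => v x `^ (2 ^+ k)^-1).
Proof. exact: (measurableT_comp (measurable_powR (2 ^+ k)^-1) mv). Qed.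

Let mg k : measurable_fun setT (g k).
Proof. by apply: measurable_funM => //; apply: measurable_funB. Qed.

Let powE k x : v x `^ (2 ^+ k)^-1 = expR (ln (v x) / 2 ^+ k).
Proof. by rewrite /powR gt_eqF// mulrC. Qed.

(** With y = v^(1/2^(k+1)) the difference is 2^k (y - 1)^2: dyadic exponents turn monotonicity into
    a perfect square. *)
Let g_dec k x : g k.+1 x <= g k x.
Proof.
rewrite /g !powE; set y := expR (_ / 2 ^+ k.+1).
have -> : expR (ln (v x) / 2 ^+ k) = y ^+ 2.
  by rewrite -expRM_natl exprS; congr expR; field; rewrite expf_neq0.
have p0 : 0 < 2 ^+ k :> R by rewrite exprn_gt0.
have h : 2 * (y - 1) <= y ^+ 2 - 1 by have := sqr_ge0 (y - 1); lra.
by rewrite exprSr -mulrA ler_pM2l.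
Qed.

Let g_noninc k n x : g (k + n) x <= g k x.
Proof.
elim: n => [|n IH]; first by rewrite addn0.
by rewrite addnS (le_trans (g_dec _ _)).
Qed.

Let g_cvg x : g k x @[k --> \oo] --> ln (v x).
Proof.
rewrite /g; under eq_fun do rewrite powE.
by apply: cvg_mulr_expRB1; exact: cvg_cst.
Qed.

Let c_ge0 k : (0 <= c k)%E.
Proof. by apply: integral_ge0 => x _; rewrite lee_fin powR_ge0. Qed.

(** A positive power of +oo is +oo, so convergence to a finite limit forces finite moments from some
    rank on. *)
Let c_fin : exists K, forall k, (K <= k)%N -> c k \is a fin_num.
Proof.
have [+ _] := (fine_cvgP _ _).1 cvc => -[K _ cK]; exists K => k /cK.
have := c_ge0 k; case: (c k) => // _ /=.
suff -> : forall n, (0 < n)%N -> (+oo ^+ n = +oo :> \bar R)%E by rewrite ?expn_gt0.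
elim=> // -[_ _|n IH _]; first by [].
by rewrite expeS IH// mulyy.
Qed.

Let cvc' : (2 ^+ k * (fine (c k) - 1)) @[k --> \oo] --> ln rho.
Proof.
have [K cK] := c_fin.
have cr : (fine (c k)) ^+ (2 ^ k) @[k --> \oo] --> rho.
  apply: cvg_trans (fine_cvg cvc); apply: near_eq_cvg; near=> k.
  have /fineK : c k \is a fin_num by apply: cK; near: k; exact: nbhs_infty_ge.
  by rewrite /comp; case: (c k) => // r _; rewrite -EFin_expe.
have cl : ln ((fine (c k)) ^+ (2 ^ k)) @[k --> \oo] --> ln rho.
  by apply: (cvg_comp (fun k => fine (c k) ^+ (2 ^ k)) (@ln R) cr); exact: continuous_ln.
apply: cvg_trans (cvg_mulr_expRB1 cl); apply: near_eq_cvg; near=> k.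
congr (_ * (_ - 1)).
have cp : 0 < fine (c k) ^+ (2 ^ k) by near: k; exact: (cvgr_gt _ cr).
have ck0 : 0 < fine (c k).
  rewrite lt0r fine_ge0// andbT; apply: contraTN cp => /eqP ->.
  by rewrite expr0n expn_eq0/= ltxx.
rewrite lnXn// -[ln _ *+ _]mulr_natr natrX mulfK ?lnK ?posrE//.

Unshelve. all: by end_near. Qed.

(** The functions 2^k (v^(1/2^k) - 1) decrease to ln v, and their integrals 2^k (c k - 1) tend to ln
    rho because (c k)^(2^k) tends to rho. Monotone convergence is applied to the nonnegative
    differences from rank [K]; integrability of ln v is an outcome, read off the finite limit. *)
Lemma integral_ln_geometric_mean :
  P.-integrable setT (EFin \o (fun x => ln (v x))) /\
  \int[P]_x (ln (v x)) = ln rho.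
Proof.
have [K cK] := c_fin.
have ipow k : (K <= k)%N -> P.-integrable setT (EFin \o (fun x => v x `^ (2 ^+ k)^-1)).
  move=> Kk; apply/integrableP; split; first exact/measurable_EFinP.
  rewrite (eq_integral (fun x => (v x `^ (2 ^+ k)^-1)%:E)); last first.
    by move=> x _ /=; rewrite ger0_norm ?powR_ge0.
  by rewrite ltey_eq cK.
have i1 : P.-integrable setT (EFin \o (fun=> 1 : R)) by exact: finite_measure_integrable_cst.
have ig k : (K <= k)%N -> P.-integrable setT (EFin \o g k).
  move=> Kk; have iB : P.-integrable setT (EFin \o (fun x => v x `^ (2 ^+ k)^-1 - 1)).
    by have := integrableB measurableT (ipow k Kk) i1.
  by have := integrableZl measurableT (2 ^+ k) iB.
have gE k : (K <= k)%N -> \int[P]_x (g k x) = 2 ^+ k * (fine (c k) - 1).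
  move=> Kk; rewrite /g RintegralZl//; last first.
    by have := integrableB measurableT (ipow k Kk) i1.
  rewrite RintegralB//; last exact: ipow.
  by rewrite Rintegral_cst// [X in fine X]probability_setT mulr1.
pose F n x : \bar R := (g K x - g (K + n) x)%:E.
have mF n : measurable_fun setT (F n).
  by apply/measurable_EFinP; exact: measurable_funB.
have F0 n x : (0 <= F n x)%E by rewrite lee_fin subr_ge0 g_noninc.
have ndF x : {homo F ^~ x : p q / (p <= q)%N >-> (p <= q)%E}.
  move=> p q pq; rewrite lee_fin lerB// -(subnKC pq) addnA; exact: g_noninc.
have cgK y : g (K + n) y @[n --> \oo] --> ln (v y).
  under eq_fun do rewrite addnC.
  have h := @g_cvg y; rewrite -(cvg_shiftn K (g ^~ y)) in h; exact: h.
have limF x : limn (F ^~ x) = (g K x - ln (v x))%:E.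
  apply/cvg_lim => //; apply: cvg_EFin; first exact: nearW.
  by apply: cvgB; [exact: cvg_cst|exact: cgK].
have mln : measurable_fun setT (fun x => ln (v x)) by exact: (measurableT_comp (@measurable_ln R)).
have intF : (\int[P]_x (g K x - ln (v x))%:E)%E = (\int[P]_x (g K x) - ln rho)%:E.
  rewrite -(eq_integral _ _ (fun x _ => limF x)) monotone_convergence//.
  apply/cvg_lim => //; apply: cvg_EFin.
    by apply: nearW => n; apply: integrable_fin_num => //;
      have := integrableB measurableT (ig K (leqnn K)) (ig (K + n)%N (leq_addr n K)).
  have -> : fine \o (fun n => \int[P]_x F n x)%E = (fun n => \int[P]_x (g K x) - 2 ^+ (K + n) * (fine (c (K + n)) - 1)).
    apply/funext => n /=; rewrite -gE ?leq_addr// -RintegralB//; [exact: ig|].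
    by apply: ig; exact: leq_addr.
  apply: cvgB; first exact: cvg_cst.
  under eq_fun do rewrite addnC.
  have h := cvc'; rewrite -(cvg_shiftn K (fun k => 2 ^+ k * (fine (c k) - 1))) in h; exact: h.
have iD : P.-integrable setT (EFin \o (fun x => g K x - ln (v x))).
  apply/integrableP; split; first by apply/measurable_EFinP; exact: measurable_funB.
  rewrite (eq_integral (fun x => (g K x - ln (v x))%:E)); first by rewrite intF ltry.
  move=> x _ /=; rewrite ger0_norm// -lee_fin -limF.
  by apply: lime_ge; [exact: ereal_nondecreasing_is_cvgn|exact: nearW].
have iln : P.-integrable setT (EFin \o (fun x => ln (v x))).
  have -> : EFin \o (fun x => ln (v x)) = ((EFin \o g K) \- (EFin \o (fun x => (g K x - ln (v x))%R)))%E.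
    by apply/funext => x /=; rewrite -EFinB; congr EFin; ring.
  by apply: integrableB => //; exact: ig.
split=> //.
have : \int[P]_x (g K x - ln (v x)) = \int[P]_x (g K x) - ln rho.
  by rewrite {1}/Rintegral intF.
rewrite RintegralB//; last exact: ig.
by move/eqP; rewrite -subr_eq0 => /eqP h; lra.
Qed.

End geometric_mean.

Lemma cvg_integral_L1 d (T : measurableType d) (R : realType) (P : probability T R)
    (Y : nat -> T -> R) (l : R) :
  (forall n, measurable_fun setT (Y n)) ->
  (\int[P]_w (`|Y n w - l|)%:E)%E @[n --> \oo] --> 0%E ->
  (\int[P]_w (Y n w)%:E)%E @[n --> \oo] --> l%:E.
Proof.
move=> mY cY.
have iN n : (\int[P]_w (`|Y n w - l|)%:E < +oo)%E -> P.-integrable setT (EFin \o (fun w => Y n w - l)).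
  move=> h; apply/integrableP; split; last exact: h.
  by apply/measurable_EFinP; apply: measurable_funB.
have il : P.-integrable setT (EFin \o (fun=> l : R)) by exact: finite_measure_integrable_cst.
have iY n : (\int[P]_w (`|Y n w - l|)%:E < +oo)%E -> P.-integrable setT (EFin \o Y n).
  move=> /iN h; have -> : EFin \o Y n = ((EFin \o (fun w => (Y n w - l)%R)) \+ (EFin \o (fun=> l)))%E.
    by apply/funext => w /=; rewrite -EFinD subrK.
  exact: integrableD.
have fin : \forall n \near \oo, (\int[P]_w (`|Y n w - l|)%:E < +oo)%E.
  have [h _] := (fine_cvgP _ _).1 cY; near=> n.
  by rewrite ltey_eq; apply/orP; left; near: n.
apply: cvg_EFin.
  by near=> n; apply: integrable_fin_num => //; apply: iY; near: n.
apply/cvgrPdist_le => e e0; near=> n.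
have fn : (\int[P]_w (`|Y n w - l|)%:E < +oo)%E by near: n.
have -> : l - (fine \o (fun n => \int[P]_w (Y n w)%:E)%E) n = - \int[P]_w (Y n w - l).
  rewrite RintegralB//; last exact: iY.
  by rewrite Rintegral_cst// [X in fine X]probability_setT mulr1 opprB.
rewrite normrN (le_trans (le_normr_Rintegral _ (iN _ fn)))//.
have : fine (\int[P]_w (`|Y n w - l|)%:E)%E <= e.
  near: n; have [_ /cvgrPdist_le h] := (fine_cvgP _ _).1 cY.
  by apply: filterS (h e e0) => n; rewrite /= sub0r normrN; apply: le_trans; exact: ler_norm.
by [].
Unshelve. all: by end_near. Qed.

Section quadratic.
Context (R : realType) (lam : R).

Definition quadratic (x : 'cV[R]_1) : R := lam / 2 * x ord0 ord0 ^+ 2.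

Let mul1mx_tr : (1%:M : 'M[R]_1) *m 1%:M^T = 1%:M.
Proof. by rewrite trmx1 mulmx1. Qed.

Let quadraticE (x : 'cV[R]_1) :
  quadratic x = \sum_(i < 1) (fun=> fun r : R => lam / 2 * r ^+ 2) i ((1%:M *m x) i ord0).
Proof. by rewrite big_ord1 mul1mx. Qed.

Lemma separable_quadratic : separable quadratic.
Proof.
exists 1%:M; split; first exact: mul1mx_tr.
by exists (fun=> fun r : R => lam / 2 * r ^+ 2) => x; exact: quadraticE.
Qed.

Lemma differentiable_quadratic x : differentiable quadratic x.
Proof.
have h : differentiable (fun x : 'cV[R]_1 => x ord0 ord0) x by exact: differentiable_coord.
apply: differentiableM; first exact: differentiable_cst.
by under eq_fun do rewrite expr2; exact: differentiableM.
Qed.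

Lemma gradient_quadratic x : gradient quadratic x ord0 ord0 = lam * x ord0 ord0.
Proof.
have := gradientE mul1mx_tr quadraticE differentiable_quadratic x ord0.
rewrite !mul1mx => ->; rewrite derive1E.
have h (r : R) : is_derive r 1 (fun r => lam / 2 * r ^+ 2) (lam * r).
  by apply: is_derive_eq; rewrite /GRing.scale/=; field.
by have := h (x ord0 ord0) => ?; rewrite derive_val.
Qed.

Lemma enorm1 (x : 'cV[R]_1) : enorm x = `|x ord0 ord0|.
Proof. by rewrite /enorm big_ord1 sqrtr_sqr. Qed.

Lemma smooth_quadratic M : 0 <= lam -> lam <= M -> smooth M quadratic.
Proof.
move=> l0 lM; split=> [|x y]; first exact: differentiable_quadratic.
rewrite !enorm1 mxE [X in _ + X]mxE !gradient_quadratic.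
have -> : (x - y) ord0 ord0 = x ord0 ord0 - y ord0 ord0 by rewrite mxE [X in _ + X]mxE.
rewrite -mulrBr normrM (ger0_norm l0).
by rewrite ler_wpM2r.
Qed.

Lemma strongly_convex_quadratic m : m <= lam -> strongly_convex m quadratic.
Proof.
move=> ml x y t t0 t1; rewrite enorm1 real_normK ?num_real// /quadratic !mxE.
set a := x _ _; set b := y _ _.
rewrite -subr_ge0.
have -> : t * (lam / 2 * a ^+ 2) + (1 - t) * (lam / 2 * b ^+ 2)
   - m / 2 * t * (1 - t) * (a - b) ^+ 2 - lam / 2 * (t * a + (1 - t) * b) ^+ 2 =
   (lam - m) / 2 * (t * (1 - t) * (a - b) ^+ 2) by field.
have q : 0 <= lam - m by rewrite subr_ge0.
have t2 : 0 <= 1 - t by rewrite subr_ge0.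
apply: mulr_ge0; first exact: divr_ge0.
by apply: mulr_ge0; [exact: mulr_ge0|exact: sqr_ge0].
Qed.

Lemma is_minimizer_quadratic : 0 <= lam -> is_minimizer quadratic 0.
Proof.
move=> l0 x; rewrite /quadratic !mxE expr0n mulr0.
by rewrite mulr_ge0 ?sqr_ge0// divr_ge0.
Qed.

End quadratic.

(** * What the rate on quadratics imposes on the law of the inverse stepsizes *)

Section necessary.
Context (R : realType) (m M : R) (m0 : 0 < m) (mM : m < M).
Context d (T : measurableType d) (P : probability T R).
Variable beta : nat -> {RV P >-> R}.
Hypothesis indep : mutually_independent beta.
Let nu := distribution P (beta 0%N).
Hypothesis idl : forall t A, measurable A -> distribution P (beta t) A = nu A.
Hypothesis ach : achieves_rate m M beta.
Local Notation rho := (accelerated_rate m M).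

Section fixed_curvature.
Variable lam : R.
Hypothesis lamI : m <= lam <= M.
Let lam0 : 0 < lam. Proof. by case/andP: lamI => + _; exact: lt_le_trans. Qed.

Local Notation step := (gd_step (fun y : R => lam * y)).
Local Notation y_ := (chain beta step 1).
Let v b := `|1 - lam * b^-1|.

Let mstep : measurable_fun setT step.
Proof. by apply: measurable_gd_step; exact: measurable_funM. Qed.

Let my n : measurable_fun setT (y_ n). Proof. exact: measurable_chain. Qed.

Let rateE n w : avg_rate (quadratic lam) 0 (const_mx 1) (fun t => beta t w) n =
  `|y_ n w| `^ n%:R^-1.
Proof.
rewrite /avg_rate !enorm1 !subr0 [in X in _ / X]mxE normr1 divr1.
congr (`|_| `^ _).
elim: n => [|n IH]; first by rewrite mxE.
by rewrite /= mxE [X in _ + X]mxE [X in _ - X]mxE gradient_quadratic IH.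
Qed.

Let quad : {ae P, forall w, (`|y_ n w| `^ n%:R^-1) @[n --> \oo] --> rho} /\
  (\int[P]_w (`| `|y_ n w| `^ n%:R^-1 - rho|)%:E)%E @[n --> \oo] --> 0%E.
Proof.
have [lm lM] := andP lamI.
have x0 : (const_mx 1 : 'cV[R]_1) != 0.
  by apply/eqP => /matrixP/(_ ord0 ord0)/eqP; rewrite !mxE oner_eq0.
have [h1 h2] := ach (leqnn 1) (separable_quadratic lam)
  (strongly_convex_quadratic lm) (smooth_quadratic (ltW lam0) lM)
  (is_minimizer_quadratic (ltW lam0)) x0.
split.
  by apply: ae_mono h1 => w; under eq_fun do rewrite rateE.
apply: cvg_trans h2.
apply: near_eq_cvg; apply: nearW => n; apply: eq_integral => w _.
by rewrite rateE.
Qed.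

(** If the first inverse stepsize equals lam, the iterate hits the minimizer at once and stays
    there, so its rate tends to 0 instead of rho > 0. Such outcomes lie in the exceptional set of
    the almost sure convergence. *)
Lemma law_set1 : nu [set lam] = 0%E.
Proof.
have [[N [mN N0 sN]] _] := quad.
apply/eqP; rewrite -measure_le0 -N0.
change (P (beta 0%N @^-1` [set lam]) <= P N)%E.
apply: le_measure; rewrite ?inE//.
move=> w /= bl; apply: sN => /= h.
have z n : y_ n.+1 w = 0.
  elim: n => [|n IH]; first by rewrite /= /gd_step/= bl mulr1 mulVf ?gt_eqF// subrr.
  by rewrite [LHS]/= -/(y_ n.+1 w) IH /gd_step/= !mulr0 subr0.
have c0 : (`|y_ n w| `^ n%:R^-1) @[n --> \oo] --> (0 : R).
  rewrite -(cvg_shiftS (fun n => `|y_ n w| `^ n%:R^-1)).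
  under eq_fun do rewrite z normr0 powR0 ?invr_eq0 ?pnatr_eq0//.
  exact: cvg_cst.
have r0 : rho = 0 by apply: (cvg_unique _ h c0).
by have := accelerated_rate_gt0 m0 mM; rewrite r0 ltxx.
Qed.

Let mv : measurable_fun setT v.
Proof.
apply: measurableT_comp => //; apply: measurable_funB => //.
by apply: measurable_funM => //; exact: measurable_invr.
Qed.

Let stepE y b : step (y, b) = y * (1 - lam * b^-1).
Proof. by rewrite /gd_step/=; ring. Qed.

Let mean_rate n : (\int[P]_w (`|y_ n w| `^ n%:R^-1)%:E)%E =
  ((\int[nu]_b (v b `^ n%:R^-1)%R%:E) ^+ n)%E.
Proof.
pose h (x : R) := (`|x| `^ n%:R^-1)%:E : \bar R.
have mp : measurable_fun setT (fun b => (v b `^ n%:R^-1)%:E).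
  by apply/measurable_EFinP; exact: (measurableT_comp (measurable_powR _) mv).
have mh : measurable_fun setT h.
  by apply/measurable_EFinP; apply: (measurableT_comp (measurable_powR _)).
have := @integral_chain_eq _ _ _ _ _ indep _ 1 mstep nu h (\int[nu]_b (v b `^ n%:R^-1)%R%:E)%E n idl mh.
rewrite /h normr1 powR1 mule1; apply.
- by move=> x; rewrite lee_fin powR_ge0.
- by apply: integral_ge0 => x _; rewrite lee_fin powR_ge0.
- move=> y; under eq_integral do rewrite stepE normrM powRM// EFinM.
  rewrite ge0_integralZl ?lee_fin ?powR_ge0//; by rewrite muleC.
Qed.

Lemma law_ln_factor :
  nu.-integrable setT (EFin \o (fun b => ln `|1 - lam * b^-1|)) /\
  \int[nu]_b (ln `|1 - lam * b^-1|) = ln rho.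
Proof.
(* The geometric mean lemma wants a positive function. Replacing 0 by 1 keeps the logarithm, as
   [ln 0 = 0 = ln 1], and alters the powers only at b = lam, a null set by [law_set1]. *)
pose v' b := if v b == 0 then 1 else v b.
have vE b : ln `|1 - lam * b^-1| = ln (v' b).
  by rewrite /v'; case: eqP => // h; rewrite -/(v b) h ln0 ?ln1.
have -> : (fun b => ln `|1 - lam * b^-1|) = (fun b => ln (v' b)) by apply/funext.
have mv' : measurable_fun setT v'.
  apply: measurable_fun_ifT => //.
  by apply: measurable_fun_eqr => //.
have v'0 b : 0 < v' b by rewrite /v'; case: eqP => // /eqP; rewrite lt0r normr_ge0 => ->.
apply: integral_ln_geometric_mean => //; first exact: accelerated_rate_gt0.
have mY n : measurable_fun setT (fun w => `|y_ n w| `^ n%:R^-1).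
  by apply: (measurableT_comp (measurable_powR _)); apply: measurableT_comp.
have := cvg_integral_L1 mY quad.2.
under eq_fun do rewrite mean_rate.
(* The subsequence n = 2^k matches the dyadic exponents that make the approximation of the logarithm
   monotone. *)
move=> h; have e2 : (fun k => (2 ^ k)%N) @ \oo --> \oo.
  move=> A [N _ NA]; exists N => // k /= Nk; apply: NA => /=.
  exact: leq_trans Nk (ltnW (ltn_expl k _)).
have := cvg_comp _ _ e2 h; rewrite /comp; apply: cvg_trans; apply: near_eq_cvg; apply: nearW => k.
suff -> : (\int[nu]_b (v b `^ (2 ^ k)%:R^-1)%R%:E = \int[nu]_b (v' b `^ (2 ^+ k)^-1)%R%:E)%E by [].
rewrite natrX; apply: ae_eq_integral => //.
- by apply/measurable_EFinP; exact: (measurableT_comp (measurable_powR _) mv).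
- by apply/measurable_EFinP; exact: (measurableT_comp (measurable_powR _) mv').
exists [set lam]; split; [by []|exact: law_set1|move=> b /=].
apply: contra_notP => bl _; rewrite /v'; case: eqP => // /normr0_eq0/eqP.
rewrite subr_eq0 => /eqP h1; exfalso; apply: bl.
have b0 : b != 0 by apply: contra_eq_neq h1 => ->; rewrite invr0 mulr0 oner_eq0.
by rewrite /= -[b]mul1r h1 divfK.
Qed.

End fixed_curvature.
End necessary.

(** * Laws with constant logarithmic potential *)

(* What the one-dimensional quadratics [lam / 2 * x ^ 2] impose on a law achieving
   the rate: one gradient step multiplies the error by [1 - lam / b]. *)
Definition equalizing_law (R : realType) (m M : R) (mu : {measure set R -> \bar R}) :=
  forall lam, m <= lam <= M ->
    mu.-integrable setT (EFin \o (fun b : R => ln `|1 - lam / b|)) /\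
    \int[mu]_b (ln `|1 - lam / b|) = ln (accelerated_rate m M).

Lemma accelerated_rateV (R : realType) (m M : R) :
  accelerated_rate M^-1 m^-1 = accelerated_rate m M.
Proof. by rewrite /accelerated_rate invrK [m^-1 * M]mulrC. Qed.

Section equalizing.
Context (R : realType) (m M : R) (m0 : 0 < m) (mM : m < M).
Variable nu : probability R R.
Hypothesis eqz : equalizing_law m M nu.
Local Notation rho := (accelerated_rate m M).
Let M0 : 0 < M. Proof. exact: lt_trans mM. Qed.

(** A majorant of ln |1 - lam / b| for all lam in [0, M] at once; it is what makes Fubini applicable
    below. *)
Let V (b : R) := ln (1 + M * `|b^-1|).

Let Vb (b : R) : 1 <= 1 + M * `|b^-1|.
Proof. by rewrite lerDl mulr_ge0// ltW. Qed.

Let V0 b : 0 <= V b. Proof. by rewrite ln_ge0. Qed.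

Let mV : measurable_fun setT V.
Proof.
apply: (measurableT_comp (@measurable_ln R)); apply: measurable_funD => //.
apply: measurable_funM => //; apply: measurableT_comp => //; exact: measurable_invr.
Qed.

Let ln_factor_le lam b : 0 <= lam <= M -> ln `|1 - lam / b| <= V b.
Proof.
move=> /andP[l0 lM]; have [h|h] := leP `|1 - lam / b| 0.
  by rewrite ln0.
rewrite ler_ln ?posrE//; last exact: lt_le_trans (Vb b).
rewrite (le_trans (ler_normB _ _))// normr1 lerD2l normrM (ger0_norm l0).
by rewrite ler_wpM2r.
Qed.

Let norm_ln_factor_le lam b : 0 <= lam <= M ->
  `|ln `|1 - lam / b| | <= 2 * V b - ln `|1 - lam / b|.
Proof.
move=> /(ln_factor_le b) h; have := V0 b.
by rewrite ler_norml; lra.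
Qed.

(** Integrability at the single curvature M controls the majorant: either M / |b| <= 2 and V b <= ln
    3, or M / |b| - 1 >= (1 + M / |b|) / 3. *)
Let V_le b : V b <= ln 3 + `|ln `|1 - M / b| |.
Proof.
have l3 : 0 <= ln (3 : R) by rewrite ln_ge0// ler1n.
have [h|h] := leP (M * `|b^-1|) 2.
  have : V b <= ln 3 by rewrite ler_ln ?posrE ?(lt_le_trans _ (Vb b))//; lra.
  by have := normr_ge0 (ln `|1 - M / b|); lra.
have h1 : M * `|b^-1| - 1 <= `|1 - M / b|.
  have := lerB_normD 1 (- (M / b)); have := lerB_dist (M / b) 1.
  by rewrite distrC normrM (gtr0_norm M0) normr1.
have : V b <= ln 3 + ln `|1 - M / b|.
  rewrite -lnM ?posrE//; last by lra.
  rewrite ler_ln ?posrE//; last 2 first.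
  - exact: lt_le_trans (Vb b).
  - by rewrite mulr_gt0//; lra.
  lra.
by have := ler_norm (ln `|1 - M / b|); lra.
Qed.

Let iV : nu.-integrable setT (EFin \o V).
Proof.
have [iM _] := eqz (introT andP (conj (ltW mM) (lexx M))).
have i3 : nu.-integrable setT (EFin \o (fun=> ln 3 : R)).
  exact: finite_measure_integrable_cst.
have := integrableD measurableT i3 (integrable_norm iM).
apply: le_integrable => //; first exact/measurable_EFinP.
move=> b _ /=; rewrite lee_fin ger0_norm//.
apply: le_trans (V_le b) _; exact: ler_norm.
Qed.

Section shift.
Variable z : R.
Hypotheses (z0 : 0 <= z) (zm : z < m).
(** Inversion swaps the ends: g runs through [mz, Mz] exactly when z + 1/g runs through [m, M]. *)
Let mz := (M - z)^-1.
Let Mz := (m - z)^-1.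
Let q1 : 0 < m - z. Proof. by rewrite subr_gt0. Qed.
Let q2 : 0 < M - z. Proof. by rewrite subr_gt0 (lt_trans zm). Qed.
Let mz0 : 0 < mz. Proof. by rewrite invr_gt0. Qed.
Let mMz : mz < Mz. Proof. by rewrite ltf_pV2 ?posrE// ltrD2r. Qed.
Local Notation c := (arc_var mz Mz).
Local Notation rhoz := (accelerated_rate mz Mz).
Local Notation th := (@theta R).
Let c0 u : 0 < c u. Proof. exact: arc_var_gt0. Qed.

Let lamI u : m <= z + (c u)^-1 <= M.
Proof.
have /andP[h1 h2] := arc_var_itv mMz u.
have h3 : (c u)^-1 <= M - z by rewrite -[M - z]invrK lef_pV2 ?posrE.
have h4 : m - z <= (c u)^-1 by rewrite -[m - z]invrK lef_pV2 ?posrE// (lt_trans mz0).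
by apply/andP; split; lra.
Qed.

Let lamI0 u : 0 <= z + (c u)^-1 <= M.
Proof. by have /andP[h ->] := lamI u; rewrite (le_trans _ h) ?ltW. Qed.

Let K (b u : R) := ln `|1 - (z + (c u)^-1) / b|.

Let mK : measurable_fun setT (fun p : R * measurableTypeR R => (K p.1 p.2)%:E).
Proof.
have mc : @measurable_fun _ _ (measurableTypeR R) R setT c by exact: measurable_arc_var.
apply/measurable_EFinP; apply: (measurableT_comp (@measurable_ln R)).
apply: measurableT_comp => //; apply: measurable_funB => //; apply: measurable_funM.
  apply: measurable_funD => //.
  apply: (measurableT_comp (@measurable_invr R)).
  by apply: (measurableT_comp mc); exact: measurable_snd.
by apply: (measurableT_comp (@measurable_invr R)); exact: measurable_fst.
Qed.

Let iK u : nu.-integrable setT (EFin \o K ^~ u). Proof. exact: (eqz (lamI u)).1. Qed.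

(** As |ln| <= 2 V - ln and the logarithm has mean ln rho at every curvature, the inner L1 norm over
    [nu] has a bound free of u. *)
Let iKprod : (nu \x th)%E.-integrable setT (fun p : R * measurableTypeR R => (K p.1 p.2)%:E).
Proof.
apply/integrable21ltyP => //.
apply: (@le_lt_trans _ _ (\int[th]_u (2 * \int[nu]_b V b - ln rho)%:E)%E); last first.
  by rewrite integral_cst// [X in (_ * X)%E]probability_setT mule1 ltry.
apply: ge0_le_integral => //.
- by move=> u _; apply: integral_ge0.
- apply: (measurable_fun_fubini_tonelli_G (fun p => `|(K p.1 p.2)%:E|%E)) => //.
  by apply: measurableT_comp.
- move=> u _ /=.
  have i2 : nu.-integrable setT (EFin \o (fun b => 2 * V b)) by have := integrableZl measurableT 2 iV.
  have iB : nu.-integrable setT (EFin \o (fun b => 2 * V b - K b u)).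
    by have := integrableB measurableT i2 (iK u).
  have -> : 2 * \int[nu]_b V b - ln rho = \int[nu]_b (2 * V b - K b u).
    by rewrite RintegralB// RintegralZl// (eqz (lamI u)).2.
  rewrite /Rintegral fineK; last exact: integrable_fin_num.
  apply: ge0_le_integral => //.
  + by apply/measurable_EFinP/measurableT_comp => //; apply/measurable_EFinP; exact: measurable_int (iK u).
  + exact: measurable_int iB.
  + by move=> b _; rewrite lee_fin norm_ln_factor_le.
Qed.

Let fub : (\int[nu]_b \int[th]_u (K b u)%:E = (ln rho)%:E)%E.
Proof.
rewrite (Fubini iKprod)/=.
transitivity (\int[th]_u (ln rho)%:E)%E.
  apply: eq_integral => u _; rewrite -(eqz (lamI u)).2 /Rintegral fineK//.
  exact: integrable_fin_num (iK u).
by rewrite integral_cst// [X in (_ * X)%E]probability_setT mule1.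
Qed.

(** The average of [K b] in closed form, after factoring the argument of the logarithm as w (g - a)
    / g with w = 1 - z / b and a = b^-1 / w. The bracket is the excess of the potential at a over
    its equilibrium value, and the capacity and ln rhoz come from the mean of ln g. *)
Let L b := ln (1 - z / b) + (\int[th]_u ln `|b^-1 / (1 - z / b) - c u| - ln ((Mz - mz) / 4)) + ln rhoz.

Let Kint b : 0 < 1 - z / b -> (\int[th]_u (K b u)%:E = (L b)%:E)%E.
Proof.
move=> w0; set w := 1 - z / b in w0; set a' := b^-1 / w.
have i1 := integrable_theta_cst (ln w).
have i2 := integrable_ln_sub_arc mMz a'.
have i3 := integrable_ln_arc mz0 mMz.
have i12 : th.-integrable setT (EFin \o (fun u => ln w + ln `|a' - c u|)).
  by have := integrableD measurableT i1 i2.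
have i123 : th.-integrable setT (EFin \o (fun u => ln w + ln `|a' - c u| - ln (c u))).
  by have := integrableB measurableT i12 i3.
have Kae : {ae th, forall u, K b u = ln w + ln `|a' - c u| - ln (c u)}.
  apply: ae_mono (theta_ae_arc_neq mMz a') => u; rewrite /K.
  move: (c u) (c0 u) => g g0 ga; have d0 : 0 < `|a' - g| by rewrite normr_gt0 subr_eq0 eq_sym.
  rewrite -lnM ?posrE// -ln_div ?posrE ?mulr_gt0//; congr ln.
  have -> : w * `|a' - g| / g = `|- (w * (a' - g) / g)|.
    by rewrite normrN normf_div normrM (gtr0_norm w0) (gtr0_norm g0).
  have wE : w = 1 - z * b^-1 by [].
  have bE : b^-1 = a' * w by rewrite /a' divfK// gt_eqF.
  congr `|_|; rewrite mulrDl opprD.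
  have -> : z * b^-1 = 1 - w by rewrite wE; ring.
  rewrite bE; field; by rewrite gt_eqF.
have mKb : measurable_fun [set: R] (K b).
  apply: (measurableT_comp (@measurable_ln R)); apply: measurableT_comp => //.
  apply: measurable_funB => //; apply: measurable_funM => //; apply: measurable_funD => //.
  by apply: (measurableT_comp (@measurable_invr R)); exact: measurable_arc_var.
have m123 : measurable_fun [set: R] (fun u => ln w + ln `|a' - c u| - ln (c u)).
  apply: measurable_funB; last first.
    by apply: (measurableT_comp (@measurable_ln R)); exact: measurable_arc_var.
  by apply: measurable_funD => //; exact: measurable_ln_sub_arc.
rewrite (_ : L b = \int[th]_u (K b u)).
  rewrite /Rintegral fineK//; apply: integrable_fin_num => //.
  apply: ae_eq_integrable i123; first exact: measurable_theta_EFin.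
  by apply: ae_mono Kae => u /= ->.
rewrite (ae_eq_Rintegral_theta mKb m123 Kae) RintegralB// RintegralD// Rintegral_theta_cst.
by rewrite Rintegral_ln_arc// /L -/w -/a'; ring.
Qed.

Let iF : nu.-integrable setT (fun b => \int[th]_u (K b u)%:E)%E.
Proof. exact: (integrable_fubini_F iKprod). Qed.

(* [z = 0]: the potential exceeds its equilibrium value outside the support. *)
Lemma equalizing_law_itv_shift0 : z = 0 -> {ae nu, forall b, M^-1 <= b^-1 <= m^-1}.
Proof.
move=> zE.
have w1 b : 1 - z / b = 1 by rewrite zE mul0r subr0.
have rE : rhoz = rho by rewrite /mz /Mz zE !subr0 accelerated_rateV.
pose D b := \int[th]_u ln `|b^-1 - c u| - ln ((Mz - mz) / 4).
have LE b : L b = D b + ln rho by rewrite /L w1 ln1 divr1 add0r rE.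
have D0 b : 0 <= D b.
  rewrite subr_ge0; have [h|h] := boolP (mz <= b^-1 <= Mz).
    by rewrite Rintegral_ln_sub_arc_in.
  by rewrite ltW// Rintegral_ln_sub_arc_out.
have KD : (fun b => \int[th]_u (K b u)%:E)%E = EFin \o (fun b => D b + ln rho).
  by apply/funext => b; rewrite Kint ?w1//= LE.
have iD : nu.-integrable setT (EFin \o D).
  have -> : EFin \o D = ((EFin \o (fun b => D b + ln rho)%R) \- (EFin \o (fun=> ln rho)))%E.
    by apply/funext => b /=; rewrite -EFinB addrK.
  apply: integrableB => //; last exact: finite_measure_integrable_cst.
  by rewrite -KD.
have int0 : (\int[nu]_b (D b)%:E = 0)%E.
  have := fub; rewrite (_ : (fun b => _) = EFin \o (fun b => D b + ln rho)) ?KD//.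
  under eq_integral do rewrite EFinD.
  rewrite integralD//; last exact: finite_measure_integrable_cst.
  rewrite integral_cst// [X in (_ * X)%E]probability_setT mule1 => /eqP.
  have := integrable_fin_num measurableT iD; case: (integral _ _ _) => // r _.
  by rewrite -EFinD eqe => /eqP h; congr EFin; lra.
have : ae_eq nu setT (EFin \o D) (cst 0%E).
  apply/ae_eq_integral_abs => //; first exact: measurable_int iD.
  by rewrite -int0; apply: eq_integral => b _ /=; rewrite ger0_norm.
apply: ae_mono => b /(_ I) /= [] Db.
have -> : M^-1 = mz by rewrite /mz zE subr0.
have -> : m^-1 = Mz by rewrite /Mz zE subr0.
apply: contraT => h; have := Rintegral_ln_sub_arc_out mMz h.
by move: Db; rewrite /D => /eqP; rewrite subr_eq0 => /eqP ->; rewrite ltxx.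
Qed.

(** For b in [m, M] the point 1 / (b - z) lies in [mz, Mz], where the excess in [L] vanishes; only
    ln (1 - z / b) + ln rhoz is left to average. The value depends on m, M and z, not on the law. *)
Lemma equalizing_law_ln_sub : {ae nu, forall b, M^-1 <= b^-1 <= m^-1} ->
  \int[nu]_b (ln (1 - z * b^-1)) = ln rho - ln rhoz.
Proof.
move=> bI.
have Kae : {ae nu, forall b, (\int[th]_u (K b u)%:E = (ln (1 - z * b^-1) + ln rhoz)%:E)%E}.
  apply: ae_mono bI => b /andP[b1 b2].
  have w0 : 0 < 1 - z / b.
    by rewrite subr_gt0 (le_lt_trans (ler_wpM2l z0 b2))// ltr_pdivrMr ?mul1r.
  rewrite Kint// /L Rintegral_ln_sub_arc_in//; first by rewrite subrr addr0.
  rewrite /mz /Mz ler_pdivlMr// ler_pdivrMr//; apply/andP; split.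
    rewrite mulrC ler_pdivrMr//.
    have : 1 <= M * b^-1 by rewrite -(mulfV (lt0r_neq0 M0)) ler_pM2l.
    by nra.
  rewrite mulrC ler_pdivlMr//.
  have : m * b^-1 <= 1 by rewrite -ler_pdivlMl// mulr1.
  by nra.
have mln : measurable_fun setT (fun b : R => ln (1 - z * b^-1)).
  apply: (measurableT_comp (@measurable_ln R)); apply: measurable_funB => //.
  by apply: measurable_funM => //; exact: measurable_invr.
have i1 : nu.-integrable setT (EFin \o (fun b => ln (1 - z * b^-1) + ln rhoz)).
  apply: ae_eq_integrable iF => //.
  by apply/measurable_EFinP; exact: measurable_funD.
have i2 : nu.-integrable setT (EFin \o (fun b => ln (1 - z * b^-1))).
  have -> : EFin \o (fun b => ln (1 - z * b^-1)) =
    ((EFin \o (fun b => ln (1 - z * b^-1) + ln rhoz)%R) \- (EFin \o (fun=> ln rhoz)))%E.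
    by apply/funext => b /=; rewrite -EFinB addrK.
  by apply: integrableB => //; exact: finite_measure_integrable_cst.
have : \int[nu]_b (ln (1 - z * b^-1) + ln rhoz) = ln rho.
  rewrite /Rintegral -[RHS]/(fine (ln rho)%:E) -fub; congr fine.
  apply: ae_eq_integral => //.
  - exact: measurable_int i1.
  - exact: measurable_int iF.
  - by apply: ae_mono Kae => b -> _.
rewrite RintegralD//; last exact: finite_measure_integrable_cst.
rewrite Rintegral_cst// [X in fine X]probability_setT mulr1; lra.
Qed.

End shift.

Lemma equalizing_law_itv : {ae nu, forall b, M^-1 <= b^-1 <= m^-1}.
Proof. exact: (@equalizing_law_itv_shift0 0 m0 erefl). Qed.

End equalizing.

(** * Determination by moments *)

(** The Taylor remainder of - ln (1 - x) at order k, whose derivative is x^k / (1 - x). *)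
Definition ln1B_remainder (R : realType) (k : nat) (x : R) :=
  - ln (1 - x) - \sum_(j < k) j.+1%:R^-1 * x ^+ j.+1.

Lemma is_derive_ln1B_remainder (R : realType) (k : nat) (x : R) : x < 1 ->
  is_derive x 1 (ln1B_remainder k) (x ^+ k / (1 - x)).
Proof.
move=> x1; have y1' : 1 - x != 0 by rewrite gt_eqF// subr_gt0.
have dp n : is_derive x 1 (fun y : R => n.+1%:R^-1 * y ^+ n.+1) (x ^+ n).
  have dX : is_derive x 1 (fun y : R => y ^+ n.+1) (n.+1%:R * x ^+ n).
    have := @is_deriveX _ _ id n.+1 x 1 1 (is_derive_id _ _).
    have -> : id ^+ n.+1 = (fun y : R => y ^+ n.+1) :> (R -> R) by apply/funext => y; rewrite exprfctE.
    by rewrite /GRing.scale/= mulr1.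
  have := @is_deriveZ _ _ _ _ n.+1%:R^-1 _ _ _ dX.
  by rewrite /GRing.scale/= mulrA mulVf ?mul1r.
rewrite /ln1B_remainder; elim: k => [|k IH].
  under eq_fun do rewrite big_ord0 subr0.
  have dln : is_derive (1 - x) 1 (@ln R) (1 - x)^-1 by apply: is_derive1_ln; rewrite subr_gt0.
  have dB : is_derive x 1 (fun y : R => 1 - y) (-1).
    by apply: is_derive_eq; ring.
  have dl : is_derive x 1 (fun y => ln (1 - y)) ((1 - x)^-1 * -1).
    exact: (@is_derive1_comp _ (@ln R) (fun y => 1 - y) x).
  by apply: is_derive_eq; rewrite expr0; field.
under eq_fun do rewrite big_ord_recr/= opprD addrA.
have := dp k => ?; apply: is_derive_eq; rewrite exprS; by field.
Qed.

(** The mean value theorem from 0, where the remainder vanishes; the factor 2 bounds 1 / (1 - c) for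
    c <= 1/2. *)
Lemma ln1B_remainder_le (R : realType) (k : nat) (x : R) : 0 <= x <= 2^-1 ->
  `|ln1B_remainder k x| <= 2 * x ^+ k.+1.
Proof.
move=> /andP[x0 x2].
have d y : y <= x -> is_derive y 1 (@ln1B_remainder R k) (y ^+ k / (1 - y)).
  by move=> yx; apply: is_derive_ln1B_remainder; lra.
have [y||c] := @MVT_segment R (ln1B_remainder k) (fun y => y ^+ k / (1 - y)) 0 x x0.
- by rewrite in_itv/= => /andP[_ /ltW]; exact: d.
- apply: derivable_within_continuous => y; rewrite in_itv/= => /andP[_ yx].
  by have := d y yx => ?; exact: ex_derive.
rewrite in_itv/= => /andP[c0 cx].
have -> : ln1B_remainder k 0 = 0 :> R.
  rewrite /ln1B_remainder subr0 ln1 oppr0 big1 ?subrr// => j _.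
  by rewrite expr0n mulr0.
rewrite !subr0 => ->.
have w0 : 0 < 1 - c by lra.
rewrite ger0_norm; last by rewrite mulr_ge0// divr_ge0 ?exprn_ge0// ltW.
rewrite exprSr mulrA ler_wpM2r// ler_pdivrMr//.
have h : c ^+ k <= x ^+ k by rewrite lerXn2r ?nnegrE.
have := exprn_ge0 k x0; nra.
Qed.

Section moments.
Context d (T : measurableType d) (R : realType).

Lemma bounded_integrable (P : probability T R) (f : T -> R) (C : R) :
  measurable_fun setT f -> (forall x, `|f x| <= C) ->
  P.-integrable setT (EFin \o f).
Proof.
move=> mf fC.
have iC : P.-integrable setT (EFin \o (fun=> C)) by exact: finite_measure_integrable_cst.
apply: (le_integrable measurableT _ _ iC).
  exact/measurable_EFinP.
by move=> x _ /=; rewrite lee_fin (le_trans (fC x))// ler_norm.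
Qed.

Lemma Rintegral_probability_cst (P : probability T R) (c : R) : \int[P]_x c = c.
Proof. by rewrite Rintegral_cst// [X in fine X]probability_setT mulr1. Qed.

Variables (P Q : probability T R) (X : T -> R).
Hypothesis mX : measurable_fun setT X.
Hypothesis X01 : forall x, 0 <= X x <= 1.

Let X0 x : 0 <= X x. Proof. by case/andP: (X01 x). Qed.
Let X1 x : X x <= 1. Proof. by case/andP: (X01 x). Qed.

Let iX (P' : probability T R) k : P'.-integrable setT (EFin \o (fun x => X x ^+ k)).
Proof.
apply: (@bounded_integrable _ _ 1); first exact: measurable_funX.
by move=> x; rewrite normrX exprn_ile1// ger0_norm.
Qed.

Let iS (P' : probability T R) n (c : nat -> R) :
  P'.-integrable setT (EFin \o (fun x => \sum_(j < n) c j * X x ^+ j)).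
Proof.
elim: n => [|n IH].
  under eq_fun do rewrite big_ord0; exact: finite_measure_integrable_cst.
have i1 := integrableZl measurableT (c n) (iX P' n).
have := integrableD measurableT IH i1; congr integrable.
by apply/funext => x /=; rewrite big_ord_recr.
Qed.

Let eq_sum n (c : nat -> R) : (forall k, (k < n)%N -> \int[P]_x (X x ^+ k) = \int[Q]_x (X x ^+ k)) ->
  \int[P]_x (\sum_(j < n) c j * X x ^+ j) = \int[Q]_x (\sum_(j < n) c j * X x ^+ j).
Proof.
elim: n => [|n IH] eqm.
  under eq_Rintegral do rewrite big_ord0.
  by under [RHS]eq_Rintegral do rewrite big_ord0; rewrite !Rintegral_probability_cst.
have E (P' : probability T R) : \int[P']_x (\sum_(j < n.+1) c j * X x ^+ j) =
    \int[P']_x (\sum_(j < n) c j * X x ^+ j) + c n * \int[P']_x (X x ^+ n).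
  under eq_Rintegral do rewrite big_ord_recr/=.
  rewrite RintegralD//; [|exact: iS|by have := integrableZl measurableT (c n) (iX P' n)].
  by rewrite (RintegralZl (c n) measurableT (iX P' n)).
rewrite !E eqm// IH// => k kn; apply: eqm; exact: ltnW.
Qed.

Hypothesis eq_ln : forall s, 0 < s < 1 ->
  \int[P]_x (ln (1 - s * X x)) = \int[Q]_x (ln (1 - s * X x)).

(** Strong induction. Expanding ln (1 - s X) to order k + 1, the lower moments cancel, and the
    difference of the next ones, times s^(k+1) / (k+1), is at most the two remainders, 4 s^(k+2).
    Divide and let s tend to 0. *)
Lemma eq_moments k : \int[P]_x (X x ^+ k) = \int[Q]_x (X x ^+ k).
Proof.
elim/ltn_ind: k => -[_|k IH].
  under eq_Rintegral do rewrite expr0.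
  by under [RHS]eq_Rintegral do rewrite expr0; rewrite !Rintegral_probability_cst.
set D := (X in X = _); set E := RHS.
(* The coefficients indexed by degree, with constant term 0, so that [eq_sum] cancels the degrees up
   to k. *)
pose lc s j := if j is j'.+1 then j'.+1%:R^-1 * s ^+ j'.+1 else 0 : R.
have lcE s x : \sum_(j < k.+1) j.+1%:R^-1 * (s * X x) ^+ j.+1 =
    \sum_(j < k.+1) lc s j * X x ^+ j + k.+1%:R^-1 * s ^+ k.+1 * X x ^+ k.+1.
  rewrite big_ord_recr/= exprMn mulrA; congr (_ + _).
  rewrite big_ord_recl/= mul0r add0r; apply: eq_bigr => j _.
  by rewrite exprMn mulrA.
have bnd s : 0 < s <= 2^-1 -> `|D - E| <= 4 * k.+1%:R * s.
  move=> /andP[s0 s2].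
  have sX x : 0 <= s * X x <= 2^-1.
    by rewrite mulr_ge0 ?(ltW s0)//= (le_trans _ s2)// ler_piMr// ltW.
  pose r x := ln1B_remainder k.+1 (s * X x).
  have rle x : `|r x| <= 2 * s ^+ k.+2.
    apply: le_trans (ln1B_remainder_le k.+1 (sX x)) _.
    by rewrite ler_wpM2l// lerXn2r ?nnegrE ?(ltW s0)//; [case/andP: (sX x)|rewrite ler_piMr// ltW].
  have rE x : r x = - ln (1 - s * X x) - (\sum_(j < k.+1) lc s j * X x ^+ j + k.+1%:R^-1 * s ^+ k.+1 * X x ^+ k.+1).
    by rewrite /r /ln1B_remainder lcE.
  have mln : measurable_fun setT (fun x => ln (1 - s * X x)).
    apply: (measurableT_comp (@measurable_ln R)); apply: measurable_funB => //.
    exact: measurable_funM.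
  have iln (P' : probability T R) : P'.-integrable setT (EFin \o (fun x => ln (1 - s * X x))).
    apply: (@bounded_integrable _ _ (ln 2)) => // x; have /andP[h1 h2] := sX x.
    rewrite ler_norml; apply/andP; split; last first.
      by rewrite ler_ln ?posrE//; lra.
    by rewrite -lnV ?posrE// ler_ln ?posrE//; lra.
  have iB (P' : probability T R) := iS P' k.+1 (lc s).
  have iC (P' : probability T R) : P'.-integrable setT (EFin \o (fun x => k.+1%:R^-1 * s ^+ k.+1 * X x ^+ k.+1)).
    by have := integrableZl measurableT (k.+1%:R^-1 * s ^+ k.+1) (iX P' k.+1).
  have iN (P' : probability T R) : P'.-integrable setT (EFin \o (fun x => - ln (1 - s * X x))).
    by have := integrableZl measurableT (-1) (iln P'); congr integrable; apply/funext => x /=; rewrite mulN1e.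
  have mr : measurable_fun setT r.
    have -> : r = (fun x => - ln (1 - s * X x) - (\sum_(j < k.+1) lc s j * X x ^+ j + k.+1%:R^-1 * s ^+ k.+1 * X x ^+ k.+1)).
      by apply/funext => x; exact: rE.
    apply: measurable_funB; first exact: measurableT_comp.
    apply: measurable_funD; first by apply/measurable_EFinP; exact: measurable_int (iB P).
    by apply/measurable_EFinP; exact: measurable_int (iC P).
  have ir (P' : probability T R) := bounded_integrable P' mr rle.
  have rI (P' : probability T R) : `|\int[P']_x (r x)| <= 2 * s ^+ k.+2.
    apply: le_trans (le_normr_Rintegral measurableT (ir P')) _.
    rewrite -[leRHS](Rintegral_probability_cst P').
    apply: le_Rintegral => //; first exact: integrable_norm (ir P').
    exact: finite_measure_integrable_cst.
  have rIE (P' : probability T R) : \int[P']_x (r x) = - (\int[P']_x (ln (1 - s * X x))) -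
     (\int[P']_x (\sum_(j < k.+1) lc s j * X x ^+ j) + k.+1%:R^-1 * s ^+ k.+1 * \int[P']_x (X x ^+ k.+1)).
    under eq_Rintegral do rewrite rE.
    rewrite RintegralB//; [|exact: iN|by have := integrableD measurableT (iB P') (iC P')].
    have EC : \int[P']_x (k.+1%:R^-1 * s ^+ k.+1 * X x ^+ k.+1) = k.+1%:R^-1 * s ^+ k.+1 * \int[P']_x (X x ^+ k.+1).
      exact: (RintegralZl _ measurableT (iX P' k.+1)).
    have ED : \int[P']_x (\sum_(j < k.+1) lc s j * X x ^+ j + k.+1%:R^-1 * s ^+ k.+1 * X x ^+ k.+1) =
        \int[P']_x (\sum_(j < k.+1) lc s j * X x ^+ j) + \int[P']_x (k.+1%:R^-1 * s ^+ k.+1 * X x ^+ k.+1).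
      exact: (RintegralD measurableT (iB P') (iC P')).
    rewrite ED EC; congr (_ - _).
    by under eq_Rintegral do rewrite -mulN1r; rewrite (RintegralZl _ measurableT (iln P')) mulN1r.
  have := rI P; have := rI Q; rewrite !rIE -/D -/E eq_ln ?s0//=; last by lra.
  rewrite (@eq_sum k.+1 (lc s)) => [|j jk]; last exact: IH.
  set A := \int[Q]_x ln _; set B := \int[Q]_x _.
  set q := k.+1%:R^-1 * s ^+ k.+1 => h1 h2.
  have qp : 0 < q by rewrite mulr_gt0 ?exprn_gt0// invr_gt0.
  have : `|q * (D - E)| <= 4 * s ^+ k.+2.
    move: h1 h2; rewrite !ler_norml => /andP[h1 h2] /andP[h3 h4].
    by apply/andP; split; lra.
  rewrite normrM gtr0_norm// mulrC -ler_pdivlMr// => h; apply: le_trans h _.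
  rewrite /q exprS le_eqVlt; apply/orP; left; apply/eqP; field.
  by rewrite expf_neq0 ?gt_eqF.
apply/eqP; rewrite -subr_eq0 -normr_le0; apply/ler_addgt0Pr => e e0; rewrite add0r.
have k4 : 0 < 4 * k.+1%:R :> R by rewrite mulr_gt0.
pose s := Num.min 2^-1 (e / (4 * k.+1%:R)).
have s0 : 0 < s by rewrite lt_min invr_gt0 ltr0n divr_gt0.
apply: le_trans (bnd s _) _; first by rewrite s0 ge_min lexx.
by rewrite mulrC -ler_pdivlMr// ge_min lexx orbT.
Qed.

Lemma eq_horner_moments (p : {poly R}) : \int[P]_x p.[X x] = \int[Q]_x p.[X x].
Proof.
under eq_Rintegral do rewrite horner_coef.
under [RHS]eq_Rintegral do rewrite horner_coef.
by apply: (@eq_sum _ (fun i => p`_i)) => k _; exact: eq_moments.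
Qed.

End moments.

Lemma bernoulli_ineq (R : realDomainType) (a : R) n : -1 <= a ->
  1 + n%:R * a <= (1 + a) ^+ n.
Proof.
move=> a1; elim: n => [|n IH]; first by rewrite mul0r addr0.
have a0 : 0 <= 1 + a by lra.
rewrite exprS; apply: le_trans (ler_wpM2l a0 IH).
have := sqr_ge0 a; have := ler0n R n; rewrite -natr1; nra.
Qed.

(* A polynomial approximation of the step function jumping from 1 to 0 at [2^-1]. *)
Definition step_fun (R : realType) (n : nat) (t : R) := (1 - t ^+ n) ^+ (2 ^ n).

Section step.
Context (R : realType) (t : R).
Hypothesis t01 : 0 < t <= 1.

Let tn n : 0 <= t ^+ n <= 1.
Proof. by case/andP: t01 => t0 t1; rewrite exprn_ge0 ?exprn_ile1// ltW. Qed.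

Lemma step_fun_itv n : 0 <= step_fun n t <= 1.
Proof.
have /andP[a0 a1] := tn n.
by rewrite exprn_ge0 ?exprn_ile1//; lra.
Qed.

(** By Bernoulli, (1 - t^n)^(2^n) >= 1 - (2 t)^n: the outer exponent 2^n is what places the jump at
    1/2. *)
Lemma cvg_step_fun_lt : t < 2^-1 -> step_fun n t @[n --> \oo] --> (1 : R).
Proof.
move=> t2; case/andP: (t01) => t0 _.
have c0 : 1 - (2 * t) ^+ n @[n --> \oo] --> (1 : R).
  rewrite -[X in _ --> X]subr0; apply: cvgB; first exact: cvg_cst.
  have := @cvg_geometric R 1 (2 * t); rewrite /geometric/=.
  under eq_fun do rewrite mul1r; apply.
  by rewrite ger0_norm; lra.
apply: (squeeze_cvgr _ c0 (cvg_cst _)); near=> n.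
have /andP[_ ->] := step_fun_itv n; rewrite andbT /step_fun.
have := @bernoulli_ineq R (- t ^+ n) (2 ^ n).
rewrite natrX mulrN -exprMn; apply.
by have /andP[_ ?] := tn n; lra.
Unshelve. all: by end_near. Qed.

(** As (1 - t^n) (1 + t^n) <= 1, the value is at most 1 / (1 + t^n)^(2^n), which Bernoulli bounds by
    (2 t)^-n. *)
Lemma cvg_step_fun_gt : 2^-1 < t -> step_fun n t @[n --> \oo] --> (0 : R).
Proof.
move=> t2; case/andP: (t01) => t0 _.
have c0 : (2 * t)^-1 ^+ n @[n --> \oo] --> (0 : R).
  have := @cvg_geometric R 1 (2 * t)^-1; rewrite /geometric/=.
  under eq_fun do rewrite mul1r; apply.
  by rewrite ger0_norm ?invr_ge0 ?invf_lt1; lra.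
apply: (squeeze_cvgr _ (cvg_cst _) c0); near=> n.
have /andP[-> _] := step_fun_itv n; rewrite /= /step_fun.
have /andP[a0 a1] := tn n.
have h : 1 + (2 * t) ^+ n <= (1 + t ^+ n) ^+ (2 ^ n).
  by rewrite exprMn -natrX; apply: bernoulli_ineq; lra.
have p : 0 < (2 * t) ^+ n by rewrite exprn_gt0//; lra.
rewrite exprVn -div1r ler_pdivlMr//.
have s0 : 0 <= (1 - t ^+ n) ^+ (2 ^ n) by rewrite exprn_ge0//; lra.
apply: (@le_trans _ _ ((1 - t ^+ n) ^+ (2 ^ n) * (1 + t ^+ n) ^+ (2 ^ n))).
  by rewrite ler_wpM2l//; lra.
by rewrite -exprMn exprn_ile1//; nra.
Unshelve. all: by end_near. Qed.

End step.

Section distribution_function.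
Context d (T : measurableType d) (R : realType).
Variables (P Q : probability T R) (X : T -> R).
Hypothesis mX : measurable_fun setT X.
Hypothesis X01 : forall w, 0 <= X w <= 1.
Hypothesis eqXp : forall p : {poly R}, \int[P]_w p.[X w] = \int[Q]_w p.[X w].

(** Composed with [t], [step_fun n] is a polynomial in X, so its integrals under P and Q agree; by
    dominated convergence they tend to the masses of X <= x. The limit is not identified where X =
    x, which is why both laws must give that level no mass. *)
Lemma eq_measure_le (x : R) : 0 <= x ->
  P (X @^-1` [set x]) = 0%E -> Q (X @^-1` [set x]) = 0%E ->
  P [set w | X w <= x] = Q [set w | X w <= x].
Proof.
move=> x0 Px Qx.
(* This affine map sends the level x to the threshold 1/2; adding 1 keeps t positive, and t <= 1
   because x >= 0 and X <= 1. *)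
pose t w := (X w + 1) / (2 * (x + 1)).
have s0 : 0 < 2 * (x + 1) by lra.
have t01 w : 0 < t w <= 1.
  have /andP[h0 h1] := X01 w.
  by rewrite divr_gt0 ?ler_pdivrMr//=; lra.
pose p n : {poly R} := (1 - ((2 * (x + 1))^-1 *: ('X + 1)) ^+ n) ^+ (2 ^ n).
have pE n w : (p n).[X w] = step_fun n (t w).
  by rewrite /p /step_fun /t !hornerE [_^-1 * _]mulrC.
have mS n : measurable_fun setT (fun w => step_fun n (t w)).
  apply: measurable_funX; apply: measurable_funB => //; apply: measurable_funX.
  by apply: measurable_funM => //; exact: measurable_funD.
have mA : measurable [set w | X w <= x].
  have := @measurable_fun_ler _ _ _ setT X (cst x) mX (measurable_cst _).
  by move=> /(_ measurableT [set true] I); rewrite setTI; congr measurable; apply/seteqP; split => w.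
have lim (P' : probability T R) : P' (X @^-1` [set x]) = 0%E ->
    (\int[P']_w (step_fun n (t w))%:E)%E @[n --> \oo] --> P' [set w | X w <= x].
  move=> P0.
  have mx : measurable (X @^-1` [set x]) by rewrite -[X in measurable X]setTI; exact: mX.
  have i1 : P'.-integrable setT (EFin \o (fun=> 1 : R)) by exact: finite_measure_integrable_cst.
  have [] := @dominated_convergence _ T R P' setT measurableT
    (fun n w => (step_fun n (t w))%:E) (fun w => (\1_[set w | X w <= x] w)%:E) (EFin \o (fun=> 1 : R)).
  - by move=> n; exact/measurable_EFinP.
  - by apply/measurable_EFinP; exact: measurable_indic.
  - exists (X @^-1` [set x]); split => // w /=; apply: contra_notP => /eqP Xx _.
    apply: cvg_EFin; first exact: nearW.
    rewrite indicE; have [h|h] : X w < x \/ x < X w.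
      by apply/orP; rewrite -neq_lt.
     
      rewrite mem_set/=; last exact: ltW.
      by apply: cvg_step_fun_lt => //; rewrite ltr_pdivrMr//; lra.
    rewrite memNset/=; last by apply/negP; rewrite -ltNge.
    by apply: cvg_step_fun_gt => //; rewrite ltr_pdivlMr//; lra.
  - exact: i1.
  - apply: aeW => w n _ /=; have /andP[h0 h1] := step_fun_itv (t01 w) n.
    by rewrite lee_fin ger0_norm.
  - by move=> _ _; rewrite integral_indic// setIT.
have e n : (\int[P]_w (step_fun n (t w))%:E = \int[Q]_w (step_fun n (t w))%:E)%E.
  have i (P' : probability T R) : (\int[P']_w (step_fun n (t w))%:E = (\int[P']_w (p n).[X w])%:E)%E.
    under [in RHS]eq_Rintegral do rewrite pE.
    rewrite /Rintegral fineK//; apply: integrable_fin_num => //.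
    apply: (@bounded_integrable _ _ _ _ _ 1) => // w.
    by have /andP[h0 h1] := step_fun_itv (t01 w) n; rewrite ger0_norm.
  by rewrite !i eqXp.
have := lim P Px; under eq_fun do rewrite e.
by move=> h; apply: (cvg_unique _ h (lim Q Qx)).
Qed.

End distribution_function.

(** For X = m / b, [equalizing_law_ln_sub] at z = s m gives both laws the same mean of ln (1 - s X),
    hence the same moments of X and the same distribution function, X being monotone in b on
    [m, M]. *)
Lemma equalizing_law_unique (R : realType) (m M : R) (P Q : probability R R) :
  0 < m -> m < M ->
  equalizing_law m M P -> equalizing_law m M Q ->
  (forall x, m <= x <= M -> P [set x] = 0%E) ->
  (forall x, m <= x <= M -> Q [set x] = 0%E) ->
  forall A, measurable A -> P A = Q A.
Proof.
move=> m0 mM eqzP eqzQ P0 Q0.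
have M0 : 0 < M by exact: lt_trans mM.
have itvE b : (M^-1 <= b^-1 <= m^-1) = (m <= b <= M).
  have [b0|b0] := leP b 0.
    have -> : (M^-1 <= b^-1) = false.
      by apply/negbTE; rewrite -ltNge (@le_lt_trans _ _ 0) ?invr_le0 ?invr_gt0.
    by rewrite [m <= b]leNgt (le_lt_trans b0 m0).
  by rewrite !lef_pV2 ?posrE// andbC.
have supp (P' : probability R R) : equalizing_law m M P' ->
    {ae P', forall b, m <= b <= M}.
  move=> eqz; have h := equalizing_law_itv m0 mM eqz.
  apply: ae_mono h => b.
  by rewrite itvE.
(* The value off [m, M], a null set, only serves to keep X in [0, 1] everywhere. *)
pose X b := if m <= b <= M then m / b else 1.
have mI : measurable_fun setT (fun b : R => m <= b <= M).
  by apply: measurable_and; apply: measurable_fun_ler.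
have mX : measurable_fun setT X.
  apply: measurable_fun_ifT => //; apply: measurable_funM => //.
  exact: measurable_invr.
have X01 b : 0 <= X b <= 1.
  rewrite /X; case: ifP => [/andP[b1 b2]|_]; last by rewrite ler01 lexx.
  have b0 : 0 < b by exact: lt_le_trans b1.
  by rewrite divr_ge0 ?(ltW m0) ?(ltW b0)// ler_pdivrMr// mul1r.
have eqX (p : {poly R}) : \int[P]_b p.[X b] = \int[Q]_b p.[X b].
  apply: eq_horner_moments => // s /andP[s0 s1].
  have E (P' : probability R R) : equalizing_law m M P' ->
      \int[P']_b (ln (1 - s * X b)) = \int[P']_b (ln (1 - s * m * b^-1)).
    move=> eqz; rewrite /Rintegral; congr fine; apply: ae_eq_integral => //.
    - apply/measurable_EFinP; apply: (measurableT_comp (@measurable_ln R)).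
      by apply: measurable_funB => //; exact: measurable_funM.
    - apply/measurable_EFinP; apply: (measurableT_comp (@measurable_ln R)).
      apply: measurable_funB => //; apply: measurable_funM => //; exact: measurable_invr.
    - by apply: ae_mono (supp _ eqz) => b bI _; rewrite /X bI mulrA.
  have z0 : 0 <= s * m by rewrite mulr_ge0 ?ltW.
  have zm : s * m < m by rewrite gtr_pMl.
  have S (P' : probability R R) : equalizing_law m M P' -> {ae P', forall b, M^-1 <= b^-1 <= m^-1}.
    by move=> /supp; apply: ae_mono => b; rewrite itvE.
  by rewrite !E// !(equalizing_law_ln_sub m0 mM _ z0 zm)//; exact: S.
apply: eq_measure_ray => x; last first.
  by rewrite (le_lt_trans (probability_le1 _ _))// ltry.
pose N := ~` [set b : R | m <= b <= M].
have mN : measurable N by apply: measurableC; rewrite -set_itvcc; exact: measurable_itv.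
have N0 (P' : probability R R) : equalizing_law m M P' -> P' N = 0%E.
  by move=> /supp h; apply/negligibleP.
have leN (P' : probability R R) A B : equalizing_law m M P' -> measurable A -> measurable B ->
    (forall b, m <= b <= M -> A b -> B b) -> (P' A <= P' B)%E.
  move=> eqz mA mB AB; rewrite -[leRHS]adde0 -(N0 _ eqz).
  apply: le_trans (measureU2 _ mB mN); apply: le_measure; rewrite ?inE//.
    exact: measurableU.
  move=> b Ab; have [bI|bI] := boolP (m <= b <= M); first by left; exact: AB.
  by right; exact/negP.
have mx : measurable (`]-oo, x[%classic : set R) by exact: measurable_itv.
have [xm|mx'] := leP x m.
  have Z (P' : probability R R) : equalizing_law m M P' -> P' `]-oo, x[%classic = 0%E.
    move=> eqz; apply/eqP; rewrite -measure_le0 -(measure0 P'); apply: leN => // b /andP[mb _].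
    by rewrite /= in_itv/= => bx; have := lt_le_trans bx (le_trans xm mb); rewrite ltxx.
  exact: etrans (Z _ eqzP) (esym (Z _ eqzQ)).
have [xM|Mx] := leP x M; last first.
  have Z (P' : probability R R) : equalizing_law m M P' -> P' `]-oo, x[%classic = 1%E.
    move=> eqz; apply/eqP; rewrite eq_le probability_le1//= -(probability_setT P').
    by apply: leN => // b /andP[_ bM] _; rewrite /= in_itv/=; exact: le_lt_trans Mx.
  exact: etrans (Z _ eqzP) (esym (Z _ eqzQ)).
have x0 : 0 < x by exact: lt_trans mx'.
(* Inversion reverses the order, so up to a null set [E] is the half-line x <= b, the complement of
   the ray. *)
pose E := [set b | X b <= m / x].
have mE : measurable E.
  have := @measurable_fun_ler _ _ _ setT X (cst (m / x)) mX (measurable_cst _).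
  by move=> /(_ measurableT [set true] I); rewrite setTI; congr measurable; apply/seteqP; split => w.
have XE b : m <= b <= M -> (X b <= m / x) = (x <= b).
  move=> bI; have b0 : 0 < b by case/andP: bI => + _; exact: lt_le_trans.
  by rewrite /X bI ler_pM2l// lef_pV2.
have mat : measurable (X @^-1` [set m / x]) by rewrite -[X in measurable X]setTI; exact: mX.
have at0 (P' : probability R R) : equalizing_law m M P' -> P' [set x] = 0%E ->
    P' (X @^-1` [set m / x]) = 0%E.
  move=> eqz <-; apply/eqP; rewrite eq_le; apply/andP; split; apply: leN => // b bI /=.
    rewrite /X bI => /(mulfI (lt0r_neq0 m0)); exact: invr_inj.
  by move=> ->; rewrite /X (ltW mx') xM.
have xI : m <= x <= M by rewrite ltW.
have EE := eq_measure_le mX X01 eqX (divr_ge0 (ltW m0) (ltW x0)) (at0 _ eqzP (P0 _ xI)) (at0 _ eqzQ (Q0 _ xI)).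
have Z (P' : probability R R) : equalizing_law m M P' -> P' `]-oo, x[%classic = (1 - P' E)%E.
  move=> eqz; rewrite -probability_setC//; apply/eqP; rewrite eq_le.
  have mCE : measurable (~` E) by exact: measurableC.
  apply/andP; split; apply: leN => // b bI; rewrite /E /= in_itv/= XE//.
    by move=> bx; apply/negP; rewrite -ltNge.
  by move=> /negP; rewrite -ltNge.
have ZP := Z _ eqzP; rewrite EE in ZP; exact: etrans ZP (esym (Z _ eqzQ)).
Qed.

Section arcsine_equalizing.
Context (R : realType) (m M : R) (m0 : 0 < m) (mM : m < M).

Lemma distribution_arc_rv (A : set R) : measurable A ->
  distribution theta (arc_rv m M) A = arcsine_prob m M A.
Proof. by move=> mA; rewrite arcsine_probE. Qed.

Lemma equalizing_arcsine : equalizing_law m M (distribution theta (arc_rv m M)).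
Proof.
move=> lam lamI.
have mln : measurable_fun setT (EFin \o (fun b : R => ln `|1 - lam / b|)).
  apply/measurable_EFinP; apply: (measurableT_comp (@measurable_ln R)).
  apply: measurableT_comp => //; apply: measurable_funB => //.
  by apply: measurable_funM => //; exact: measurable_invr.
have i := integrable_ln_factor m0 mM lam.
split; first exact: (integrable_arcsine mM distribution_arc_rv mln).
rewrite -(Rintegral_ln_factor m0 mM lamI) /Rintegral; congr fine.
exact: (integral_arcsine mM distribution_arc_rv mln).
Qed.

End arcsine_equalizing.

Theorem theorem1p2 (R : realType) (m M : R) (hm : 0 < m) (hmM : m < M) :
  (forall (dT : measure_display) (T : measurableType dT)
      (P : probability T R) (beta : nat -> {RV P >-> R}),
    iid_with_law beta (arcsine_prob m M) -> achieves_rate m M beta)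
  /\
  (forall mu : probability (measurableTypeR R) R, mu [set 0] = 0%E ->
    forall (dT : measure_display) (T : measurableType dT)
      (P : probability T R) (beta : nat -> {RV P >-> R}),
    iid_with_law beta mu -> achieves_rate m M beta ->
    forall A : set R, measurable A -> mu A = arcsine_prob m M A).
Proof.
split=> [dT T P beta|mu _ dT T P beta [indep law] ach A mA].
  exact: arcsine_achieves_rate.
have idl t B : measurable B -> distribution P (beta t) B = distribution P (beta 0%N) B.
  by move=> mB; rewrite !law.
(* [arcsine_prob] is registered as a measure only; the law of [arc_rv] is a probability with the
   same values, which [equalizing_law_unique] can take as its second law. *)
rewrite -(law 0%N)// -distribution_arc_rv//.
apply: (equalizing_law_unique hm hmM) => //.
- by move=> lam lamI; exact: (law_ln_factor hm hmM indep idl ach lamI).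
- exact: equalizing_arcsine.
- by move=> x xI; exact: (law_set1 hm hmM ach xI).
- move=> x _; apply: etrans (distribution_arc_rv hmM (measurable_set1 x)) _; exact: arcsine_no_atom.
Qed.
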